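(* Let $d\ge 1$ be an integer, let $(X,\nu)$ be a $\sigma$-finite measure space, and let $L=(L_1,\ldots,L_d)$ be a system of non-negative self-adjoint operators on $L^2(X,\nu)$ which commute strongly. Assume that for every $r=1,\ldots,d$: (1) for all $1\le p\le\infty$ and all $t>0$, $\|e^{-tL_r}f\|_{L^p(X,\nu)}\le\|f\|_{L^p(X,\nu)}$ for $f\in L^p(X,\nu)\cap L^2(X,\nu)$; (2) $E_{L_r}(\{0\})=0$, where $E_{L_r}$ is the spectral measure of $L_r$. Then for each $r=1,\ldots,d$ and each $\sigma>0$, the operator $L_r^{\sigma}(L_1+\cdots+L_d)^{-\sigma}$ is bounded on $L^p(X,\nu)$ for all $1<p<\infty$. Moreover, $$\max_{r=1,\ldots,d}\big\|L_r^{\sigma}(L_1+\cdots+L_d)^{-\sigma}\big\|_{L^p(X,\nu)\to L^p(X,\nu)}\le C_{p,\sigma},$$ where the constant $C_{p,\sigma}$ depends only on $p$ and $\sigma$; in particular, it is independent of $d$.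
   Context: Self-adjoint operators $L_1,\ldots,L_d$ commute strongly if their spectral projections commute pairwise. In that case there is a unique joint spectral measure $E$ on $[0,\infty)^d$ with $L_r=\int_{[0,\infty)^d}\lambda_r\,dE(\lambda)$ for each $r$. For a Borel function $m$ one sets $m(L)=\int m(\lambda)\,dE(\lambda)$ on the domain $\{f\in L^2(X,\nu):\int|m|^2\,dE_{f,f}<\infty\}$, where $E_{f,f}(\cdot)=\langle E(\cdot)f,f\rangle$. Under assumption (2) the measure $E$ is concentrated on $(0,\infty)^d$, so $m$ need only be defined there. The operator $L_r^{\sigma}(L_1+\cdots+L_d)^{-\sigma}$ means $m(L)$ with $m(\lambda)=\lambda_r^\sigma(\lambda_1+\cdots+\lambda_d)^{-\sigma}$, $\lambda\in(0,\infty)^d$; it is bounded on $L^2(X,\nu)$ because $|m|\le 1$. Boundedness on $L^p(X,\nu)$ of an operator defined on $L^2(X,\nu)$ means that its restriction to the dense subspace $L^p(X,\nu)\cap L^2(X,\nu)$ of $L^p(X,\nu)$ has a (unique) bounded extension to $L^p(X,\nu)$. The $L^p\to L^p$ norm is the norm of this extension. *)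

(* Defs.v *)
From HB Require Import structures.
From mathcomp Require Import all_boot all_order all_algebra.
From mathcomp Require Import all_classical all_reals all_analysis.
From mathcomp Require Import complex.

Set Implicit Arguments.
Unset Strict Implicit.
Unset Printing Implicit Defensive.

Import Order.TTheory GRing.Theory Num.Theory.
Import numFieldNormedType.Exports.

Local Open Scope classical_set_scope.
Local Open Scope ring_scope.
Local Open Scope complex_scope.

(* [mu] is only required to be a set function, so that the spectral
   distribution [spectral_dist E f] below can be integrated against.  Values
   are meaningful only for functions integrable in the usual sense. *)
Definition cintegral {d} {T : measurableType d} {R : realType}
    (mu : set T -> \bar R) (f : T -> R[i]) : R[i] :=
  fine (\int[mu]_x (complex.Re (f x))%:E) +i*
  fine (\int[mu]_x (complex.Im (f x))%:E).

Section Operators.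
Context {dX} {X : measurableType dX} {R : realType}.
Variable nu : {measure set X -> \bar R}.

Definition cmeasurable (f : X -> R[i]) : Prop :=
  measurable_fun setT (fun x => complex.Re (f x)) /\
  measurable_fun setT (fun x => complex.Im (f x)).

Definition Lpnorm (p : \bar R) (f : X -> R[i]) : \bar R :=
  Lnorm nu p (fun x => (ComplexField.Normc.normc (f x))%:E).

(* Elements of L^p(X, nu) are represented by functions; identities between
   elements are stated as equalities nu-almost everywhere. *)
Definition Lp (p : \bar R) : set (X -> R[i]) :=
  [set f | cmeasurable f /\ (Lpnorm p f < +oo)%E].

Definition inner (f g : X -> R[i]) : R[i] :=
  cintegral nu (fun x => f x * conjc (g x)).

(* The values of an operator outside its domain are irrelevant. *)
Record operator := Operator {
  domain : set (X -> R[i]) ;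
  opfun :> (X -> R[i]) -> (X -> R[i]) }.

Definition operator_eq (S T : operator) : Prop :=
  domain S = domain T /\
  (forall f, domain S f -> S f = T f %[ae nu]).

(* A linear operator in L^p(X, nu), defined on a linear subspace. *)
Definition linear_operator (p : \bar R) (T : operator) : Prop :=
  [/\ domain T `<=` Lp p,
      domain T (fun=> 0),
      forall f g, domain T f -> cmeasurable g -> f = g %[ae nu] ->
        domain T g /\ T f = T g %[ae nu],
      forall f, domain T f -> Lp p (T f) &
      forall (a : R[i]) f g, domain T f -> domain T g ->
        domain T (fun x => a * f x + g x) /\
        T (fun x => a * f x + g x) = (fun x => a * T f x + T g x) %[ae nu]].

Definition densely_defined (T : operator) : Prop :=
  forall f, Lp 2%:E f -> forall e : R, 0 < e ->
    exists2 g, domain T g & (Lpnorm 2%:E (fun x => f x - g x)%R < e%:E)%E.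

(* The last clause says that the graph of T is the graph of its adjoint. *)
Definition self_adjoint (T : operator) : Prop :=
  [/\ linear_operator 2%:E T, densely_defined T &
      forall g h, Lp 2%:E g -> Lp 2%:E h ->
        ((forall f, domain T f -> inner (T f) g = inner f h) <->
         (domain T g /\ T g = h %[ae nu]))].

(* On R[i], 0 <= z means that z is real and non-negative. *)
Definition nonneg_operator (T : operator) : Prop :=
  forall f, domain T f -> 0 <= inner (T f) f.

Definition orthogonal_projection (P : (X -> R[i]) -> (X -> R[i])) : Prop :=
  [/\ linear_operator 2%:E (Operator (Lp 2%:E) P),
      forall f, Lp 2%:E f -> P (P f) = P f %[ae nu] &
      forall f g, Lp 2%:E f -> Lp 2%:E g -> inner (P f) g = inner f (P g)].

Section SpectralMeasure.
Context {dO} {Omega : measurableType dO}.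
Implicit Type E : set Omega -> (X -> R[i]) -> (X -> R[i]).

(* Countable additivity is in the strong operator topology. *)
Definition spectral_measure E : Prop :=
  [/\ forall A, measurable A -> orthogonal_projection (E A),
      forall f, Lp 2%:E f -> E setT f = f %[ae nu] &
      forall F : nat -> set Omega, (forall k, measurable (F k)) ->
        trivIset setT F -> forall f, Lp 2%:E f ->
        Lpnorm 2%:E (fun x => E (\bigcup_k F k) f x - \sum_(k < n) E (F k) f x)
          @[n --> \oo] --> 0%E].

(* E_{f,f}(A) = <E(A) f, f>, which is real. *)
Definition spectral_dist E (f : X -> R[i]) : set Omega -> \bar R :=
  fun A => (complex.Re (inner (E A f) f))%:E.

Definition spectral_domain E (m : Omega -> R[i]) : set (X -> R[i]) :=
  [set f | Lp 2%:E f /\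
    (\int[spectral_dist E f]_l
       (ComplexField.Normc.normc (m l) ^+ 2)%R%:E < +oo)%E].

(* \int m dE_{f,g} for f, g in the domain, where the complex measure
   E_{f,g}(A) = <E(A) f, g> is expressed through E_{u,u} by polarization. *)
Definition spectral_form E (m : Omega -> R[i]) (f g : X -> R[i]) : R[i] :=
  4^-1 * \sum_(k < 4)
    'i ^+ k * cintegral (spectral_dist E (fun x => f x + 'i ^+ k * g x)) m.

(* \int m dE: the element h with <h, g> = \int m dE_{f,g} for all g in the
   (dense) domain is unique up to nu-almost everywhere equality. *)
Definition spectral_integral E (m : Omega -> R[i]) : operator :=
  Operator (spectral_domain E m)
    (fun f => xget (fun=> 0)
      [set h | Lp 2%:E h /\
        forall g, spectral_domain E m g -> inner h g = spectral_form E m f g]).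

End SpectralMeasure.

Definition spectral_measure_of (T : operator)
    (E : set (measurableTypeR R) -> (X -> R[i]) -> (X -> R[i])) : Prop :=
  spectral_measure E /\
  operator_eq T (spectral_integral E (fun l : measurableTypeR R => l%:C)).

Definition commute_strongly (d : nat)
    (E : 'I_d -> set (measurableTypeR R) -> (X -> R[i]) -> (X -> R[i])) : Prop :=
  forall (r s : 'I_d) A B, measurable A -> measurable B ->
    forall f, Lp 2%:E f -> E r A (E s B f) = E s B (E r A f) %[ae nu].

(* A spectral measure on [0, +oo[^d is a spectral measure on R^d which is
   concentrated on [0, +oo[^d. *)
Definition joint_spectral_measure (d : nat) (L : 'I_d -> operator)
    (E : set (d.-tuple (measurableTypeR R)) -> (X -> R[i]) -> (X -> R[i])) : Prop :=
  [/\ spectral_measure E,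
      forall f, Lp 2%:E f ->
        E [set l | forall r, 0 <= tnth l r :> R] f = f %[ae nu] &
      forall r, operator_eq (L r)
        (spectral_integral E
           (fun l : d.-tuple (measurableTypeR R) => (tnth l r : R)%:C))].

Definition semigroup
    (E : set (measurableTypeR R) -> (X -> R[i]) -> (X -> R[i])) (t : R) :
    operator :=
  spectral_integral E (fun l : measurableTypeR R => (expR (- (t * l)))%:C).

(* Only its values on ]0, +oo[^d are meaningful. *)
Definition riesz_multiplier (d : nat) (r : 'I_d) (sigma : R)
    (l : d.-tuple (measurableTypeR R)) : R[i] :=
  (((tnth l r : R) `^ sigma) *
   (\sum_(s < d) (tnth l s : R)) `^ (- sigma))%:C.

Definition Lp_bounded_extension (p : \bar R) (T S : operator) : Prop :=
  [/\ linear_operator p S,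
      domain S = Lp p,
      exists K : R, forall f, Lp p f ->
        (Lpnorm p (S f) <= K%:E * Lpnorm p f)%E,
      Lp p `&` Lp 2%:E `<=` domain T &
      forall f, Lp p f -> Lp 2%:E f -> S f = T f %[ae nu]].

Definition Lp_opnorm (p : \bar R) (S : operator) : \bar R :=
  ereal_sup [set Lpnorm p (S f) | f in [set f | Lp p f /\ (Lpnorm p f <= 1)%E]].

End Operators.

Arguments operator {dX} X R.

(* Main.v *)
(* Let 1 < p <= 2 with conjugate exponent q; exponents above 2 follow by symmetry.
   A convexity argument yields a function Phi on C x C with
     0 <= Phi(z, e) <= C_p (|z|^p + |e|^q),
     Phi(-z, e) = Phi(z, e) + 2 Re (z * conj e),
   and with the Jensen inequality for complex weights of total mass at most 1.
   Hence \int Phi(T f, T g) <= \int Phi(f, g) for every linear contraction T of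
   L^1 and L^oo, in particular for every exp(-t L_s); the joint calculus is
   matched with the semigroups of the L_s through their resolvents.

   Apply the contractions exp(-w_s L_s / n), s = 1..d, cyclically n^2 times to f
   and g.  Summing the decrease of Re <f, g> over the steps with s = r only,
   the decrease of \int Phi(-f, g) bounds <m(L) f, g> by C_p (|f|_p^p + |g|_q^q),
   where m is a geometric sum converging to w_r l_r / \sum_s w_s l_s.  Only the
   total energy enters, so the bound does not depend on d or on the weights w.

   Taking w_r = 1 + v and w_s = 1 otherwise gives (1 + v) T / (1 + v T), where
   T = l_r / \sum_s l_s, and T^s with 0 < s < 1 is a limit of convex combinations
   of these.  Duality turns the form bound into an L^p bound, and T^sigma is a
   power of T^(sigma / n) for n > sigma. *)

From HB Require Import structures.
Require Import Defs.
From mathcomp Require Import finmap.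
From mathcomp Require Import all_boot all_order all_algebra.
From mathcomp Require Import all_classical all_reals all_analysis.
From mathcomp Require Import measurable_realfun ess_sup_inf hoelder complex.
From mathcomp Require Import ring lra.

Import Order.TTheory GRing.Theory Num.Theory.
Import numFieldNormedType.Exports.

Local Open Scope classical_set_scope.
Local Open Scope ring_scope.
Local Open Scope complex_scope.

Set Implicit Arguments.
Unset Strict Implicit.
Unset Printing Implicit Defensive.

(** * Complex arithmetic *)

(** The semigroups need not be positive, so on step functions a contraction of L^1 and L^oo is
    controlled through two facts only: the images of disjoint indicators have moduli summing to at
    most 1 almost everywhere, and no image has a larger L^1 norm than its indicator. The first fact
    feeds a Jensen inequality with complex weights, which is why the Bellman function is a supremum
    invariant under a common rotation of its arguments; the second one restores the integral. Finite
    time steps replace time derivatives, so this single inequality drives the flow and no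
    differentiability of the orbits enters. The energy bounds a pairing by a sum of moments, not by
    a product of norms; a scaled test function in the duality step recovers homogeneity. Symbols
    with a given form bound are convex and stable under bounded pointwise limits, but the bound does
    not pass to products. The weighted ratios are normalised to be 1 at T = 1, so all their averages
    keep one constant; this reaches the exponents below 1, and larger ones cost one factor of the
    operator bound per composition. *)

Notation normc := ComplexField.Normc.normc.

HB.lock Definition nsq {R : realType} (z : R[i]) : R :=
  complex.Re z ^+ 2 + complex.Im z ^+ 2.
(** Re (x * conj y), the inner product of C as a real plane. *)
HB.lock Definition dot {R : realType} (x y : R[i]) : R :=
  complex.Re x * complex.Re y + complex.Im x * complex.Im y.

Section ComplexPlane.
Context {R : realType}.
Implicit Types (x y z : R[i]) (a b : R).

Lemma ReD x y : complex.Re (x + y) = complex.Re x + complex.Re y.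
Proof. by case: x y => [? ?] []. Qed.
Lemma ImD x y : complex.Im (x + y) = complex.Im x + complex.Im y.
Proof. by case: x y => [? ?] []. Qed.
Lemma ReN x : complex.Re (- x) = - complex.Re x.
Proof. by case: x. Qed.
Lemma ImN x : complex.Im (- x) = - complex.Im x.
Proof. by case: x. Qed.
Lemma ReM x y : complex.Re (x * y) =
  complex.Re x * complex.Re y - complex.Im x * complex.Im y.
Proof. by case: x y => [? ?] []. Qed.
Lemma ImM x y : complex.Im (x * y) =
  complex.Re x * complex.Im y + complex.Im x * complex.Re y.
Proof. by case: x y => [? ?] []. Qed.

Definition ReImE := (ReD, ImD, ReN, ImN, ReM, ImM).

Lemma complex_eqP x y : complex.Re x = complex.Re y ->
  complex.Im x = complex.Im y -> x = y.
Proof. by case: x y => [? ?] [? ?] /= -> ->. Qed.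

Lemma Re_sum (I : Type) (s : seq I) (P : pred I) (F : I -> R[i]) :
  complex.Re (\sum_(i <- s | P i) F i) = \sum_(i <- s | P i) complex.Re (F i).
Proof. by apply: (big_morph (@complex.Re R) ReD). Qed.

Lemma normcE z : normc z = Num.sqrt (nsq z). Proof. by rewrite nsq.unlock; case: z. Qed.
Lemma nsq_ge0 z : 0 <= nsq z. Proof. by rewrite nsq.unlock addr_ge0 ?sqr_ge0. Qed.
Lemma normc_ge0 z : 0 <= normc z. Proof. by rewrite normcE sqrtr_ge0. Qed.
Lemma sqr_normc z : normc z ^+ 2 = nsq z.
Proof. by rewrite normcE sqr_sqrtr// nsq_ge0. Qed.
Lemma nsqD x y : nsq (x + y) = nsq x + 2 * dot x y + nsq y.
Proof. by rewrite nsq.unlock dot.unlock !ReImE; ring. Qed.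
Lemma nsqM x y : nsq (x * y) = nsq x * nsq y.
Proof. by rewrite nsq.unlock !ReImE; ring. Qed.
Lemma nsqN x : nsq (- x) = nsq x.
Proof. by rewrite nsq.unlock !ReImE; ring. Qed.
Lemma nsq_real a : nsq a%:C = a ^+ 2.
Proof. by rewrite nsq.unlock /= expr0n addr0. Qed.
Lemma nsq0 : nsq (0 : R[i]) = 0. Proof. by rewrite nsq.unlock /= expr0n addr0. Qed.
Lemma dotxx x : dot x x = nsq x. Proof. by rewrite nsq.unlock dot.unlock. Qed.
Lemma dotC x y : dot x y = dot y x. Proof. by rewrite dot.unlock; ring. Qed.
Lemma dotDl x y z : dot (x + y) z = dot x z + dot y z.
Proof. by rewrite dot.unlock !ReImE; ring. Qed.
Lemma dotDr x y z : dot z (x + y) = dot z x + dot z y.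
Proof. by rewrite dot.unlock !ReImE; ring. Qed.
Lemma dotNl x y : dot (- x) y = - dot x y.
Proof. by rewrite dot.unlock !ReImE; ring. Qed.
Lemma dotNr x y : dot x (- y) = - dot x y.
Proof. by rewrite dot.unlock !ReImE; ring. Qed.
Lemma dotZl a x y : dot (a%:C * x) y = a * dot x y.
Proof. by rewrite dot.unlock !ReImE /=; ring. Qed.
Lemma dotZr a x y : dot x (a%:C * y) = a * dot x y.
Proof. by rewrite dot.unlock !ReImE /=; ring. Qed.
Lemma dot0l x : dot 0 x = 0. Proof. by rewrite dot.unlock /= !mul0r addr0. Qed.
Lemma dot0r x : dot x 0 = 0. Proof. by rewrite dot.unlock /= !mulr0 addr0. Qed.
Lemma dotMl x y z : dot (x * y) z = dot y (conjc x * z).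
Proof. by case: x y z => [a b] [c d] [e f]; rewrite dot.unlock !ReImE /=; ring. Qed.
Lemma dot_suml (I : Type) (s : seq I) (P : pred I) (F : I -> R[i]) y :
  dot (\sum_(i <- s | P i) F i) y = \sum_(i <- s | P i) dot (F i) y.
Proof.
by apply: (big_morph (dot^~ y)) => [x z|]; rewrite ?dotDl ?dot0l.
Qed.
Lemma dot_sumr (I : Type) (s : seq I) (P : pred I) (F : I -> R[i]) y :
  dot y (\sum_(i <- s | P i) F i) = \sum_(i <- s | P i) dot y (F i).
Proof. by rewrite dotC dot_suml; apply: eq_bigr => i _; rewrite dotC. Qed.

Lemma sqr_dot_le x y : dot x y ^+ 2 <= nsq x * nsq y.
Proof.
rewrite -subr_ge0 [leRHS](_ : _ =
  (complex.Re x * complex.Im y - complex.Im x * complex.Re y) ^+ 2) ?sqr_ge0//.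
by rewrite nsq.unlock dot.unlock; ring.
Qed.

Lemma dot_le x y : dot x y <= normc x * normc y.
Proof.
apply: le_trans (ler_norm _) _.
rewrite -(@ler_pXn2r _ 2) ?nnegrE ?mulr_ge0 ?normc_ge0//.
by rewrite exprMn !sqr_normc real_normK ?num_real// sqr_dot_le.
Qed.

Lemma normcM x y : normc (x * y) = normc x * normc y.
Proof. exact: ComplexField.Normc.normcM. Qed.
Lemma normcD x y : normc (x + y) <= normc x + normc y.
Proof. exact: le_normcD. Qed.
Lemma normc_opp x : normc (- x) = normc x. Proof. exact: normcN. Qed.
Lemma normc_real a : normc a%:C = `|a|.
Proof. by rewrite normcE nsq_real sqrtr_sqr. Qed.
Lemma normc0 : normc (0 : R[i]) = 0. Proof. exact: ComplexField.Normc.normc0. Qed.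
Lemma normc_eq0 x : normc x = 0 -> x = 0.
Proof. exact: ComplexField.Normc.eq0_normc. Qed.
Lemma normc_conj x : normc (conjc x) = normc x.
Proof. by case: x => a b /=; rewrite sqrrN. Qed.
Lemma normc_i : normc ('i%C : R[i]) = 1.
Proof. by rewrite /= expr0n expr1n add0r sqrtr1. Qed.
Lemma conjc_unit x : normc x = 1 -> conjc x * x = 1.
Proof.
move=> x1; have : nsq x = 1 by rewrite -sqr_normc x1 expr1n.
case: x x1 => a b _; rewrite nsq.unlock /= => ab.
by apply: complex_eqP; rewrite !ReImE /=; [rewrite -ab|]; ring.
Qed.
Lemma normc_subC x y : normc (x - y) = normc (y - x).
Proof. by rewrite -normc_opp opprB. Qed.
Lemma normc_sum (I : Type) (s : seq I) (P : pred I) (F : I -> R[i]) :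
  normc (\sum_(i <- s | P i) F i) <= \sum_(i <- s | P i) normc (F i).
Proof.
apply: (big_ind2 (fun x a => normc x <= a)) => [|x a y b xa yb|i _//].
  by rewrite normc0.
by apply: le_trans (normcD _ _) _; exact: lerD.
Qed.
Lemma Re_le_normc x : `|complex.Re x| <= normc x.
Proof.
by rewrite normcE nsq.unlock -sqrtr_sqr ler_wsqrtr// lerDl sqr_ge0.
Qed.
Lemma Im_le_normc x : `|complex.Im x| <= normc x.
Proof.
by rewrite normcE nsq.unlock -sqrtr_sqr ler_wsqrtr// lerDr sqr_ge0.
Qed.
Lemma normc_le_ReIm x : normc x <= `|complex.Re x| + `|complex.Im x|.
Proof.
rewrite -(@ler_pXn2r _ 2) ?nnegrE ?addr_ge0 ?normc_ge0//.
rewrite sqr_normc nsq.unlock sqrrD !real_normK ?num_real//.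
by rewrite addrAC lerDl mulrn_wge0// mulr_ge0.
Qed.

Lemma polar_decomp x : exists2 u, normc u = 1 & x = (normc x)%:C * u.
Proof.
have [x0|x0] := eqVneq (normc x) 0.
  exists 1; first by rewrite ComplexField.Normc.normc1.
  by rewrite (normc_eq0 x0) normc0 mul0r.
exists ((normc x)^-1%:C * x).
  by rewrite normcM normc_real ger0_norm ?invr_ge0 ?normc_ge0// mulVf.
by rewrite mulrA -rmorphM mulfV// mul1r.
Qed.

Lemma powR_normc x p : normc x `^ p = nsq x `^ (p / 2).
Proof. by rewrite normcE -powR12_sqrt ?nsq_ge0// -powRrM mulrC. Qed.

End ComplexPlane.

(** * The Bellman function *)

Section Tangent.
Context {R : realType}.
Implicit Types (a b c t : R).

Let quad a b c t := a + 2 * b * t + c * t ^+ 2.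

Let is_derive_quad a b c t :
  is_derive t 1 (quad a b c) (2 * (b + c * t)).
Proof.
have -> : quad a b c = (cst a \+ ((2 * b) \*: id) \+ (c \*: (id ^+ 2)))%R.
  by apply/funext => u /=; rewrite /quad.
apply: is_derive_eq.
by rewrite /GRing.scale /= ; ring.
Qed.

Let is_derive_quad_powR r a b c t : 0 < quad a b c t ->
  is_derive t 1 (fun u => quad a b c u `^ r)
    (2 * r * (quad a b c t `^ (r - 1)) * (b + c * t)).
Proof.
move=> q0.
have := @is_derive1_comp _ (fun u : R => u `^ r) (quad a b c) t _ _
  (is_derive1_powR r q0) (is_derive_quad a b c t).
move=> H; apply: (is_derive_eq H).
by rewrite /GRing.scale /=; ring.
Qed.

(** The function f(t) = k A(t)^r - B(t)^r of the two quadratics is convex, so its value at 1 lies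
    above its tangent at 0. The Cauchy-Schwarz hypothesis on A gives (A^r)'' >= 2 r (2 r - 1) a2
    A^(r-1), while (B^r)'' <= 2 r b2 B^(r-1) <= 4 r a2 A^(r-1) because r <= 1 and A <= B. The
    condition 2 <= k (2 r - 1) compares the two. *)
Lemma tangent_powR_quad (r k a0 a1 a2 b0 b1 b2 : R) :
  2^-1 < r -> r <= 1 -> 2 <= k * (2 * r - 1) -> 0 <= a2 -> b2 <= 2 * a2 ->
  (forall t, 0 < a0 + 2 * a1 * t + a2 * t ^+ 2) ->
  (forall t, a0 + 2 * a1 * t + a2 * t ^+ 2 <= b0 + 2 * b1 * t + b2 * t ^+ 2) ->
  (forall t, (a1 + a2 * t) ^+ 2 <= a2 * (a0 + 2 * a1 * t + a2 * t ^+ 2)) ->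
  k * a0 `^ r - b0 `^ r +
    2 * r * (k * a0 `^ (r - 1) * a1 - b0 `^ (r - 1) * b1) <=
  k * (a0 + 2 * a1 + a2) `^ r - (b0 + 2 * b1 + b2) `^ r.
Proof.
move=> r2 r1 kr a2ge0 b2a2 A0 AB A1.
pose A := quad a0 a1 a2; pose B := quad b0 b1 b2.
have B0 t : 0 < B t by apply: lt_le_trans (A0 t) (AB t).
pose f t := k * (A t `^ r) - B t `^ r.
pose df t := k * (2 * r * (A t `^ (r - 1)) * (a1 + a2 * t)) -
             2 * r * (B t `^ (r - 1)) * (b1 + b2 * t).
pose ddf t := k * (2 * r * (2 * (r - 1) * (A t `^ (r - 1 - 1)) * (a1 + a2 * t) * (a1 + a2 * t) + (A t `^ (r - 1)) * a2)) -
  2 * r * (2 * (r - 1) * (B t `^ (r - 1 - 1)) * (b1 + b2 * t) * (b1 + b2 * t) + (B t `^ (r - 1)) * b2).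
have fE t : is_derive t 1 f (df t).
  have dA := is_derive_quad_powR r (A0 t); have dB := is_derive_quad_powR r (B0 t).
  have -> : f = ((k \*: (fun u => A u `^ r)) - (fun u => B u `^ r))%R.
    by apply/funext => u.
  by apply: is_derive_eq; rewrite /GRing.scale /=.
have lin a b t : is_derive t 1 (fun u : R => a + b * u) b.
  have -> : (fun u : R => a + b * u) = (cst a \+ (b \*: id))%R by apply/funext.
  by apply: is_derive_eq; rewrite /GRing.scale /=; ring.
have dfE t : is_derive t 1 df (ddf t).
  have dA := is_derive_quad_powR (r - 1) (A0 t).
  have dB := is_derive_quad_powR (r - 1) (B0 t).
  have la := lin a1 a2 t; have lb := lin b1 b2 t.
  have -> : df = ((k * (2 * r)) \*: ((fun u => A u `^ (r - 1)) * (fun u => a1 + a2 * u)) -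
      (2 * r) \*: ((fun u => B u `^ (r - 1)) * (fun u => b1 + b2 * u)))%R.
    by apply/funext => u; rewrite -[RHS]/(k * (2 * r) * (A u `^ (r - 1) * (a1 + a2 * u)) - 2 * r * (B u `^ (r - 1) * (b1 + b2 * u))) /df; ring.
  apply: is_derive_eq; rewrite /GRing.scale /= /ddf.
  by rewrite -/(A t) -/(B t); ring.
have ddf0 t : 0 <= ddf t.
  have Ap : 0 < A t `^ (r - 1) by apply: powR_gt0; exact: A0.
  have Bp : 0 < B t `^ (r - 1) by apply: powR_gt0; exact: B0.
  have App : A t `^ (r - 1) = A t * (A t `^ (r - 1 - 1)).
    have {1}-> : r - 1 = 1 + (r - 1 - 1) by ring.
    rewrite (powRD (x := A t) (r := 1)); last by rewrite (gt_eqF (A0 t)) implybT.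
    by rewrite powRr1//; exact/ltW/A0.
  have BA : B t `^ (r - 1) <= A t `^ (r - 1).
    have -> : r - 1 = - (1 - r) by ring.
    rewrite !powRN lef_pV2 ?posrE ?powR_gt0 ?A0 ?B0//.
    by apply: ge0_ler_powR; rewrite ?nnegrE ?subr_ge0//;
      [exact/ltW/A0|exact/ltW/B0|exact: AB].
  have A2p : 0 <= A t `^ (r - 1 - 1) by apply: powR_ge0.
  have B2p : 0 <= B t `^ (r - 1 - 1) by apply: powR_ge0.
  have k0 : 0 < k.
    rewrite -(@pmulr_lgt0 _ (2 * r - 1)); first by apply: lt_le_trans kr.
    by rewrite subr_gt0; move: r2; lra.
  have h1 : 2 * (r - 1) * (A t `^ (r - 1) * a2) <= 
      2 * (r - 1) * ((A t `^ (r - 1 - 1)) * ((a1 + a2 * t) * (a1 + a2 * t))).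
    apply: ler_wnM2l; first by move: r1; lra.
    rewrite App (mulrC (A t)) -(mulrA _ _ a2).
    apply: ler_wpM2l => //.
    by have := A1 t; rewrite expr2 (mulrC (A t)).
  have h2 : 2 * (r - 1) * (B t `^ (r - 1 - 1) * ((b1 + b2 * t) * (b1 + b2 * t))) <= 0.
    apply: mulr_le0_ge0; first by move: r1; lra.
    by apply: mulr_ge0 => //; rewrite -expr2 sqr_ge0.
  have h3 : B t `^ (r - 1) * b2 <= A t `^ (r - 1) * (2 * a2).
    have: B t `^ (r - 1) * (2 * a2) <= A t `^ (r - 1) * (2 * a2).
      by apply: ler_wpM2r => //; rewrite mulr_ge0.
    by apply: le_trans; apply: ler_wpM2l b2a2; exact: ltW.
  rewrite /ddf.
  have rp : 0 <= 2 * r by move: r2; lra.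
  have h4 : k * (2 * r) * ((2 * r - 1) * (A t `^ (r - 1) * a2)) <=
    k * (2 * r * (2 * (r - 1) * A t `^ (r - 1 - 1) * (a1 + a2 * t) * (a1 + a2 * t) +
     A t `^ (r - 1) * a2)).
    rewrite -[leLHS]mulrA.
    apply: ler_wpM2l; first exact: ltW.
    apply: ler_wpM2l => //.
    by move: h1; lra.
  have h5 : 2 * r * (2 * (r - 1) * B t `^ (r - 1 - 1) * (b1 + b2 * t) * (b1 + b2 * t) +
     B t `^ (r - 1) * b2) <= 2 * r * (A t `^ (r - 1) * (2 * a2)).
    apply: ler_wpM2l => //.
    by move: h2 h3; lra.
  have h6 : 2 * r * (A t `^ (r - 1) * (2 * a2)) <= k * (2 * r) * ((2 * r - 1) * (A t `^ (r - 1) * a2)).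
    have : 0 <= A t `^ (r - 1) * a2 by rewrite mulr_ge0// ltW.
    set u := A t `^ _ * a2 => u0.
    have -> : 2 * r * (A t `^ (r - 1) * (2 * a2)) = 2 * (2 * r * u) by rewrite /u; ring.
    have -> : k * (2 * r) * ((2 * r - 1) * u) = k * (2 * r - 1) * (2 * r * u) by ring.
    by apply: ler_wpM2r => //; rewrite mulr_ge0.
  by rewrite subr_ge0; apply: le_trans h5 (le_trans h6 h4).
have cont (g dg : R -> R) : (forall t, is_derive t 1 g (dg t)) ->
    forall a b, {within `[a, b], continuous g}.
  move=> H a b; apply: continuous_subspaceT => x.
  apply/differentiable_continuous/derivable1_diffP.
  exact: (@ex_derive _ _ _ _ _ _ _ (H x)).
(* Two mean value steps: f 1 - f 0 is the slope at some c in ]0, 1[, and the slope does not decrease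
   from 0 to c. *)
have [c c01] := MVT ltr01 (fun t _ => fE t) (cont _ _ fE 0 1).
have /andP[c0 c1] : 0 < c < 1 by move: c01; rewrite in_itv.
have [e] := MVT c0 (fun t _ => dfE t) (cont _ _ dfE 0 c).
rewrite in_itv /= => /andP[e0 ec] H1 H2.
have dfc : df 0 <= df c.
  by rewrite -subr_ge0 H1 subr0 mulr_ge0// ltW.
have : f 0 + df 0 <= f 1.
  by rewrite -lerBrDl H2 subr0 mulr1.
have -> : f 1 = k * (a0 + 2 * a1 + a2) `^ r - (b0 + 2 * b1 + b2) `^ r.
  by rewrite /f /A /B /quad !expr1n !mulr1.
apply: le_trans.
have -> : f 0 = k * a0 `^ r - b0 `^ r.
  by rewrite /f /A /B /quad !expr0n /= !mulr0 !addr0.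
have -> : df 0 = k * (2 * r * a0 `^ (r - 1) * a1) - 2 * r * b0 `^ (r - 1) * b1.
  by rewrite /df /A /B /quad !expr0n /= !mulr0 !addr0.
rewrite lerD2l le_eqVlt; apply/orP; left; apply/eqP.
by ring.
Qed.

End Tangent.

Section PowerInequalities.
Context {R : realType}.
Implicit Types (a b r p q : R).

(** The shares c / (a + b) lie in [0, 1], where t <= t^r, and the two shares add up to 1. *)
Lemma powRD_le a b r : 0 < r -> r <= 1 -> 0 <= a -> 0 <= b ->
  (a + b) `^ r <= a `^ r + b `^ r.
Proof.
move=> r0 r1 a0 b0.
have [ab0|ab0] := eqVneq (a + b) 0.
  by rewrite ab0 powR0 ?gt_eqF// addr_ge0 ?powR_ge0.
have abp : 0 < a + b by rewrite lt_def ab0 addr_ge0.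
have H c : 0 <= c -> c <= a + b -> c / (a + b) * (a + b) `^ r <= c `^ r.
  move=> c0 cab; have [->|cn0] := eqVneq c 0; first by rewrite !mul0r powR_ge0.
  have cp : 0 < c by rewrite lt_def cn0.
  rewrite -[leRHS](_ : (c / (a + b)) `^ r * (a + b) `^ r = _); last first.
    by rewrite -powRM ?divfK// ?divr_ge0// ltW.
  apply: ler_wpM2r; first exact: powR_ge0.
  by apply: ger1_powR => //; rewrite divr_gt0//= ler_pdivrMr// mul1r.
have Ha := H a a0 _; have Hb := H b b0 _.
apply: le_trans (lerD (Ha _) (Hb _)); rewrite ?lerDl ?lerDr//.
by rewrite -mulrDl -mulrDl mulfV// mul1r.
Qed.

Lemma powRD_le2 a b p : 0 <= p -> 0 <= a -> 0 <= b ->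
  (a + b) `^ p <= 2 `^ p * (a `^ p + b `^ p).
Proof.
move=> p0; wlog : a b / a <= b => [H a0 b0|ab a0 b0].
  by have /orP[ab|ab] := le_total a b; [|rewrite addrC (addrC (a `^ p))]; exact: H.
apply: (@le_trans _ _ ((2 * b) `^ p)).
  by apply: ge0_ler_powR; rewrite ?nnegrE ?mulr_ge0 ?addr_ge0//; move: ab; lra.
by rewrite powRM// ler_wpM2l ?powR_ge0// lerDr powR_ge0.
Qed.

Lemma young_powR p a b : 1 < p -> 0 <= a -> 0 <= b ->
  a * b <= a `^ p + b `^ (p / (p - 1)).
Proof.
move=> p1 a0 b0; have p0 : 0 < p by apply: lt_trans p1.
have pm1 : 0 < p - 1 by rewrite subr_gt0.
have q0 : 0 < p / (p - 1) by rewrite divr_gt0.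
apply: le_trans (conjugate_powR a0 b0 p0 q0 _) _.
  by rewrite invf_div; field; rewrite ?gt_eqF.
apply: lerD; rewrite ler_pdivrMr// ler_peMr ?powR_ge0//; first exact: ltW.
by rewrite ler_pdivlMr// mul1r lerBlDr lerDl.
Qed.

End PowerInequalities.

Section Bellman.
Context {R : realType}.
Variable p : R.
Hypotheses (p1 : 1 < p) (p2 : p <= 2).
Implicit Types (x y z e : R[i]) (eps : R).

Let r := p / 2.
Let q := p / (p - 1).
Let k := 2 / (p - 1).

Let r_gt2 : 2^-1 < r. Proof. by rewrite /r; move: p1; lra. Qed.
Let r_le1 : r <= 1. Proof. by rewrite /r; move: p2; lra. Qed.
Let r_gt0 : 0 < r. Proof. by move: r_gt2; lra. Qed.
Let pm1 : 0 < p - 1. Proof. by rewrite subr_gt0. Qed.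
Let k_ge2 : 2 <= k.
Proof. by rewrite /k ler_pdivlMr//; move: p2; lra. Qed.
Let kr : 2 <= k * (2 * r - 1).
Proof. by rewrite /k /r mulrC (mulrC 2) divfK ?pnatr_eq0// mulrC divfK// gt_eqF. Qed.

(** At eps = 0 this is minus the function (|x|^2 + |y|^2)^(p/2) - k |x|^p evaluated at (x, y + x):
    changing x moves both arguments equally. A positive eps keeps the bases of the powers away from
    0, where t^r need not be smooth. *)
Let G eps y x := k * (eps + nsq x) `^ r - (eps + nsq x + nsq (y + x)) `^ r.

(** On the line x0 + t h the two bases are quadratics in t with leading coefficients |h|^2 and 2
    |h|^2, the case b2 = 2 a2 of the tangent inequality. The witness v is the gradient of G at
    x0. *)
Let G_tangent eps y x0 : 0 < eps ->
  exists v, forall x, G eps y x0 + dot v (x - x0) <= G eps y x.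
Proof.
move=> e0.
pose A := (eps + nsq x0) `^ (r - 1).
pose B := (eps + nsq x0 + nsq (y + x0)) `^ (r - 1).
exists ((2 * r * (k * A - B))%:C * x0 + (- (2 * r * B))%:C * (y + x0)) => x.
have [h ->] : exists h, x = x0 + h by exists (x - x0); rewrite subrKC.
rewrite (_ : x0 + h - x0 = h); last by rewrite addrAC subrr add0r.
have H := @tangent_powR_quad _ r k (eps + nsq x0) (dot x0 h) (nsq h)
  (eps + nsq x0 + nsq (y + x0)) (dot x0 h + dot (y + x0) h) (2 * nsq h)
  r_gt2 r_le1 kr (nsq_ge0 _) (lexx _).
have E t : eps + nsq x0 + 2 * dot x0 h * t + nsq h * t ^+ 2 =
    eps + nsq (x0 + t%:C * h).
  by rewrite nsqD nsqM dotZr nsq_real; ring.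
have F t : eps + nsq x0 + nsq (y + x0) + 2 * (dot x0 h + dot (y + x0) h) * t +
    2 * nsq h * t ^+ 2 = eps + nsq (x0 + t%:C * h) + nsq (y + x0 + t%:C * h).
  by rewrite !nsqD !nsqM !dotZr nsq_real; ring.
have E1 := E 1; have F1 := F 1.
rewrite !(mulr1, expr1n, mul1r) in E1, F1.
rewrite E1 F1 in H.
rewrite /G dotDl !dotZl (addrA y x0 h).
apply: le_trans (H _ _ _).
- rewrite -/A -/B lerD2l le_eqVlt; apply/orP; left; apply/eqP.
  by ring.
- by move=> t; rewrite E ltr_wpDr ?nsq_ge0.
- by move=> t; rewrite E F lerDl nsq_ge0.
- move=> t; rewrite E.
  have -> : dot x0 h + nsq h * t = dot h (x0 + t%:C * h).
    by rewrite dotDr dotZr dotxx (dotC h); ring.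
  apply: le_trans (sqr_dot_le _ _) _.
  by apply: ler_wpM2l; rewrite ?nsq_ge0// lerDr ltW.
Qed.

(** Jensen from the supporting plane at the barycentre X. The missing mass 1 - sum c is placed at
    the point 0, where G is at most 0 up to the regularisation; eps then tends to 0. *)
Let G_jensen (I : finType) (c : I -> R) (x : I -> R[i]) y :
  (forall i, 0 <= c i) -> \sum_i c i <= 1 ->
  G 0 y (\sum_i (c i)%:C * x i) <= \sum_i c i * G 0 y (x i).
Proof.
move=> c0 c1; set X := \sum_i _.
have Geps eps x' : 0 < eps ->
    G 0 y x' - eps `^ r <= G eps y x' <= G 0 y x' + k * eps `^ r.
  move=> e0; rewrite /G !add0r.
  have a1 := powRD_le r_gt0 r_le1 (ltW e0) (nsq_ge0 x').
  have a2 := @powRD_le _ eps (nsq x' + nsq (y + x')) r r_gt0 r_le1 (ltW e0)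
    (addr_ge0 (nsq_ge0 _) (nsq_ge0 _)).
  have a3 : nsq x' `^ r <= (eps + nsq x') `^ r.
    by apply: ge0_ler_powR; rewrite ?nnegrE ?addr_ge0 ?nsq_ge0 ?(ltW r_gt0) ?(ltW e0)// lerDr ltW.
  have a4 : (nsq x' + nsq (y + x')) `^ r <= (eps + (nsq x' + nsq (y + x'))) `^ r.
    by apply: ge0_ler_powR; rewrite ?nnegrE ?addr_ge0 ?nsq_ge0 ?(ltW r_gt0) ?(ltW e0)// lerDr ltW.
  rewrite -!addrA.
  have k0 : 0 <= k by apply: le_trans k_ge2.
  have := ler_wpM2l k0 a1; have := ler_wpM2l k0 a3; rewrite mulrDr.
  by move: a2 a4; lra.
have J eps : 0 < eps -> G 0 y X <= \sum_i c i * G 0 y (x i) + (1 + 2 * k) * eps `^ r.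
  move=> e0; have [v Hv] := G_tangent y X e0.
  have /andP[l1 _] := Geps _ X e0.
  have H0 : G eps y 0 <= k * eps `^ r.
    by rewrite /G nsq0 addr0 lerBlDr lerDl powR_ge0.
  have S1 : \sum_i c i * (G eps y X + dot v (x i - X)) <= \sum_i c i * G eps y (x i).
    by apply: ler_sum => i _; apply: ler_wpM2l.
  have S2 : \sum_i c i * G eps y (x i) <= \sum_i c i * G 0 y (x i) + k * eps `^ r.
    apply: (@le_trans _ _ (\sum_i (c i * G 0 y (x i) + c i * (k * eps `^ r)))).
      apply: ler_sum => i _; rewrite -mulrDr; apply: ler_wpM2l => //.
      by have /andP[] := Geps _ (x i) e0.
    rewrite big_split /= lerD2l -mulr_suml ler_piMl// mulr_ge0 ?powR_ge0//.
    exact: le_trans k_ge2.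
  have S3 : \sum_i c i * (G eps y X + dot v (x i - X)) =
     (\sum_i c i) * (G eps y X) + dot v X - (\sum_i c i) * dot v X.
    rewrite (_ : dot v X = \sum_i c i * dot v (x i)); last first.
      by rewrite /X dot_sumr; apply: eq_bigr => i _; rewrite dotZr.
    rewrite [in LHS](eq_bigr (fun i => c i * G eps y X + c i * dot v (x i) - c i * dot v X)).
      by rewrite !big_split /= sumrN -!mulr_suml /X dot_sumr; congr (_ - _ * _);
        apply: eq_bigr => i _; rewrite dotZr.
    by move=> i _; rewrite dotDr dotNr; ring.
  have H1 := Hv 0; rewrite sub0r dotNr in H1.
  have H2 : G eps y X - k * eps `^ r <= \sum_i c i * G eps y (x i).
    apply: le_trans S1; rewrite S3.
    have : 0 <= (1 - \sum_i c i) * (k * eps `^ r - G eps y X + dot v X).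
      apply: mulr_ge0; first by rewrite subr_ge0.
      by move: H0 H1; lra.
    have : 0 <= (\sum_i c i) * (k * eps `^ r).
      by rewrite mulr_ge0 ?sumr_ge0// mulr_ge0 ?powR_ge0//; apply: le_trans k_ge2.
    by lra.
  by move: l1 H2 S2; lra.
apply/ler_addgt0Pr => d d0.
have K0 : 0 < 1 + 2 * k by move: k_ge2; lra.
(* Solves (1 + 2 k) eps^r = d. *)
pose eps := (d / (1 + 2 * k)) `^ r^-1.
have e0 : 0 < eps by rewrite powR_gt0// divr_gt0.
apply: le_trans (J eps e0) _.
rewrite lerD2l /eps -powRrM mulVf ?gt_eqF// powRr1; last by rewrite divr_ge0// ltW.
by rewrite mulrC divfK ?gt_eqF.
Qed.

Definition bell_term z e y := dot e y + (k * nsq z `^ r - (nsq z + nsq (y + z)) `^ r).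

(* Partial Legendre transform of the zigzag-concave function
   (x, y) |-> (|x|^2 + |y|^2)^(p/2) - 2/(p-1) |x|^p, shifted by [z]; the shift
   accounts for the term - Re (z * conj e) which makes [bellN] below hold. *)
Definition bell z e : R := sup (range (bell_term z e)).

(** Write y as (y + z) - z and apply Young to both pairings with e; the resulting |y + z|^p is
    absorbed by the negative power in [bell_term]. *)
Let bell_bound z e y :
  bell_term z e y <= (k + 1) * normc z `^ p + 2 * normc e `^ q.
Proof.
rewrite /bell_term.
have -> : dot e y = dot e (y + z) - dot e z by rewrite dotDr addrK.
have d1 := dot_le e (y + z).
have d2 : - dot e z <= normc e * normc z.
  by rewrite -dotNr; apply: le_trans (dot_le _ _) _; rewrite normc_opp.
have y1 := young_powR p1 (normc_ge0 (y + z)) (normc_ge0 e).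
have y2 := young_powR p1 (normc_ge0 z) (normc_ge0 e).
have -> : nsq z `^ r = normc z `^ p by rewrite powR_normc.
have le3 : normc (y + z) `^ p <= (nsq z + nsq (y + z)) `^ r.
  rewrite powR_normc; apply: ge0_ler_powR; rewrite ?nnegrE ?addr_ge0 ?nsq_ge0 ?(ltW r_gt0)//.
  by rewrite lerDr nsq_ge0.
by rewrite -/q in y1 y2; move: d1 d2 y1 y2 le3; rewrite !(mulrC (normc e)); lra.
Qed.

Let bell_has_ub z e : has_ubound (range (bell_term z e)).
Proof.
by exists ((k + 1) * normc z `^ p + 2 * normc e `^ q) => _ [y _ <-].
Qed.

Lemma bell_ge z e y : bell_term z e y <= bell z e.
Proof. by apply: ub_le_sup => //; exists y. Qed.

Lemma bell_le z e M : (forall y, bell_term z e y <= M) -> bell z e <= M.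
Proof.
by move=> H; apply: ge_sup => [|_ [y _ <-]//]; exists (bell_term z e 0); exists 0.
Qed.

Lemma bell_upper z e : bell z e <= (k + 1) * normc z `^ p + 2 * normc e `^ q.
Proof. exact: bell_le. Qed.

(** At y = 0 the term equals (k - 2^r) |z|^p, and 2^r <= 2 <= k because p <= 2. *)
Lemma bell_ge0 z e : 0 <= bell z e.
Proof.
apply: le_trans (bell_ge z e 0).
rewrite /bell_term dot0r add0r add0r -mulr2n -mulr_natl powRM ?nsq_ge0//.
rewrite -mulrBl mulr_ge0 ?powR_ge0// subr_ge0.
apply: le_trans k_ge2.
by rewrite -[leRHS]powRr1//; apply: ler_powR; rewrite ?ler1n.
Qed.

(** The term of (- z, e) at y is the term of (z, e) at y - 2 z, plus 2 dot z e. This one-sided bound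
    is used for z and for - z. *)
Lemma bellN z e : bell (- z) e = bell z e + 2 * dot z e.
Proof.
have H z' e' : bell (- z') e' <= bell z' e' + 2 * dot z' e'.
  apply: bell_le => y.
  have := bell_ge z' e' (y - z' - z'); rewrite /bell_term nsqN subrK !dotDr !dotNr.
  by rewrite (dotC e' z'); lra.
apply/eqP; rewrite eq_le H /=.
by have := H (- z) e; rewrite opprK dotNl; lra.
Qed.

(** Write c_i = |c_i| u_i with |u_i| = 1. For fixed y the phases go into the points u_i z_i of the
    Jensen inequality for G, and the i-th pair is tested at conj(u_i) y instead of y, which is
    allowed because [bell] is a supremum. *)
Lemma bell_jensen (I : finType) (c : I -> R[i]) (z e : I -> R[i]) :
  \sum_i normc (c i) <= 1 ->
  bell (\sum_i c i * z i) (\sum_i c i * e i) <= \sum_i normc (c i) * bell (z i) (e i).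
Proof.
move=> c1; apply: bell_le => y.
have [u Hu] : exists u : I -> R[i],
    forall i, normc (u i) = 1 /\ c i = (normc (c i))%:C * u i.
  have H i : {v | normc v = 1 /\ c i = (normc (c i))%:C * v}.
    by apply: cid; have [v v1 v2] := polar_decomp (c i); exists v.
  by exists (fun i => projT1 (H i)) => i; exact: projT2 (H i).
have gj := @G_jensen I (fun i => normc (c i)) (fun i => u i * z i) y
  (fun i => normc_ge0 _) c1.
have -> : \sum_i c i * z i = \sum_i (normc (c i))%:C * (u i * z i).
  by apply: eq_bigr => i _; have [_ {1}->] := Hu i; rewrite mulrA.
rewrite /G !add0r in gj.
apply: (@le_trans _ _ (\sum_i normc (c i) * bell_term (z i) (e i) (conjc (u i) * y))); last first.
  by apply: ler_sum => i _; apply: ler_wpM2l (bell_ge _ _ _); exact: normc_ge0.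
rewrite /bell_term dot_suml.
rewrite [leRHS](eq_bigr (fun i => dot (c i * e i) y + normc (c i) *
  (k * (0 + nsq (u i * z i)) `^ r -
     (0 + nsq (u i * z i) + nsq (y + u i * z i)) `^ r))); last first.
  move=> i _; have [u1 ci] := Hu i.
  have nu1 : nsq (u i) = 1 by rewrite -sqr_normc u1 expr1n.
  have -> : nsq (conjc (u i) * y + z i) = nsq (y + u i * z i).
    rewrite -[RHS](mul1r _) -nu1 (_ : nsq (u i) = nsq (conjc (u i))); last first.
      by rewrite -!sqr_normc normc_conj.
    by rewrite -nsqM mulrDr mulrA conjc_unit// mul1r.
  rewrite nsqM nu1 mul1r !add0r mulrDr; congr (_ + _).
  by rewrite [in RHS]ci -mulrA dotZl dotMl.
by rewrite big_split /= lerD2l.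
Qed.

Lemma bell0 : bell 0 0 = 0.
Proof.
apply/eqP; rewrite eq_le bell_ge0 andbT; apply: le_trans (bell_upper _ _) _.
by rewrite normc0 !powR0 ?mulr0 ?addr0// gt_eqF ?divr_gt0// (lt_trans _ p1).
Qed.

Let q_gt0 : 0 < q. Proof. by rewrite divr_gt0// (lt_trans _ p1). Qed.
Let p_gt0 : 0 < p. Proof. by rewrite (lt_trans _ p1). Qed.

(* A convex function bounded on a ball is Lipschitz at its centre. *)
Let bell_lip1 z e z' e' (d : R) : 0 < d -> d <= 1 ->
  normc (z' - z) <= d -> normc (e' - e) <= d ->
  bell z' e' <= bell z e +
    d * ((k + 1) * (normc z + 1) `^ p + 2 * (normc e + 1) `^ q).
Proof.
move=> d0 d1 zd ed.
pose c (b : bool) : R[i] := (if b then 1 - d else d)%:C.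
pose Z (b : bool) : R[i] := if b then z else z + d^-1%:C * (z' - z).
pose E (b : bool) : R[i] := if b then e else e + d^-1%:C * (e' - e).
have J : (1 - d) + d <= 1 ->
    bell ((1 - d)%:C * z + d%:C * (z + d^-1%:C * (z' - z)))
      ((1 - d)%:C * e + d%:C * (e + d^-1%:C * (e' - e))) <=
    (1 - d) * bell z e +
    d * bell (z + d^-1%:C * (z' - z)) (e + d^-1%:C * (e' - e)).
  have := @bell_jensen _ c Z E.
  rewrite !big_bool -[c true]/((1 - d)%:C) -[c false]/(d%:C).
  rewrite -[Z true]/z -[E true]/e -[Z false]/(z + d^-1%:C * (z' - z)).
  by rewrite -[E false]/(e + d^-1%:C * (e' - e)) !normc_real !ger0_norm ?subr_ge0 ?(ltW d0).
have X w w' : (1 - d)%:C * w + d%:C * (w + d^-1%:C * (w' - w)) = w'.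
  rewrite mulrDr mulrA -rmorphM mulfV ?gt_eqF// addrA -mulrDl -rmorphD subrK.
  by rewrite !rmorph1 !mul1r subrKC.
move: J; rewrite !X subrK => /(_ (lexx _)) /le_trans; apply.
apply: lerD.
  by rewrite ler_piMl ?bell_ge0// lerBlDr lerDl ltW.
apply: ler_wpM2l; first exact: ltW.
apply: le_trans (bell_upper _ _) _.
have N w w' : normc (w' - w) <= d -> normc (w + d^-1%:C * (w' - w)) <= normc w + 1.
  move=> H; apply: le_trans (normcD _ _) _; rewrite lerD2l normcM normc_real.
  by rewrite ger0_norm ?invr_ge0 ?(ltW d0)// mulrC ler_pdivrMr// mul1r.
by apply: lerD; (apply: ler_wpM2l; first by move: k_ge2; lra);
  apply: ge0_ler_powR; rewrite ?nnegrE ?addr_ge0 ?normc_ge0 ?(ltW p_gt0) ?(ltW q_gt0)//; exact: N.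
Qed.

(** The reverse bound is centred at (z', e'), whose moduli exceed those of z and e by at most 1;
    hence the radius 2 instead of 1. *)
Lemma bell_lip z e z' e' (d : R) : 0 < d -> d <= 1 ->
  normc (z' - z) <= d -> normc (e' - e) <= d ->
  `|bell z' e' - bell z e| <=
    d * ((k + 1) * (normc z + 2) `^ p + 2 * (normc e + 2) `^ q).
Proof.
move=> d0 d1 zd ed.
have N w w' : normc (w' - w) <= d -> normc w' <= normc w + 1.
  move=> H; rewrite -[w' in leLHS](subrKC w); apply: le_trans (normcD _ _) _.
  by rewrite lerD2l; apply: le_trans d1.
have L a b : a <= normc z + 2 -> b <= normc e + 2 -> 0 <= a -> 0 <= b ->
    d * ((k + 1) * a `^ p + 2 * b `^ q) <=
    d * ((k + 1) * (normc z + 2) `^ p + 2 * (normc e + 2) `^ q).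
  move=> a1 b1 a0 b0; apply: ler_wpM2l; first exact: ltW.
  by apply: lerD; (apply: ler_wpM2l; first by move: k_ge2; lra);
    apply: ge0_ler_powR; rewrite ?nnegrE ?addr_ge0 ?normc_ge0 ?(ltW p_gt0) ?(ltW q_gt0).
set D := d * _ in L *.
have U : bell z' e' <= bell z e + D.
  apply: le_trans (bell_lip1 d0 d1 zd ed) _; rewrite lerD2l; apply: L;
    by rewrite ?addr_ge0 ?normc_ge0// lerD2l ler1n.
have V : bell z e <= bell z' e' + D.
  apply: (le_trans (@bell_lip1 z' e' z e d d0 d1 _ _)); rewrite 1?normc_subC//.
  rewrite lerD2l; apply: L; rewrite ?addr_ge0 ?normc_ge0//.
    by apply: le_trans (lerD (N _ _ zd) (lexx 1)) _; rewrite -addrA.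
  by apply: le_trans (lerD (N _ _ ed) (lexx 1)) _; rewrite -addrA.
by rewrite ler_norml; apply/andP; split; lra.
Qed.

End Bellman.

(** * Lp spaces and real inner products *)

Section LpSpace.
Context {dX} {X : measurableType dX} {R : realType}.
Variable nu : {measure set X -> \bar R}.
Implicit Types (f g h : X -> R[i]) (a : R[i]) (p : R).

Lemma aeqP {T : Type} (u v : X -> T) :
  u = v %[ae nu] <-> \forall x \ae nu, u x = v x.
Proof. by split; apply: filterS => x //; apply. Qed.

Lemma cmeasurable_cst a : cmeasurable (cst a : X -> R[i]).
Proof. by split; exact: measurable_cst. Qed.

Lemma cmeasurableD f g : cmeasurable f -> cmeasurable g ->
  cmeasurable (fun x => f x + g x).
Proof.
move=> [f1 f2] [g1 g2]; split.
- under eq_fun do rewrite ReD; exact: measurable_funD.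
- under eq_fun do rewrite ImD; exact: measurable_funD.
Qed.

Lemma cmeasurableM f g : cmeasurable f -> cmeasurable g ->
  cmeasurable (fun x => f x * g x).
Proof.
move=> [f1 f2] [g1 g2]; split.
- under eq_fun do rewrite ReM.
  by apply: measurable_funB; apply: measurable_funM.
- under eq_fun do rewrite ImM.
  by apply: measurable_funD; apply: measurable_funM.
Qed.

Lemma cmeasurable_real (u : X -> R) : measurable_fun setT u ->
  cmeasurable (fun x => (u x)%:C).
Proof. by move=> mu; split => //=; exact: measurable_cst. Qed.

Lemma cmeasurableZ a f : cmeasurable f -> cmeasurable (fun x => a * f x).
Proof. by move=> mf; apply: cmeasurableM => //; exact: cmeasurable_cst. Qed.

Lemma cmeasurableN f : cmeasurable f -> cmeasurable (fun x => - f x).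
Proof.
move=> [f1 f2]; split.
- by under eq_fun do rewrite ReN; exact: measurableT_comp.
- by under eq_fun do rewrite ImN; exact: measurableT_comp.
Qed.

Lemma cmeasurableB f g : cmeasurable f -> cmeasurable g ->
  cmeasurable (fun x => f x - g x).
Proof. by move=> mf mg; apply: cmeasurableD => //; exact: cmeasurableN. Qed.

Lemma measurable_dot f g : cmeasurable f -> cmeasurable g ->
  measurable_fun setT (fun x => dot (f x) (g x)).
Proof.
move=> [f1 f2] [g1 g2]; rewrite dot.unlock.
by apply: measurable_funD; exact: measurable_funM.
Qed.

Lemma measurable_nsq f : cmeasurable f -> measurable_fun setT (fun x => nsq (f x)).
Proof.
move=> mf; under eq_fun do rewrite -dotxx; exact: measurable_dot.
Qed.

Lemma measurable_normc_powR p f : cmeasurable f ->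
  measurable_fun setT (fun x => normc (f x) `^ p).
Proof.
move=> mf; under eq_fun do rewrite powR_normc.
exact: (measurableT_comp (measurable_powR _) (measurable_nsq mf)).
Qed.

Lemma measurable_normc f : cmeasurable f ->
  measurable_fun setT (fun x => normc (f x)).
Proof.
move=> mf; under eq_fun => x do rewrite -(powRr1 (normc_ge0 (f x))).
exact: measurable_normc_powR.
Qed.

(** The estimates are carried out on moments, which are plain integrals; p-th roots are taken only
    when a norm is stated. *)
Definition mom p f : \bar R := (\int[nu]_x (normc (f x) `^ p)%:E)%E.

Lemma mom_ge0 p f : (0 <= mom p f)%E.
Proof. by apply: integral_ge0 => x _; rewrite lee_fin powR_ge0. Qed.

Lemma measurable_mom p f : cmeasurable f ->
  measurable_fun setT (fun x => (normc (f x) `^ p)%:E).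
Proof. by move=> mf; apply/measurable_EFinP; exact: measurable_normc_powR. Qed.

Lemma LpnormE p f : Lpnorm nu p%:E f = (mom p f `^ (p^-1))%E.
Proof.
rewrite /Lpnorm unlock; congr (_ `^ _)%E; apply: eq_integral => x _.
by rewrite abse_EFin ger0_norm ?normc_ge0// poweR_EFin.
Qed.

Lemma poweRK p (x : \bar R) : 0 < p -> (0 <= x)%E -> ((x `^ p^-1) `^ p = x)%E.
Proof. by move=> p0 x0; rewrite -poweRrM mulVf ?gt_eqF// poweRe1. Qed.

Lemma momE p f : 0 < p -> mom p f = (Lpnorm nu p%:E f `^ p)%E.
Proof. by move=> p0; rewrite LpnormE poweRK// mom_ge0. Qed.

Lemma le_poweR p (x y : \bar R) : 0 <= p -> (0 <= x)%E -> (x <= y)%E ->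
  (x `^ p <= y `^ p)%E.
Proof.
move=> p0 x0 xy; apply: gt0_ler_poweR => //; rewrite in_itv/= leey andbT//.
exact: le_trans xy.
Qed.

Lemma LpP p f : 0 < p -> Lp nu p%:E f <-> cmeasurable f /\ (mom p f < +oo)%E.
Proof.
move=> p0; split => -[mf H]; split => //.
  by rewrite momE//; apply: poweR_lty.
by rewrite LpnormE; apply: poweR_lty.
Qed.

Lemma Lpnorm_le_mom p f g : 0 < p ->
  (Lpnorm nu p%:E f <= Lpnorm nu p%:E g)%E -> (mom p f <= mom p g)%E.
Proof.
by move=> p0 H; rewrite !momE//; apply: le_poweR; rewrite ?(ltW p0)// Lnorm_ge0.
Qed.

Lemma mom_le p f g : 0 <= p -> cmeasurable f -> cmeasurable g ->
  (\forall x \ae nu, normc (f x) <= normc (g x)) -> (mom p f <= mom p g)%E.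
Proof.
move=> p0 mf mg fg; apply: ae_ge0_le_integral => //.
- by move=> x _; rewrite lee_fin powR_ge0.
- exact: measurable_mom.
- by move=> x _; rewrite lee_fin powR_ge0.
- exact: measurable_mom.
- apply: filterS fg => x fgx _; rewrite lee_fin.
  by apply: ge0_ler_powR; rewrite ?nnegrE ?normc_ge0.
Qed.

Lemma mom_ae p f g : cmeasurable f -> cmeasurable g ->
  (\forall x \ae nu, f x = g x) -> mom p f = mom p g.
Proof.
move=> mf mg fg; apply: ae_eq_integral => //; [exact: measurable_mom|exact: measurable_mom|].
by apply: filterS fg => x -> _.
Qed.

Lemma momZ p a f : cmeasurable f ->
  mom p (fun x => a * f x)%R = ((normc a `^ p)%:E * mom p f)%E.
Proof.
move=> mf; rewrite /mom -ge0_integralZl_EFin ?powR_ge0//.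
- by apply: eq_integral => x _; rewrite normcM powRM ?normc_ge0.
- by move=> x _; rewrite lee_fin powR_ge0.
- exact: measurable_mom.
Qed.

Lemma momN p f : mom p (fun x => - f x)%R = mom p f.
Proof. by apply: eq_integral => x _; rewrite normc_opp. Qed.

Lemma mom_subC p f g : mom p (fun x => f x - g x)%R = mom p (fun x => g x - f x)%R.
Proof. by apply: eq_integral => x _; rewrite normc_subC. Qed.

Lemma mom0 p : 0 < p -> mom p (fun=> 0)%R = 0%E.
Proof.
move=> p0; rewrite /mom; under eq_integral do rewrite normc0 powR0 ?gt_eqF//.
exact: integral0.
Qed.

(** A quasi-triangle inequality; its factor 2^p enters only constants that depend on p. *)
Lemma momD p f g : 0 <= p -> cmeasurable f -> cmeasurable g ->
  (mom p (fun x => f x + g x)%R <= (2 `^ p)%:E * (mom p f + mom p g))%E.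
Proof.
move=> p0 mf mg; rewrite -ge0_integralD//; last 4 first.
- by move=> x _; rewrite lee_fin powR_ge0.
- exact: measurable_mom.
- by move=> x _; rewrite lee_fin powR_ge0.
- exact: measurable_mom.
rewrite -ge0_integralZl_EFin ?powR_ge0//; last 2 first.
- by move=> x _; rewrite adde_ge0// lee_fin powR_ge0.
- by apply: emeasurable_funD; exact: measurable_mom.
apply: ge0_le_integral => //.
- by move=> x _; rewrite lee_fin powR_ge0.
- by apply: measurable_mom; exact: cmeasurableD.
- apply: measurable_funeM.
  by apply: emeasurable_funD; exact: measurable_mom.
- move=> x _; rewrite -EFinD -EFinM lee_fin.
  apply: le_trans (powRD_le2 p0 (normc_ge0 _) (normc_ge0 _)).
  by apply: ge0_ler_powR; rewrite ?nnegrE ?addr_ge0 ?normc_ge0// normcD.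
Qed.

Lemma mom_eq0 p f : 0 < p -> cmeasurable f -> mom p f = 0%E ->
  \forall x \ae nu, f x = 0.
Proof.
move=> p0 mf; rewrite /mom => H.
have : (\int[nu]_x `|(normc (f x) `^ p)%:E| = 0)%E.
  by rewrite -[RHS]H; apply: eq_integral => x _; rewrite gee0_abs// lee_fin powR_ge0.
move/(ae_eq_integral_abs nu measurableT (measurable_mom p mf)).
apply: filterS => x /(_ I) /= [] /eqP; rewrite powR_eq0 => /andP[/eqP]; move/normc_eq0 => //.
Qed.

Lemma Lp_add p f g : 0 < p -> Lp nu p%:E f -> Lp nu p%:E g ->
  Lp nu p%:E (fun x => f x + g x).
Proof.
move=> p0 /(LpP _ p0)[mf ff] /(LpP _ p0)[mg fg]; apply/(LpP _ p0); split.
  exact: cmeasurableD.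
apply: le_lt_trans (momD (ltW p0) mf mg) _.
by rewrite lte_mul_pinfty ?lee_fin ?powR_ge0// lte_add_pinfty.
Qed.

Lemma Lp_scale p a f : 0 < p -> Lp nu p%:E f -> Lp nu p%:E (fun x => a * f x).
Proof.
move=> p0 /(LpP _ p0)[mf ff]; apply/(LpP _ p0); split; first exact: cmeasurableZ.
by rewrite momZ// lte_mul_pinfty ?lee_fin ?powR_ge0.
Qed.

Lemma Lp_opp p f : 0 < p -> Lp nu p%:E f -> Lp nu p%:E (fun x => - f x).
Proof.
move=> p0 /(Lp_scale (-1) p0); congr Lp; apply/funext => x.
by rewrite mulN1r.
Qed.

Lemma Lp_sub p f g : 0 < p -> Lp nu p%:E f -> Lp nu p%:E g ->
  Lp nu p%:E (fun x => f x - g x).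
Proof. by move=> p0 Lf Lg; apply: Lp_add => //; exact: Lp_opp. Qed.

Lemma Lp0 p : 0 < p -> Lp nu p%:E (fun=> 0).
Proof.
move=> p0; apply/(LpP _ p0); split; first exact: cmeasurable_cst.
by rewrite mom0// ltry.
Qed.

Lemma Lp_ae p f g : 0 < p -> Lp nu p%:E f -> cmeasurable g ->
  (\forall x \ae nu, f x = g x) -> Lp nu p%:E g.
Proof.
move=> p0 /(LpP _ p0)[mf ff] mg fg; apply/(LpP _ p0); split => //.
by rewrite -(mom_ae p mf mg fg).
Qed.

Lemma Lp_le p f g : 0 < p -> Lp nu p%:E g -> cmeasurable f ->
  (\forall x \ae nu, normc (f x) <= normc (g x)) -> Lp nu p%:E f.
Proof.
move=> p0 /(LpP _ p0)[mg fg] mf H; apply/(LpP _ p0); split => //.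
by apply: le_lt_trans fg; apply: mom_le => //; exact: ltW.
Qed.

Lemma Lp_sum (I : Type) (s : seq I) p (F : I -> X -> R[i]) : 0 < p ->
  (forall i, Lp nu p%:E (F i)) -> Lp nu p%:E (fun x => \sum_(i <- s) F i x).
Proof.
move=> p0 LF; elim: s => [|i s IH].
  by under eq_fun do rewrite big_nil; exact: Lp0.
by under eq_fun do rewrite big_cons; exact: Lp_add.
Qed.

End LpSpace.

Lemma cvg_powR {R : realType} (u : nat -> R) (a p : R) : 0 <= p ->
  (forall n, 0 <= u n) -> u n @[n --> \oo] --> a -> u n `^ p @[n --> \oo] --> a `^ p.
Proof.
move=> p0 u0 ua.
have [->|pn0] := eqVneq p 0.
  by under eq_fun do rewrite powRr0; rewrite powRr0; exact: cvg_cst.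
have pp : 0 < p by rewrite lt_def pn0.
have a0 : 0 <= a.
  rewrite -(cvg_lim _ ua)//; apply: limr_ge; first exact: cvgP ua.
  exact: nearW.
(* The power need not be differentiable at 0, so a limit 0 is treated by hand through the inverse
   power. *)
have [a00|an0] := eqVneq a 0.
  rewrite a00 powR0//; apply/cvgrPdist_le => e e0.
  have e1 : 0 < e `^ p^-1 by rewrite powR_gt0.
  move/cvgrPdist_le : ua => /(_ _ e1); apply: filterS => n.
  rewrite a00 !sub0r !normrN !ger0_norm ?powR_ge0// => une.
  have -> : e = (e `^ p^-1) `^ p by rewrite -powRrM mulVf// powRr1// ltW.
  by apply: ge0_ler_powR; rewrite ?nnegrE// ltW.
have ap : 0 < a by rewrite lt_def an0.
apply: (@cvg_comp _ _ _ u (fun x : R => x `^ p) _ _ _ ua).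
have : {for a, continuous (fun x : R => x `^ p)}; last exact.
apply/differentiable_continuous/derivable1_diffP.
by apply: derivable_powR; rewrite in_itv /= andbT.
Qed.

Lemma squeeze0 {R : realType} (u v : nat -> R) : (forall n, 0 <= u n <= v n) ->
  v n @[n --> \oo] --> 0 -> u n @[n --> \oo] --> 0.
Proof.
move=> uv v0; apply/cvgrPdist_le => e e0.
move/cvgrPdist_le : v0 => /(_ e e0); apply: filterS => n.
have /andP[u0 uvn] := uv n.
rewrite !sub0r !normrN !ger0_norm//; first exact: le_trans.
exact: le_trans uvn.
Qed.

(** * Fatou's lemma along almost everywhere convergent sequences *)

Section Convergence.
Context {dX} {X : measurableType dX} {R : realType}.
Variable nu : {measure set X -> \bar R}.
Implicit Types (f g h : X -> R[i]) (p : R).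

Lemma fatou_cvg (F : nat -> X -> R) (G : X -> R) (b : nat -> \bar R) B :
  (forall n, measurable_fun setT (F n)) -> measurable_fun setT G ->
  (forall n x, 0 <= F n x) -> (forall x, 0 <= G x) ->
  (\forall x \ae nu, F n x @[n --> \oo] --> G x) ->
  (forall n, \int[nu]_x (F n x)%:E <= b n)%E -> b n @[n --> \oo] --> B ->
  (\int[nu]_x (G x)%:E <= B)%E.
Proof.
move=> mF mG F0 G0 FG Fb bB.
pose H n x := (F n x)%:E.
have mH n : measurable_fun setT (H n) by apply/measurable_EFinP.
have mI : measurable_fun setT (fun x => limn_einf (H ^~ x)).
  have -> : (fun x => limn_einf (H ^~ x)) =
      (fun x => - limn_esup (fun n => - H n x))%E.
    apply/funext => x; rewrite -limn_einfN; congr limn_einf.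
    by apply/funext => n; rewrite /comp oppeK.
  apply: measurableT_comp => //; apply: measurable_fun_limn_esup => n.
  exact: measurableT_comp.
apply: (@le_trans _ _ (\int[nu]_x limn_einf (H ^~ x))%E).
  rewrite le_eqVlt; apply/orP; left; apply/eqP.
  apply: ae_eq_integral => //; first exact/measurable_EFinP.
  apply: filterS FG => x Fx _; apply/esym.
  have/cvg_limn_einf_sup[-> //] : H n x @[n --> \oo] --> (G x)%:E.
  by apply/cvg_EFin => //; exact: nearW.
apply: le_trans (fatou nu measurableT mH _) _ => [n x _|]; first by rewrite lee_fin.
rewrite limn_einf_lim -(cvg_lim _ bB)//.
apply: lee_lim; first exact: is_cvg_einfs.
  by apply/cvg_ex; exists B.
apply: nearW => n; apply: le_trans (Fb n).
by apply: ereal_inf_lbound; exists n => //=.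
Qed.

Lemma mom_fatou p (u : nat -> X -> R[i]) f (b : nat -> \bar R) B : 0 <= p ->
  (forall n, cmeasurable (u n)) -> cmeasurable f ->
  (\forall x \ae nu, normc (u n x - f x) @[n --> \oo] --> 0) ->
  (forall n, mom nu p (u n) <= b n)%E -> b n @[n --> \oo] --> B ->
  (mom nu p f <= B)%E.
Proof.
move=> p0 mu mf uf ub bB.
apply: (fatou_cvg (F := fun n x => normc (u n x) `^ p) (b := b)) => //.
- by move=> n; exact: measurable_normc_powR.
- exact: measurable_normc_powR.
- by move=> n x; exact: powR_ge0.
- by move=> x; exact: powR_ge0.
apply: filterS uf => x ux.
have : normc (u n x) @[n --> \oo] --> normc (f x).
  apply/cvgrPdist_le => e e0; near=> n.
  have : normc (u n x - f x) <= e.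
    near: n; move/cvgrPdist_le : ux => /(_ e e0); apply: filterS => n.
    by rewrite sub0r normrN ger0_norm ?normc_ge0.
  apply: le_trans; rewrite ler_norml; apply/andP; split.
    have := normcD (f x) (u n x - f x); rewrite subrKC.
    by lra.
  by have := normcD (u n x) (f x - u n x); rewrite subrKC normc_subC; lra.
by apply: cvg_powR => // *; exact: normc_ge0.
Unshelve. all: by end_near. Qed.

End Convergence.

(** * Completeness of L^p along geometrically fast sequences *)

Section Completeness.
Context {dX} {X : measurableType dX} {R : realType}.
Variable nu : {measure set X -> \bar R}.
Implicit Types (f g h : X -> R[i]) (p : R).

Let sum_half (r : R) : (\sum_(0 <= n <oo) (r / 2 ^+ n)%:E = (r * 2)%:E)%E.
Proof.
have := @cvg_geometric_eseries_half _ (r * 2) 0.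
rewrite expr0 divr1 => /cvg_lim <-//; congr (limn _); apply/funext => n.
apply: eq_bigr => k _; congr (_%:E).
by rewrite addn1 natrX exprS invfM mulrA mulfK ?pnatr_eq0.
Qed.

(** The rate is chosen so that (2^n)^p times the n-th moment is at most K 2^-n. Then the series of
    the functions (2^n |v_n|)^p has a finite integral, so it is finite almost everywhere and bounds
    each of its terms. *)
Lemma ae_geometric p K (v : nat -> X -> R[i]) : 0 < p ->
  (forall n, cmeasurable (v n)) ->
  (forall n, mom nu p (v n) <= (K * (2 * 2 `^ p) ^- n)%:E)%E ->
  \forall x \ae nu, exists M, forall n, normc (v n x) <= M / 2 ^+ n.
Proof.
move=> p0 mv vK.
pose w n x : R := (2 ^+ n * normc (v n x)) `^ p.
have w0 n x : 0 <= w n x by exact: powR_ge0.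
have w0E n x : (0 <= (w n x)%:E)%E by rewrite lee_fin.
have wE n x : w n x = (2 `^ p) ^+ n * normc (v n x) `^ p.
  rewrite /w powRM ?exprn_ge0 ?normc_ge0//; congr (_ * _).
  by rewrite -powR_mulrn// -powRrM mulrC powRrM powR_mulrn ?powR_ge0.
have mw n : measurable_fun setT (fun x => (w n x)%:E).
  apply/measurable_EFinP; rewrite (funext (wE n)).
  by apply: measurable_funM => //; exact: measurable_normc_powR.
have iw n : (\int[nu]_x (w n x)%:E <= (K / 2 ^+ n)%:E)%E.
  under eq_integral do rewrite wE EFinM.
  rewrite ge0_integralZl_EFin ?exprn_ge0 ?powR_ge0//; last 2 first.
  - by move=> x _; rewrite lee_fin powR_ge0.
  - exact: measurable_mom.
  apply: (@le_trans _ _ (((2 `^ p) ^+ n)%:E * (K * (2 * 2 `^ p) ^- n)%:E)%E).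
    by apply: lee_wpmul2l (vK n); rewrite lee_fin exprn_ge0 ?powR_ge0.
  rewrite -EFinM lee_fin exprMn le_eqVlt; apply/orP; left; apply/eqP.
  have : (2 `^ p) ^+ n != 0 by rewrite expf_neq0// gt_eqF// powR_gt0.
  have : (2 : R) ^+ n != 0 by rewrite expf_neq0.
  by move: (2 ^+ n) (2 `^ p ^+ n) => A B A0 B0; field; rewrite ?A0 ?B0.
have iS : (\int[nu]_x \sum_(0 <= n <oo) (w n x)%:E < +oo)%E.
  rewrite (integral_nneseries nu measurableT mw (fun n x _ => w0E n x)).
  apply: (@le_lt_trans _ _ (\sum_(0 <= n <oo) (K / 2 ^+ n)%:E)%E).
    by apply: lee_nneseries => [*|n _]; [apply: integral_ge0 => x _; rewrite lee_fin|exact: iw].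
  by rewrite sum_half ltry.
have S0 x : (0 <= \sum_(0 <= n <oo) (w n x)%:E)%E by apply: nneseries_ge0 => *; exact: w0E.
have mS : measurable_fun setT (fun x => \sum_(0 <= n <oo) (w n x)%:E)%E.
  by apply: ge0_emeasurable_sum => // n x *; exact: w0E.
have intS : nu.-integrable setT (fun x => \sum_(0 <= n <oo) (w n x)%:E)%E.
  apply/integrableP; split => //.
  by under eq_integral do rewrite gee0_abs//.
have := integrable_ae measurableT intS; apply: filterS => x /(_ I) Sfin.
exists ((fine (\sum_(0 <= n <oo) (w n x)%:E)%E) `^ p^-1) => n.
rewrite ler_pdivlMr ?exprn_gt0// mulrC.
have : w n x <= fine (\sum_(0 <= n <oo) (w n x)%:E)%E.
  rewrite -lee_fin fineK//.
  apply: le_trans (nneseries_lim_ge n.+1 _) => [|*]; last exact: w0E.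
  by rewrite big_nat_recr//= leeDr// sume_ge0// => *; exact: w0E.
move=> H; rewrite -[leLHS](_ : (w n x) `^ p^-1 = _); last first.
  by rewrite /w -powRrM mulfV ?gt_eqF// powRr1// mulr_ge0 ?exprn_ge0 ?normc_ge0.
by apply: ge0_ler_powR; rewrite ?nnegrE ?invr_ge0 ?(ltW p0)// (le_trans _ H).
Qed.

Lemma ae_cvg_geometric p K (u : nat -> X -> R[i]) f : 0 < p ->
  (forall n, cmeasurable (u n)) -> cmeasurable f ->
  (forall n, mom nu p (fun x => u n x - f x)%R <= (K * (2 * 2 `^ p) ^- n)%:E)%E ->
  \forall x \ae nu, normc (u n x - f x) @[n --> \oo] --> 0.
Proof.
move=> p0 mu mf H.
have := @ae_geometric p K (fun n x => u n x - f x) p0 _ H.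
have : forall n, cmeasurable (fun x => u n x - f x).
  by move=> n; exact: cmeasurableB.
move=> + H1 => /H1; apply: filterS => x [M HM].
have cM : M / 2 ^+ n @[n --> \oo] --> 0.
  have := @cvg_geometric R M 2^-1; rewrite ger0_norm ?invr_ge0// invf_lt1// ltr1n.
  rewrite (_ : geometric M 2^-1 = fun n => M / 2 ^+ n); first exact.
  by apply/funext => n; rewrite /geometric /= exprVn.
by apply: (squeeze0 _ cM) => n; rewrite normc_ge0 HM.
Qed.

Let cvg_geometric_telescope (a : nat -> R) (M : R) :
  (forall n, `|a n.+1 - a n| <= M / 2 ^+ n) -> cvgn a.
Proof.
move=> aM; have -> : a = (fun n => a 0%N + series (telescope a) n).
  by apply/funext => n; exact: eq_sum_telescope.
apply: is_cvgD; first exact: is_cvg_cst.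
apply: normed_cvg; apply: (@series_le_cvg _ _ (geometric M 2^-1)).
- by move=> n /=.
- by move=> n; apply: (@le_trans _ _ (M / 2 ^+ n)); [exact: le_trans (aM n)|rewrite /geometric /= exprVn].
- by move=> n; apply: le_trans (aM n) _; rewrite /geometric /= exprVn.
- by apply: is_cvg_geometric_series; rewrite ger0_norm ?invr_ge0// invf_lt1// ltr1n.
Qed.

(** Consecutive differences are geometrically small almost everywhere, so the sequence converges
    pointwise; Fatou transfers the rate to the limit. *)
Lemma Lp_complete p K (u : nat -> X -> R[i]) : 0 < p ->
  (forall n, Lp nu p%:E (u n)) ->
  (forall n m, (n <= m)%N ->
    mom nu p (fun x => u m x - u n x)%R <= (K * (2 * 2 `^ p) ^- n)%:E)%E ->
  exists2 f, Lp nu p%:E f &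
    (\forall x \ae nu, normc (u n x - f x) @[n --> \oo] --> 0) /\
    (forall n, mom nu p (fun x => u n x - f x)%R <= (K * (2 * 2 `^ p) ^- n)%:E)%E.
Proof.
move=> p0 Lu uK.
have mu n : cmeasurable (u n) by have /(LpP nu _ p0)[] := Lu n.
(* Upper limits give a candidate that is measurable on the whole space and equals the limit wherever
   the sequence converges. *)
pose lre x : R := fine (limn_esup (fun n => (complex.Re (u n x))%:E)).
pose lim x : R := fine (limn_esup (fun n => (complex.Im (u n x))%:E)).
pose f x : R[i] := Complex (lre x) (lim x).
have mesup (a : nat -> X -> R) : (forall n, measurable_fun setT (a n)) ->
    measurable_fun setT (fun x => fine (limn_esup (fun n => (a n x)%:E))).
  move=> ma; apply: (measurableT_comp (fine_measurable measurableT)).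
  apply: (@measurable_fun_limn_esup _ _ _ _ (fun n x => (a n x)%:E)) => n.
  exact/measurable_EFinP.
have mf : cmeasurable f.
  split; rewrite /f /=.
  - by apply: (mesup (fun n x => complex.Re (u n x))) => n; have [] := mu n.
  - by apply: (mesup (fun n x => complex.Im (u n x))) => n; have [] := mu n.
have ucvg : \forall x \ae nu, normc (u n x - f x) @[n --> \oo] --> 0.
  have := @ae_geometric p K (fun n x => u n.+1 x - u n x) p0 _ _.
  have md n : cmeasurable (fun x => u n.+1 x - u n x) by exact: cmeasurableB.
  move=> /(_ md (fun n => uK n n.+1 (leqnSn n))); apply: filterS => x [M HM].
  have limE (a : nat -> R) : cvgn a -> a n @[n --> \oo] --> fine (limn_esup (EFin \o a)).
    move=> ca; have aE : (EFin \o a) n @[n --> \oo] --> (limn a)%:E.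
      by apply/cvg_EFin; [exact: nearW|exact: ca].
    by rewrite (cvg_limn_einf_sup aE).
  have cre : complex.Re (u n x) @[n --> \oo] --> lre x.
    apply: limE; apply: (@cvg_geometric_telescope _ M) => n.
    by apply: le_trans (HM n); rewrite -ReN -ReD; exact: Re_le_normc.
  have cim : complex.Im (u n x) @[n --> \oo] --> lim x.
    apply: limE; apply: (@cvg_geometric_telescope _ M) => n.
    by apply: le_trans (HM n); rewrite -ImN -ImD; exact: Im_le_normc.
  have H : `|complex.Re (u n x) - lre x| + `|complex.Im (u n x) - lim x| @[n --> \oo] --> 0.
    have H0 (a : nat -> R) (l : R) : a n @[n --> \oo] --> l -> `|a n - l| @[n --> \oo] --> 0.
      move=> al; apply/cvgrPdist_le => e e0.
      move/cvgrPdist_le : al => /(_ e e0); apply: filterS => n.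
      by rewrite sub0r normrN normr_id distrC.
    by rewrite -(addr0 0); apply: cvgD; exact: H0.
  apply: (squeeze0 _ H) => n; rewrite normc_ge0 /=.
  by have := normc_le_ReIm (u n x - f x); rewrite !ReImE.
have uf n : (mom nu p (fun x => u n x - f x)%R <= (K * (2 * 2 `^ p) ^- n)%:E)%E.
  rewrite mom_subC.
  have mB (m : nat) : cmeasurable (fun x => u (m + n)%N x - u n x) by exact: cmeasurableB.
  apply: (mom_fatou (ltW p0) mB _ _ (fun m => uK n (m + n)%N (leq_addl _ _))); last exact: cvg_cst.
    exact: cmeasurableB.
  apply: filterS ucvg => x ux.
  rewrite (_ : (fun m => normc _) = (fun m => normc (u (m + n)%N x - f x))).
    apply: (@cvg_comp _ _ _ (addn^~ n) (fun m => normc (u m x - f x)) _ _ _ _ ux).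
    exact: cvg_addnr.
  by apply/funext => m; rewrite opprB addrA subrK.
exists f => //.
have -> : f = (fun x => u 0%N x - (u 0%N x - f x)).
  by apply/funext => x; rewrite opprB subrKC.
apply: Lp_sub => //; apply/(LpP _ _ p0); split; first exact: cmeasurableB.
by apply: le_lt_trans (uf 0%N) _; rewrite ltry.
Qed.

End Completeness.

(** * L^2 as a real inner product space *)

Section L2.
Context {dX} {X : measurableType dX} {R : realType}.
Variable nu : {measure set X -> \bar R}.
Implicit Types (f g h : X -> R[i]) (a : R[i]).
Local Notation L2 := (Lp nu 2%:E).

(* Real part of the inner product; its imaginary part is [rin f ('i g)]. *)
Definition rin f g : R := fine (\int[nu]_x (dot (f x) (g x))%:E)%E.

Let two_gt0 : 0 < 2 :> R. Proof. by []. Qed.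

Lemma normc_powR2 (z : R[i]) : normc z `^ 2 = nsq z.
Proof. by rewrite powR_mulrn ?normc_ge0// sqr_normc. Qed.

Lemma L2_measurable f : L2 f -> cmeasurable f.
Proof. by case. Qed.

Lemma mom2E f : mom nu 2 f = (\int[nu]_x (nsq (f x))%:E)%E.
Proof. by apply: eq_integral => x _; rewrite normc_powR2. Qed.

Lemma integrable_nsq f : L2 f -> nu.-integrable setT (fun x => (nsq (f x))%:E).
Proof.
move=> /(LpP nu _ two_gt0)[mf]; rewrite mom2E => ff; apply/integrableP; split.
  by apply/measurable_EFinP; exact: measurable_nsq.
by under eq_integral => x _ do rewrite gee0_abs ?lee_fin ?nsq_ge0//.
Qed.

Lemma integrable_dot f g : L2 f -> L2 g ->
  nu.-integrable setT (fun x => (dot (f x) (g x))%:E).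
Proof.
move=> Lf Lg.
apply: (le_integrable measurableT _ _ (integrableD measurableT (integrable_nsq Lf) (integrable_nsq Lg))).
  by apply/measurable_EFinP; apply: measurable_dot; exact: L2_measurable.
move=> x _ /=; rewrite lee_fin [leRHS]ger0_norm ?addr_ge0 ?nsq_ge0//.
have := nsq_ge0 (f x + g x); have := nsq_ge0 (f x - g x).
rewrite !nsqD nsqN dotNr ler_norml => H1 H2.
have := nsq_ge0 (f x); have := nsq_ge0 (g x).
by move: H1 H2 => *; apply/andP; split; lra.
Qed.

Lemma EFin_rin f g : L2 f -> L2 g ->
  ((rin f g)%:E = \int[nu]_x (dot (f x) (g x))%:E)%E.
Proof.
by move=> Lf Lg; rewrite fineK//; apply: integrable_fin_num => //; exact: integrable_dot.
Qed.

Lemma rinC f g : rin f g = rin g f.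
Proof. by congr fine; apply: eq_integral => x _; rewrite dotC. Qed.

Lemma rinDl f g h : L2 f -> L2 g -> L2 h ->
  rin (fun x => f x + g x)%R h = rin f h + rin g h.
Proof.
move=> Lf Lg Lh; apply: EFin_inj; rewrite EFinD !EFin_rin//; last exact: Lp_add.
rewrite -integralD//; [|exact: integrable_dot..].
by apply: eq_integral => x _; rewrite dotDl.
Qed.

Lemma rinDr f g h : L2 f -> L2 g -> L2 h ->
  rin h (fun x => f x + g x)%R = rin h f + rin h g.
Proof. by move=> *; rewrite rinC rinDl// !(rinC h). Qed.

Lemma rinZl (c : R) f g : L2 f -> L2 g ->
  rin (fun x => c%:C * f x)%R g = c * rin f g.
Proof.
move=> Lf Lg; apply: EFin_inj; rewrite EFinM !EFin_rin//; last exact: Lp_scale.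
rewrite -integralZl//; last exact: integrable_dot.
by apply: eq_integral => x _; rewrite dotZl.
Qed.

Lemma rinZr (c : R) f g : L2 f -> L2 g ->
  rin f (fun x => c%:C * g x)%R = c * rin f g.
Proof. by move=> *; rewrite rinC rinZl// rinC. Qed.

Lemma rinNl f g : L2 f -> L2 g -> rin (fun x => - f x)%R g = - rin f g.
Proof.
move=> Lf Lg; rewrite -mulN1r -rinZl//; congr rin; apply/funext => x.
by rewrite rmorphN1 mulN1r.
Qed.

Lemma rinNr f g : L2 f -> L2 g -> rin f (fun x => - g x)%R = - rin f g.
Proof. by move=> *; rewrite rinC rinNl// rinC. Qed.

Lemma rinBl f g h : L2 f -> L2 g -> L2 h ->
  rin (fun x => f x - g x)%R h = rin f h - rin g h.
Proof.
move=> Lf Lg Lh.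
by rewrite (@rinDl f (fun x => - g x)%R) ?rinNl//; exact: Lp_opp.
Qed.

Lemma rinMl a f g : rin (fun x => a * f x)%R g = rin f (fun x => conjc a * g x)%R.
Proof. by congr fine; apply: eq_integral => x _; rewrite dotMl. Qed.

Lemma rin_ae f f' g g' : cmeasurable f -> cmeasurable f' -> cmeasurable g ->
  cmeasurable g' -> (\forall x \ae nu, f x = f' x) ->
  (\forall x \ae nu, g x = g' x) -> rin f g = rin f' g'.
Proof.
move=> mf mf' mg mg' ff' gg'; congr fine; apply: ae_eq_integral => //.
- by apply/measurable_EFinP; exact: measurable_dot.
- by apply/measurable_EFinP; exact: measurable_dot.
- by move: ff' gg'; apply: filterS2 => x -> ->.
Qed.

Lemma rinxx f : L2 f -> mom nu 2 f = (rin f f)%:E.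
Proof.
by move=> Lf; rewrite EFin_rin// mom2E; apply: eq_integral => x _; rewrite dotxx.
Qed.

Lemma rin_ge0 f : 0 <= rin f f.
Proof.
by apply: fine_ge0; apply: integral_ge0 => x _; rewrite dotxx lee_fin nsq_ge0.
Qed.

Lemma rin_eq0 f : L2 f -> rin f f = 0 -> \forall x \ae nu, f x = 0.
Proof.
move=> Lf f0; apply: (@mom_eq0 _ _ _ nu 2) => //; first exact: L2_measurable.
by rewrite rinxx// f0.
Qed.

Lemma rin_sqrD f g : L2 f -> L2 g ->
  rin (fun x => f x + g x)%R (fun x => f x + g x)%R =
  rin f f + 2 * rin f g + rin g g.
Proof.
move=> Lf Lg; have Lfg := Lp_add two_gt0 Lf Lg.
by rewrite rinDl// !rinDr// (rinC g f); ring.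
Qed.

Lemma rin_sqrB f g : L2 f -> L2 g ->
  rin (fun x => f x - g x)%R (fun x => f x - g x)%R =
  rin f f - 2 * rin f g + rin g g.
Proof.
move=> Lf Lg; have Lg' := Lp_opp two_gt0 Lg.
rewrite (@rin_sqrD f (fun x => - g x)%R)// rinNr// rinNl// rinNr//; ring.
Qed.

Lemma rin_CS f g : L2 f -> L2 g -> rin f g ^+ 2 <= rin f f * rin g g.
Proof.
move=> Lf Lg.
have [f0|fn0] := eqVneq (rin f f) 0.
  have : rin f g = 0.
    rewrite (rin_ae (L2_measurable Lf) (cmeasurable_cst 0) (L2_measurable Lg)
      (L2_measurable Lg) (rin_eq0 Lf f0) (aeW _ (fun x => erefl (g x)))).
    by rewrite /rin; under eq_integral do rewrite dot0l; rewrite integral0.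
  by move=> ->; rewrite f0 mul0r expr0n.
have fp : 0 < rin f f by rewrite lt_def fn0 rin_ge0.
pose t := rin f g / rin f f.
have := rin_ge0 (fun x => g x - t%:C * f x).
have Ltf := Lp_scale t%:C two_gt0 Lf.
rewrite (@rin_sqrB g (fun x => t%:C * f x)%R)// !rinZr// rinZl// (rinC g f).
have -> : rin g g - 2 * (t * rin f g) + t * (t * rin f f) = rin g g - rin f g ^+ 2 / rin f f.
  by rewrite /t; field.
by rewrite subr_ge0 ler_pdivrMr// mulrC.
Qed.

Lemma innerE f g : inner nu f g = Complex (rin f g) (rin f (fun x => 'i%C * g x)%R).
Proof.
rewrite /inner /cintegral; congr Complex; congr fine; apply: eq_integral => x _;
  congr (_%:E); rewrite dot.unlock.
- by case: (f x) (g x) => [a b] [c d] /=; ring.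
- by case: (f x) (g x) => [a b] [c d] /=; ring.
Qed.

Lemma rin_separates f g : L2 f -> L2 g ->
  (forall h, L2 h -> rin f h = rin g h) -> \forall x \ae nu, f x = g x.
Proof.
move=> Lf Lg fg; have Lfg := Lp_sub two_gt0 Lf Lg.
have := rin_eq0 Lfg; rewrite rinBl// fg// subrr => /(_ erefl).
by apply: filterS => x /eqP; rewrite subr_eq0 => /eqP.
Qed.

End L2.

(** * Truncation and density *)

Section Density.
Context {dX} {X : measurableType dX} {R : realType}.
Variable nu : {measure set X -> \bar R}.
Implicit Types (f g h : X -> R[i]) (p q : R).

(** Removing both large and small values puts a function of L^p into every L^q: what is left is
    bounded and lives on a set of finite measure. *)
Definition band (n : nat) f : set X := [set x | n.+1%:R^-1 <= normc (f x) <= n.+1%:R].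
Definition trunc (n : nat) f : X -> R[i] := fun x => (\1_(band n f) x)%:C * f x.

Lemma measurable_band n f : cmeasurable f -> measurable (band n f).
Proof.
move=> mf; have := measurable_normc mf => /(_ measurableT) H.
have := H `[n.+1%:R^-1, n.+1%:R]%classic (measurable_itv _).
by rewrite setTI; congr (measurable _); apply/seteqP; split => x /=; rewrite in_itv.
Qed.

Lemma cmeasurable_trunc n f : cmeasurable f -> cmeasurable (trunc n f).
Proof.
move=> mf; apply: cmeasurableM => //; apply: cmeasurable_real.
by apply: measurable_indic; exact: measurable_band.
Qed.

Lemma normc_trunc_le n f x : normc (trunc n f x) <= normc (f x).
Proof.
rewrite /trunc normcM normc_real ler_piMl ?normc_ge0// indicE.
by case: (_ \in _); rewrite ?normr1 ?normr0.
Qed.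

Lemma trunc_near f x : \forall n \near \oo, trunc n f x = f x.
Proof.
have [fx0|fx0] := eqVneq (f x) 0.
  by apply: nearW => n; rewrite /trunc fx0 mulr0.
have np : 0 < normc (f x).
  by rewrite lt_def normc_ge0 andbT; apply: contra fx0 => /eqP/normc_eq0 ->.
near=> n; rewrite /trunc indicE mem_set ?rmorph1 ?mul1r// /band /=.
apply/andP; split.
  rewrite invf_ple ?posrE//; near: n.
  have [N _ HN] := nbhs_infty_ger (normc (f x))^-1.
  by exists N => // n /= Nn; apply: le_trans (HN _ Nn) _; rewrite ler_nat.
near: n; have [N _ HN] := nbhs_infty_ger (normc (f x)).
by exists N => // n /= Nn; apply: le_trans (HN _ Nn) _; rewrite ler_nat.
Unshelve. all: by end_near. Qed.

Lemma Lp_trunc p q n f : 0 < p -> 0 < q -> Lp nu p%:E f -> Lp nu q%:E (trunc n f).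
Proof.
move=> p0 q0 /(LpP nu _ p0)[mf ff]; apply/(LpP nu _ q0); split.
  exact: cmeasurable_trunc.
(* On the band |f|^q <= (n+1)^q and 1 <= ((n+1) |f|)^p; the product of the two is c |f|^p. *)
pose c : R := n.+1%:R `^ q * n.+1%:R `^ p.
apply: (@le_lt_trans _ _ (c%:E * mom nu p f)%E); last first.
  by rewrite lte_mul_pinfty ?lee_fin ?mulr_ge0 ?powR_ge0.
rewrite /mom -ge0_integralZl_EFin ?mulr_ge0 ?powR_ge0//; last 2 first.
- by move=> x _; rewrite lee_fin powR_ge0.
- exact: measurable_mom.
apply: ge0_le_integral => //.
- by move=> x _; rewrite lee_fin powR_ge0.
- by apply: measurable_mom; exact: cmeasurable_trunc.
- by apply: measurable_funeM; exact: measurable_mom.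
move=> x _; rewrite -EFinM lee_fin /trunc normcM normc_real indicE.
have [|] := boolP (x \in band n f); last first.
  by rewrite normr0 mul0r powR0 ?gt_eqF// mulr_ge0 ?mulr_ge0 ?powR_ge0.
rewrite inE /band /= normr1 mul1r => /andP[x1 x2].
rewrite /c -mulrA -powRM ?normc_ge0//.
rewrite -[leLHS]mulr1; apply: ler_pM; rewrite ?powR_ge0//.
  by apply: ge0_ler_powR; rewrite ?nnegrE ?normc_ge0// ltW.
rewrite -[leLHS](_ : 1 `^ p = 1); last by rewrite powR1.
apply: ge0_ler_powR; rewrite ?nnegrE ?mulr_ge0 ?normc_ge0 ?(ltW p0)//.
by rewrite -ler_pdivrMl// mulr1.
Qed.

Lemma mom_trunc_cvg p f : 0 < p -> Lp nu p%:E f ->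
  mom nu p (fun x => trunc n f x - f x)%R @[n --> \oo] --> 0%E.
Proof.
move=> p0 /(LpP nu _ p0)[mf ff].
have mB n : cmeasurable (fun x => trunc n f x - f x).
  by apply: cmeasurableB => //; exact: cmeasurable_trunc.
have [] := @dominated_convergence _ _ _ nu setT measurableT
  (fun n x => (normc (trunc n f x - f x) `^ p)%:E) (fun=> 0%E)
  (fun x => (normc (f x) `^ p)%:E).
- by move=> n; exact: measurable_mom.
- exact: measurable_cst.
- apply: aeW => x _; apply: cvg_near_cst; have := trunc_near f x; apply: filterS => n ->.
  by rewrite subrr normc0 powR0 ?gt_eqF.
- apply/integrableP; split; first exact: measurable_mom.
  by under eq_integral => x _ do rewrite gee0_abs ?lee_fin ?powR_ge0//.
- apply: aeW => x n _; rewrite gee0_abs ?lee_fin ?powR_ge0//.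
  apply: ge0_ler_powR; rewrite ?nnegrE ?normc_ge0 ?(ltW p0)//.
  rewrite /trunc -[X in _ - X]mul1r -mulrBl normcM ler_piMl ?normc_ge0//.
  rewrite -(rmorph1 (@real_complex R)) -rmorphB normc_real indicE.
  by case: (_ \in _); rewrite ?subrr ?sub0r ?normrN ?normr0 ?normr1.
by move=> _ _; rewrite integral0.
Qed.

Lemma Lp_dense p q f (e : R) : 0 < p -> 0 < q -> 0 < e -> Lp nu p%:E f ->
  exists v, [/\ Lp nu p%:E v, Lp nu q%:E v,
    forall x, normc (v x) <= normc (f x) &
    (mom nu p (fun x => v x - f x)%R <= e%:E)%E].
Proof.
move=> p0 q0 e0 Lf; have H := mom_trunc_cvg p0 Lf.
have [n Hn] : exists n, (mom nu p (fun x => trunc n f x - f x)%R <= e%:E)%E.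
  have : \forall n \near \oo, (mom nu p (fun x => trunc n f x - f x)%R < e%:E)%E.
    apply: (H [set y | (y < e%:E)%E]); apply: open_nbhs_nbhs; split.
      exact: open_ereal_lt_ereal.
    by rewrite /= lte_fin.
  by case=> N _ HN; exists N; apply/ltW/HN => /=.
exists (trunc n f); split => //.
- exact: Lp_trunc Lf.
- exact: Lp_trunc Lf.
- by move=> x; exact: normc_trunc_le.
Qed.

End Density.

(** * Norm bounds from inhomogeneous form bounds *)

Section Duality.
Context {dX} {X : measurableType dX} {R : realType}.
Variable nu : {measure set X -> \bar R}.
Implicit Types (f g h : X -> R[i]).
Variables (p K : R).
Hypotheses (p1 : 1 < p) (K0 : 0 < K).
Local Notation q := (p / (p - 1)).

(* Obtained by testing against s |h|^(p-2) h with s = (2K)^(1-p), for which the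
   term K |s h|^q is half of the pairing. *)
Definition dual_const := 2 * K / (2 * K) `^ (- (p - 1)).

Let s := (2 * K) `^ (- (p - 1)).
Let s0 : 0 < s. Proof. by rewrite powR_gt0 ?mulr_gt0. Qed.
Let pm1 : 0 < p - 1. Proof. by rewrite subr_gt0. Qed.
Let p0 : 0 < p. Proof. exact: lt_trans p1. Qed.
Let q0 : 0 < q. Proof. by rewrite divr_gt0. Qed.

Lemma dual_const_ge0 : 0 <= dual_const.
Proof. by rewrite divr_ge0 ?mulr_ge0 ?powR_ge0// ltW. Qed.

(** Since - (p - 1) q = - p, the power s^q is s / (2 K). *)
Let sq : K * s `^ q = s / 2.
Proof.
rewrite /s -powRrM (_ : - (p - 1) * q = - (p - 1) - 1); last first.
  by field; rewrite gt_eqF.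
rewrite powRD; last by rewrite (gt_eqF (mulr_gt0 (ltr0Sn _ 1) K0)) implybT.
rewrite (powRN _ 1) powRr1; last by rewrite mulr_ge0// ltW.
by move: (_ `^ _) => a; field; rewrite gt_eqF.
Qed.

Let g n h : X -> R[i] := fun x => (s * normc (h x) `^ (p - 2))%:C * trunc n h x.

Let cmeasurable_g n h : cmeasurable h -> cmeasurable (g n h).
Proof.
move=> mh; apply: cmeasurableM; last exact: cmeasurable_trunc.
by apply: cmeasurable_real; apply: measurable_funM => //; exact: measurable_normc_powR.
Qed.

Let band_gt0 n h x : x \in band n h -> 0 < normc (h x).
Proof. by rewrite inE /band /= => /andP[+ _]; apply: lt_le_trans; rewrite invr_gt0. Qed.

Let normc_g n h x : normc (g n h x) = s * normc (trunc n h x) `^ (p - 1).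
Proof.
rewrite /g /trunc !normcM !normc_real indicE ger0_norm ?mulr_ge0 ?powR_ge0//.
have [xA|_] := boolP (x \in band n h); last first.
  by rewrite normr0 !mul0r mulr0 powR0 ?mulr0// gt_eqF.
rewrite normr1 !mul1r -mulrA; congr (_ * _).
rewrite -{2}(powRr1 (normc_ge0 (h x))) -powRD; last by rewrite (gt_eqF (band_gt0 xA)) implybT.
by congr (_ `^ _); ring.
Qed.

Let mom_g r n h : 0 < r -> cmeasurable h ->
  mom nu r (g n h) = ((s `^ r)%:E * mom nu (r * (p - 1)) (trunc n h))%E.
Proof.
move=> r0 mh; rewrite /mom -ge0_integralZl_EFin ?powR_ge0//; last 2 first.
- by move=> x _; rewrite lee_fin powR_ge0.
- by apply: measurable_mom; exact: cmeasurable_trunc.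
apply: eq_integral => x _.
by rewrite normc_g powRM ?powR_ge0 ?(ltW s0)// -EFinM -powRrM (mulrC r).
Qed.

(** Let M be the moment of the truncation of h. Testing against the truncated function gives s M <=
    K A + (s / 2) M, and the last term can be moved to the left because M is finite, which is the
    purpose of the truncation. Fatou then removes it. *)
Lemma dual_bound h A : Lp nu 2%:E h -> 0 <= A ->
  (forall f, Lp nu 2%:E f -> Lp nu q%:E f ->
    rin nu h f <= K * (A + fine (mom nu q f))) ->
  (mom nu p h <= (dual_const * A)%:E)%E.
Proof.
move=> Lh A0 H; have mh := L2_measurable Lh.
have Lt n r : 0 < r -> Lp nu r%:E (trunc n h) by move=> r0; exact: Lp_trunc Lh.
have Lg n r : 0 < r -> Lp nu r%:E (g n h).
  move=> r0; apply/(LpP _ _ r0); split; first exact: cmeasurable_g.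
  rewrite mom_g// lte_mul_pinfty ?lee_fin ?powR_ge0//.
  by have /(LpP nu _ (mulr_gt0 r0 pm1))[] := Lt n (r * (p - 1)) (mulr_gt0 r0 pm1).
have tfin n : (mom nu p (trunc n h) < +oo)%E.
  by have /(LpP nu _ p0)[] := Lt n p p0.
have tE n : mom nu p (trunc n h) = (fine (mom nu p (trunc n h)))%:E.
  by rewrite fineK// ge0_fin_numE// mom_ge0.
have B n : (mom nu p (trunc n h) <= (dual_const * A)%:E)%E.
  have := H _ (Lg n _ (ltr0Sn _ 1)) (Lg n _ q0).
  have -> : rin nu h (g n h) = s * fine (mom nu p (trunc n h)).
    rewrite /rin; have -> : (\int[nu]_x (dot (h x) (g n h x))%:E =
        s%:E * mom nu p (trunc n h))%E.
      rewrite /mom -ge0_integralZl_EFin ?(ltW s0)//; last 2 first.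
      - by move=> x _; rewrite lee_fin powR_ge0.
      - by apply: measurable_mom; exact: cmeasurable_trunc.
      apply: eq_integral => x _; rewrite -EFinM; congr (_%:E).
      rewrite /g /trunc dotZr dotZr dotxx -normc_powR2 normcM normc_real indicE.
      have [xA|_] := boolP (x \in band n h); last first.
        by rewrite normr0 !mul0r powR0 ?mulr0// gt_eqF.
      rewrite normr1 !mul1r -mulrA -powRD; last by rewrite (gt_eqF (band_gt0 xA)) implybT.
      by rewrite subrK.
    by rewrite tE fineM.
  rewrite mom_g// (_ : q * (p - 1) = p); last by rewrite divfK// gt_eqF.
  rewrite tE fineM// /= lee_fin mulrDr mulrA sq => HH.
  rewrite /dual_const -/s mulrAC ler_pdivlMr//.
  by move: HH; move: (fine _) => G; rewrite (mulrC G); lra.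
apply: (mom_fatou (ltW p0) (fun n => cmeasurable_trunc n mh) mh _ B (cvg_cst _)).
apply: aeW => x; apply: cvg_near_cst; have := trunc_near h x; apply: filterS => n ->.
by rewrite subrr normc0.
Qed.

End Duality.

(** * Contractions decrease the Bellman integral *)

Import HBNNSimple.

Section SimpleApproximation.
Context {dX} {X : measurableType dX} {R : realType}.
Implicit Types (f g h : X -> R[i]).

Lemma simple_approx (u : X -> R) : measurable_fun setT u ->
  exists s : nat -> X -> R,
    [/\ forall n, measurable_fun setT (s n), forall n, finite_set (range (s n)),
        forall n x, `|s n x| <= `|u x| &
        forall x, s n x @[n --> \oo] --> u x].
Proof.
move=> mu.
have A (v : X -> R) : measurable_fun setT v -> (forall x, 0 <= v x) ->
  exists s : nat -> X -> R,
    [/\ forall n, measurable_fun setT (s n), forall n, finite_set (range (s n)),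
        forall n x, 0 <= s n x <= v x &
        forall x, s n x @[n --> \oo] --> v x].
  move=> mv v0.
  have [||s [snd scv]] := @approximation _ X R setT measurableT (fun x => (v x)%:E).
  - exact/measurable_EFinP.
  - by move=> x _; rewrite lee_fin.
  have cv x : s n x @[n --> \oo] --> v x.
    by apply: (fine_cvg (f := fun n => (s n x)%:E)); exact: scv.
  exists (fun n => s n); split => //.
  - move=> n x; rewrite fun_ge0/=; rewrite -(cvg_lim _ (cv x))//.
    apply: nondecreasing_cvgn_le; last exact: cvgP (cv x).
    by move=> a b ab; have /lefP := snd a b ab; exact.
have [||sp [p1 p2 p3 p4]] := A (fun x => Num.max (u x) 0).
- exact: measurable_maxr.
- by move=> x; rewrite le_max lexx orbT.
have [||sm [m1 m2 m3 m4]] := A (fun x => Num.max (- u x) 0).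
- by apply: measurable_maxr => //; exact: measurableT_comp.
- by move=> x; rewrite le_max lexx orbT.
exists (fun n x => sp n x - sm n x); split.
- by move=> n; exact: measurable_funB.
- move=> n; apply: (@sub_finite_set _ _ ((fun z : R * R => z.1 - z.2) @` (range (sp n) `*` range (sm n)))).
    by move=> _ [x _ <-]; exists (sp n x, sm n x) => //; split; exists x.
  by apply: finite_image; exact: finite_setX.
- move=> n x; have /andP[a1 a2] := p3 n x; have /andP[b1 b2] := m3 n x.
  have [u0|u0] := leP 0 (u x).
    rewrite (max_idPl u0) in a2.
    have : sm n x = 0.
      apply/eqP; rewrite eq_le b1 andbT; apply: le_trans b2 _.
      by rewrite ge_max lexx oppr_le0 u0.
    by move=> ->; rewrite subr0 !ger0_norm.
  have u0' : 0 <= - u x by rewrite oppr_ge0 ltW.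
  rewrite (max_idPl u0') in b2.
  have : sp n x = 0.
    apply/eqP; rewrite eq_le a1 andbT; apply: le_trans a2 _.
    by rewrite ge_max lexx ltW.
  by move=> ->; rewrite sub0r normrN (ger0_norm b1) (ltr0_norm u0).
- move=> x; rewrite [X in _ --> X](_ : _ = Num.max (u x) 0 - Num.max (- u x) 0).
    exact: cvgB.
  have [u0|u0] := leP 0 (u x).
    by rewrite max_r ?subr0// oppr_le0.
  by rewrite max_l ?sub0r ?opprK// oppr_ge0 ltW.
Qed.

(** Both functions factor through one finite measurable partition, so any function of the pair is
    constant on its cells. *)
Definition csimple2 f g := exists (I : finType) (c : X -> I) (phi psi : I -> R[i]),
  [/\ forall i, measurable (c @^-1` [set i]), f = phi \o c & g = psi \o c].

(** The cells are indexed by the finite set of values of the quadruple. *)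
Lemma csimple2_real (s1 s2 s3 s4 : X -> R) :
  measurable_fun setT s1 -> measurable_fun setT s2 ->
  measurable_fun setT s3 -> measurable_fun setT s4 ->
  finite_set (range s1) -> finite_set (range s2) ->
  finite_set (range s3) -> finite_set (range s4) ->
  csimple2 (fun x => Complex (s1 x) (s2 x)) (fun x => Complex (s3 x) (s4 x)).
Proof.
move=> m1 m2 m3 m4 f1 f2 f3 f4.
pose S x := (s1 x, s2 x, s3 x, s4 x).
have fS : finite_set (range S).
  apply: (@sub_finite_set _ _ (range s1 `*` range s2 `*` range s3 `*` range s4)).
    by move=> _ [x _ <-]; do ![split => /=]; exists x.
  by do ![apply: finite_setX => //].
have HS x : S x \in fset_set (range S) by rewrite in_fset_set//; apply/mem_set; exists x.
pose I : finType := fset_set (range S).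
pose c x : I := FSetSub (HS x).
exists I, c, (fun i => Complex (val i).1.1.1 (val i).1.1.2),
  (fun i => Complex (val i).1.2 (val i).2); split => //.
move=> i.
have mpre (s : X -> R) r : measurable_fun setT s -> measurable (s @^-1` [set r]).
  by move=> ms; rewrite -[X in measurable X]setTI; exact: ms.
rewrite (_ : _ @^-1` _ = s1 @^-1` [set (val i).1.1.1] `&` s2 @^-1` [set (val i).1.1.2] `&`
    (s3 @^-1` [set (val i).1.2] `&` s4 @^-1` [set (val i).2])).
  by do ![apply: measurableI]; exact: mpre.
apply/seteqP; split => x /=; first by move=> <-.
move=> [[e1 e2] [e3 e4]]; apply: val_inj; rewrite /= /S e1 e2 e3 e4.
by case: (val i) => [[[]]].
Qed.

Lemma csimple2_approx f g : cmeasurable f -> cmeasurable g ->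
  exists F G : nat -> X -> R[i],
    [/\ forall n, csimple2 (F n) (G n),
        forall n x, normc (F n x) <= normc (f x) /\ normc (G n x) <= normc (g x),
        forall x, normc (F n x - f x) @[n --> \oo] --> 0 &
        forall x, normc (G n x - g x) @[n --> \oo] --> 0].
Proof.
move=> [f1 f2] [g1 g2].
have [s1 [a1 b1 c1 d1]] := simple_approx f1.
have [s2 [a2 b2 c2 d2]] := simple_approx f2.
have [s3 [a3 b3 c3 d3]] := simple_approx g1.
have [s4 [a4 b4 c4 d4]] := simple_approx g2.
have N (a b : R) (z : R[i]) : `|a| <= `|complex.Re z| -> `|b| <= `|complex.Im z| ->
    normc (Complex a b) <= normc z.
  move=> az bz; rewrite !normcE ler_wsqrtr// !nsq.unlock /=.
  by apply: lerD; rewrite -(real_normK (num_real _)) -[leRHS]real_normK ?num_real//;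
    rewrite ler_pXn2r ?nnegrE.
have L (a b : nat -> R) (z : R[i]) : a n @[n --> \oo] --> complex.Re z ->
    b n @[n --> \oo] --> complex.Im z ->
    normc (Complex (a n) (b n) - z) @[n --> \oo] --> 0.
  move=> az bz.
  have H0 (u : nat -> R) (l : R) : u n @[n --> \oo] --> l -> `|u n - l| @[n --> \oo] --> 0.
    move=> al; apply/cvgrPdist_le => e e0.
    move/cvgrPdist_le : al => /(_ e e0); apply: filterS => n.
    by rewrite sub0r normrN normr_id distrC.
  have H : `|a n - complex.Re z| + `|b n - complex.Im z| @[n --> \oo] --> 0.
    by rewrite -(addr0 0); apply: cvgD; exact: H0.
  apply: (squeeze0 _ H) => n; rewrite normc_ge0 /=.
  by have := normc_le_ReIm (Complex (a n) (b n) - z); rewrite !ReImE.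
exists (fun n x => Complex (s1 n x) (s2 n x)), (fun n x => Complex (s3 n x) (s4 n x)).
split.
- by move=> n; exact: csimple2_real.
- by move=> n x; split; exact: N.
- by move=> x; exact: L.
- by move=> x; exact: L.
Qed.

End SimpleApproximation.

Section RationalPhases.
Context {R : realType}.

Definition ratc (z : rat * rat) : R[i] := Complex (ratr z.1) (ratr z.2).

(* Countably many phases suffice, so that the hypothesis can be checked almost
   everywhere at once. *)
Lemma sum_normc_le1 (I : finType) (z : I -> R[i]) :
  (forall e : {ffun I -> rat * rat}, (forall i, normc (ratc (e i)) <= 1) ->
    normc (\sum_i ratc (e i) * z i) <= 1) ->
  \sum_i normc (z i) <= 1.
Proof.
move=> H; apply/ler_addgt0Pr => d0 d0p.
set S := \sum_i normc (z i).
have S0 : 0 <= S by apply: sumr_ge0 => i _; exact: normc_ge0.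
(* With this d, the bound (1 - 2 d) S <= 1 gives S <= 1 + d0. *)
pose d := Num.min (1 / 2) (d0 / (2 * (S + 1))).
have dp : 0 < d by rewrite lt_min !divr_gt0// mulr_gt0// ltr_wpDl.
have d1 : d <= 1 / 2 by rewrite ge_min lexx.
have dS : 2 * d * S <= d0.
  have : d <= d0 / (2 * (S + 1)) by rewrite ge_min lexx orbT.
  rewrite ler_pdivlMr ?mulr_gt0 ?ltr_wpDl// => H1.
  by apply: le_trans H1; have := ltW dp; nra.
have near_rat (w : R[i]) : exists a : rat * rat, normc (ratc a - w) <= d.
  have d2 : 0 < d / 2 by rewrite divr_gt0.
  have [a /andP[a1 a2]] : exists a : rat, complex.Re w - d / 2 < ratr a < complex.Re w + d / 2.
    have [|a] := @rat_in_itvoo R (complex.Re w - d / 2) (complex.Re w + d / 2).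
      by rewrite ltrD2l; lra.
    by rewrite in_itv /=; exists a.
  have [b /andP[b1 b2]] : exists b : rat, complex.Im w - d / 2 < ratr b < complex.Im w + d / 2.
    have [|b] := @rat_in_itvoo R (complex.Im w - d / 2) (complex.Im w + d / 2).
      by rewrite ltrD2l; lra.
    by rewrite in_itv /=; exists b.
  exists (a, b); apply: le_trans (normc_le_ReIm _) _; rewrite !ReImE /=.
  have A : `|ratr a - complex.Re w| <= d / 2 by rewrite ler_norml; apply/andP; split; lra.
  have B : `|ratr b - complex.Im w| <= d / 2 by rewrite ler_norml; apply/andP; split; lra.
  by move: A B; lra.
(* The optimal phase conj u is shrunk by 1 - d, so that a rational point within d of the shrunk
   phase stays in the unit disc; the total loss is a factor 1 - 2 d. *)
have Hi i : {a : rat * rat | normc (ratc a) <= 1 /\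
    (1 - 2 * d) * normc (z i) <= complex.Re (ratc a * z i)}.
  apply: cid; have [u u1 zu] := polar_decomp (z i).
  have [a Ha] := near_rat ((1 - d)%:C * conjc u).
  have nw : normc ((1 - d)%:C * conjc u) = 1 - d.
    by rewrite normcM normc_real normc_conj u1 mulr1 ger0_norm// subr_ge0; lra.
  exists a; split.
    have := normcD (ratc a - (1 - d)%:C * conjc u) ((1 - d)%:C * conjc u).
    by rewrite subrK nw => /le_trans; apply; lra.
  have -> : ratc a * z i = (1 - d)%:C * conjc u * z i + (ratc a - (1 - d)%:C * conjc u) * z i.
    by rewrite -mulrDl subrKC.
  rewrite ReD.
  have -> : (1 - d)%:C * conjc u * z i = ((1 - d) * normc (z i))%:C.
    rewrite {1}zu mulrACA -rmorphM.
    by rewrite conjc_unit// mulr1.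
  have := Re_le_normc ((ratc a - (1 - d)%:C * conjc u) * z i).
  rewrite normcM ler_norml => /andP[+ _].
  have : normc (ratc a - (1 - d)%:C * conjc u) * normc (z i) <= d * normc (z i).
    by apply: ler_wpM2r => //; exact: normc_ge0.
  by rewrite /=; lra.
pose e := [ffun i => projT1 (Hi i)].
have /H : forall i, normc (ratc (e i)) <= 1.
  by move=> i; rewrite ffunE; have [] := projT2 (Hi i).
move/(le_trans (le_trans (ler_norm _) (Re_le_normc _))).
rewrite Re_sum.
have : (1 - 2 * d) * S <= \sum_i complex.Re (ratc (e i) * z i).
  rewrite /S mulr_sumr; apply: ler_sum => i _; rewrite ffunE.
  by have [] := projT2 (Hi i).
by move: dS; lra.
Qed.

End RationalPhases.

Section Contraction.
Context {dX} {X : measurableType dX} {R : realType}.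
Variable nu : {measure set X -> \bar R}.
Implicit Types (f g h : X -> R[i]).
Local Notation L2 := (Lp nu 2%:E).

(** All clauses concern functions of L^2, where the semigroups are defined. The L^oo clause takes
    functions bounded by 1 everywhere, such as combinations of disjoint indicators with coefficients
    in the unit disc. *)
Record bicontraction (T : (X -> R[i]) -> (X -> R[i])) : Prop := Bicontraction {
  bic_L2 : forall f, L2 f -> L2 (T f) ;
  bic_lin : forall (a : R[i]) f g, L2 f -> L2 g ->
    \forall x \ae nu, T (fun x => a * f x + g x)%R x = a * T f x + T g x ;
  bic_norm2 : forall f, L2 f -> (mom nu 2 (T f) <= mom nu 2 f)%E ;
  bic_norm1 : forall f, L2 f -> (mom nu 1 (T f) <= mom nu 1 f)%E ;
  bic_normoo : forall f, L2 f -> (forall x, normc (f x) <= 1) ->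
    \forall x \ae nu, normc (T f x) <= 1 }.

Variable T : (X -> R[i]) -> (X -> R[i]).
Hypothesis bT : bicontraction T.

Let two_gt0 : 0 < 2 :> R. Proof. by []. Qed.

Lemma bic0 : \forall x \ae nu, T (fun=> 0) x = 0.
Proof.
have L0 := Lp0 nu two_gt0.
have := bic_lin bT (-1) L0 L0; apply: filterS => x.
rewrite (_ : (fun x : X => (-1 : R[i]) * 0 + 0) = (fun=> 0)).
  by rewrite mulN1r addNr.
by apply/funext => y; rewrite mulr0 addr0.
Qed.

Lemma bic_sum (I : Type) (s : seq I) (a : I -> R[i]) (e : I -> X -> R[i]) :
  (forall i, L2 (e i)) ->
  \forall x \ae nu, T (fun y => \sum_(i <- s) a i * e i y)%R x =
                    \sum_(i <- s) a i * T (e i) x.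
Proof.
move=> Le; elim: s => [|i s IH].
  rewrite (_ : (fun y => _) = (fun=> 0)); last by apply/funext => y; rewrite big_nil.
  by have := bic0; apply: filterS => x ->; rewrite big_nil.
have Ls : L2 (fun y => \sum_(j <- s) a j * e j y).
  by apply: Lp_sum => // j; exact: Lp_scale.
have := bic_lin bT (a i) (Le i) Ls; move: IH; apply: filterS2 => x IH.
by rewrite big_cons -IH => <-; congr T; apply/funext => y; rewrite big_cons.
Qed.

(** Stands in for the total mass of a kernel of T, which need not be positive. For |a_i| <= 1 the
    sum of the a_i e_i is bounded by 1, hence so is its image almost everywhere; a supremum over the
    phases a_i turns this into the sum of the moduli. *)
Lemma bic_kernel_le1 (I : finType) (e : I -> X -> R[i]) :
  (forall i, L2 (e i)) -> (forall x, \sum_i normc (e i x) <= 1) ->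
  \forall x \ae nu, \sum_i normc (T (e i) x) <= 1.
Proof.
move=> Le e1.
pose P (a : {ffun I -> rat * rat}) x := (forall i, normc (@ratc R (a i)) <= 1) ->
  normc (\sum_i ratc (a i) * T (e i) x) <= 1.
have Pa a : \forall x \ae nu, P a x.
  have [a1|na1] := pselect (forall i, normc (@ratc R (a i)) <= 1); last first.
    by apply: aeW => x /na1.
  have La : L2 (fun y => \sum_i ratc (a i) * e i y).
    by apply: Lp_sum => // i; exact: Lp_scale.
  have b1 y : normc (\sum_i ratc (a i) * e i y) <= 1.
    apply: le_trans (normc_sum _ _ _) _; apply: le_trans (e1 y).
    by apply: ler_sum => i _; rewrite normcM ler_piMl ?normc_ge0.
  have := bic_normoo bT La b1.
  have := bic_sum (index_enum I) (fun i => ratc (a i)) Le.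
  by apply: filterS2 => x -> ? _.
(* The countably many phase vectors are enumerated by [unpickle], so that one null set serves all of
   them. *)
have : \forall x \ae nu, forall n : nat,
    if @choice.unpickle {ffun I -> rat * rat} n is Some a then P a x else True.
  by apply: ae_foralln => n; case: choice.unpickle => [a|]; [exact: Pa|exact: aeW].
apply: filterS => x Hx; apply: sum_normc_le1 => a.
by have := Hx (choice.pickle a); rewrite choice.pickleK; exact.
Qed.

End Contraction.

Lemma subseq_cvg {T : topologicalType} (u : nat -> T) (k : nat -> nat) (l : T) :
  (forall n, (n <= k n)%N) -> u n @[n --> \oo] --> l -> u (k n) @[n --> \oo] --> l.
Proof.
move=> kn ul A /ul [N _ HN]; exists N => // n /= Nn; apply: HN.
exact: leq_trans (kn n).
Qed.

Lemma cvg_near_le {R : realType} (u : nat -> \bar R) (e : R) : 0 < e ->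
  u n @[n --> \oo] --> 0%E -> \forall n \near \oo, (u n <= e%:E)%E.
Proof.
move=> e0 H; have : \forall n \near \oo, (u n < e%:E)%E.
  apply: (H [set y | (y < e%:E)%E]); apply: open_nbhs_nbhs; split.
    exact: open_ereal_lt_ereal.
  by rewrite /= lte_fin.
by apply: filterS => n /ltW.
Qed.

(** * The Bellman integral under one contraction *)

Section BellmanFlow.
Context {dX} {X : measurableType dX} {R : realType}.
Variable nu : {measure set X -> \bar R}.
Implicit Types (f g h : X -> R[i]).
Variable p : R.
Hypotheses (p1 : 1 < p) (p2 : p <= 2).
Local Notation L2 := (Lp nu 2%:E).
Local Notation q := (p / (p - 1)).

Let two_gt0 : 0 < 2 :> R. Proof. by []. Qed.
Let p0 : 0 < p. Proof. exact: lt_trans p1. Qed.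
Let q0 : 0 < q. Proof. by rewrite divr_gt0// subr_gt0. Qed.
Let k0 : 0 <= 2 / (p - 1) + 1.
Proof. by rewrite addr_ge0// divr_ge0// subr_ge0 ltW. Qed.

Let bellm f g : \bar R := (\int[nu]_x (bell p (f x) (g x))%:E)%E.

Lemma bell_cvg (F G : nat -> R[i]) z e :
  normc (F n - z) @[n --> \oo] --> 0 -> normc (G n - e) @[n --> \oo] --> 0 ->
  bell p (F n) (G n) @[n --> \oo] --> bell p z e.
Proof.
move=> Fz Ge; apply/cvgrPdist_le => d d0.
pose M := (2 / (p - 1) + 1) * (normc z + 2) `^ p + 2 * (normc e + 2) `^ q.
have M0 : 0 <= M by rewrite addr_ge0 ?mulr_ge0 ?powR_ge0.
pose del := Num.min 1 (d / (M + 1)).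
have del0 : 0 < del by rewrite lt_min ltr01 divr_gt0// ltr_wpDl.
move/cvgrPdist_le : Fz => /(_ _ del0) Fz; move/cvgrPdist_le : Ge => /(_ _ del0) Ge.
move: Fz Ge; apply: filterS2 => n.
rewrite !sub0r !normrN !(ger0_norm (normc_ge0 _)) => Fz Ge.
rewrite distrC; apply: le_trans (bell_lip p1 p2 del0 _ Fz Ge) _.
  by rewrite ge_min lexx.
rewrite -/M; apply: (@le_trans _ _ (d / (M + 1) * M)).
  by apply: ler_wpM2r => //; rewrite ge_min lexx orbT.
rewrite mulrAC ler_pdivrMr ?ltr_wpDl// ler_pM2l//.
by rewrite lerDl.
Qed.

Lemma measurable_finfactor (I : finType) (c : X -> I) (F : I -> R) :
  (forall i, measurable (c @^-1` [set i])) -> measurable_fun setT (F \o c).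
Proof.
move=> mc.
rewrite (_ : F \o c = fun x => \sum_i F i * \1_(c @^-1` [set i]) x).
  by apply: measurable_sum => i; exact: measurable_funM.
apply/funext => x /=; rewrite (bigD1 (c x))//= indicE mem_set// mulr1.
rewrite big1 ?addr0// => i ix; rewrite indicE memNset ?mulr0//=.
by move/eqP; rewrite eq_sym (negbTE ix).
Qed.

(** [bell] is a supremum over an uncountable family; measurability comes from its continuity and
    from approximation by functions with finitely many values. *)
Lemma measurable_bell f g : cmeasurable f -> cmeasurable g ->
  measurable_fun setT (fun x => bell p (f x) (g x)).
Proof.
move=> mf mg; have [F [G [sFG _ Ff Gg]]] := csimple2_approx mf mg.
apply: (measurable_fun_cvg (h := fun n x => bell p (F n x) (G n x))) => [n|x _].
  have [I [c [phi [psi [mc -> ->]]]]] := sFG n.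
  exact: (measurable_finfactor (fun i => bell p (phi i) (psi i)) mc).
exact: bell_cvg.
Qed.

Lemma bellm_le f g : cmeasurable f -> cmeasurable g ->
  (bellm f g <= (2 / (p - 1) + 1)%:E * mom nu p f + 2%:E * mom nu q g)%E.
Proof.
move=> mf mg; rewrite -!ge0_integralZl_EFin//; try by [exact: measurable_mom];
  try by move=> x _; rewrite lee_fin powR_ge0.
rewrite -ge0_integralD//; try by [apply: measurable_funeM; exact: measurable_mom];
  try by move=> x _; rewrite -EFinM lee_fin mulr_ge0 ?powR_ge0.
apply: ge0_le_integral => //.
- by move=> x _; rewrite lee_fin bell_ge0.
- by apply/measurable_EFinP; exact: measurable_bell.
- by apply: emeasurable_funD; apply: measurable_funeM; exact: measurable_mom.
- by move=> x _; rewrite -!EFinM -EFinD lee_fin bell_upper.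
Qed.

Lemma mom_dominated r (u : nat -> X -> R[i]) f : 0 < r -> Lp nu r%:E f ->
  (forall n, cmeasurable (u n)) -> (forall n x, normc (u n x) <= normc (f x)) ->
  (forall x, normc (u n x - f x) @[n --> \oo] --> 0) ->
  mom nu r (fun x => u n x - f x)%R @[n --> \oo] --> 0%E.
Proof.
move=> r0 /(LpP nu _ r0)[mf ff] mu uf ucv.
have mB n : cmeasurable (fun x => u n x - f x) by exact: cmeasurableB.
have [] := @dominated_convergence _ _ _ nu setT measurableT
  (fun n x => (normc (u n x - f x) `^ r)%:E) (fun=> 0%E)
  (fun x => ((2 `^ r)%:E * (normc (f x) `^ r)%:E)%E).
- by move=> n; exact: measurable_mom.
- exact: measurable_cst.
- apply: aeW => x _; apply/cvg_EFin; first exact: nearW.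
  rewrite -(@powR0 R r) ?gt_eqF//.
  by apply: cvg_powR => //; [exact: ltW|move=> n; exact: normc_ge0].
- apply/integrableP; split; first by apply: measurable_funeM; exact: measurable_mom.
  under eq_integral => x _ do rewrite gee0_abs ?mule_ge0 ?lee_fin ?powR_ge0//.
  rewrite ge0_integralZl_EFin ?powR_ge0//; first by rewrite lte_mul_pinfty ?lee_fin ?powR_ge0.
    by move=> x _; rewrite lee_fin powR_ge0.
  exact: measurable_mom.
- apply: aeW => x n _; rewrite gee0_abs ?lee_fin ?powR_ge0//.
  rewrite -powRM ?normc_ge0//.
  apply: ge0_ler_powR; rewrite ?nnegrE ?mulr_ge0 ?normc_ge0 ?(ltW r0)//.
  apply: le_trans (normcD _ _) _; rewrite normc_opp.
  by have := uf n x; lra.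
by move=> _ _; rewrite integral0.
Qed.

Variable T : (X -> R[i]) -> (X -> R[i]).
Hypothesis bT : bicontraction nu T.

(** With f = sum phi_i e_i and g = sum psi_i e_i over common indicators, Jensen with the weights T
    e_i bounds the integrand by the sum of |T e_i| bell(phi_i, psi_i). The L^1 contraction replaces
    |T e_i| by e_i under the integral, and what remains is the integral of bell(f, g). *)
Lemma bell_step_simple f g : csimple2 f g -> L2 f -> L2 g ->
  (bellm (T f) (T g) <= bellm f g)%E.
Proof.
move=> [I [c [phi [psi [mc fE gE]]]]] Lf Lg.
(* Cells where f and g both vanish may have infinite measure. They are dropped, at no cost because
   [bell] is 0 at (0, 0). *)
pose J i := (phi i != 0) || (psi i != 0).
pose e i : X -> R[i] := fun x => ((J i)%:R * \1_(c @^-1` [set i]) x)%:C.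
have me i : cmeasurable (e i).
  apply: cmeasurable_real; apply: measurable_funM => //; exact: measurable_indic.
have eE i x : e i x = ((J i) && (c x == i))%:R%:C.
  rewrite /e indicE -natrM mulnb; congr (_%:R%:C); congr (nat_of_bool (_ && _)).
  by apply/idP/idP => [/set_mem /= ->//|/eqP cx]; apply/mem_set.
have Le i : L2 (e i).
  have H (z : R[i]) (h : X -> R[i]) : L2 h -> z != 0 -> (forall x, c x = i -> h x = z) ->
      L2 (e i).
    move=> Lh z0 hz; apply: (Lp_le two_gt0 (Lp_scale z^-1 two_gt0 Lh) (me i)).
    apply: aeW => x; rewrite eE normc_real.
    have [cx|_] := eqVneq (c x) i; last by rewrite andbF normr0 normc_ge0.
    by rewrite hz// mulVf// ComplexField.Normc.normc1 andbT; case: (J i); rewrite ?normr1 ?normr0.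
  have [/orP[z0|z0]|nJ] := boolP (J i).
  - by apply: (H _ _ Lf z0) => x <-; rewrite fE.
  - by apply: (H _ _ Lg z0) => x <-; rewrite gE.
  - rewrite (_ : e i = fun=> 0); first exact: Lp0.
    by apply/funext => x; rewrite eE (negbTE nJ).
have dec (th : I -> R[i]) : (forall i, ~~ J i -> th i = 0) ->
    th \o c = (fun x => \sum_i th i * e i x).
  move=> thJ; apply/funext => x /=; rewrite (bigD1 (c x))//= eE eqxx andbT.
  rewrite big1 => [|i ix]; last by rewrite eE eq_sym (negbTE ix) andbF mulr0.
  rewrite addr0; have [_|/thJ ->] := boolP (J (c x)); last by rewrite mul0r.
  by rewrite rmorph1 mulr1.
have fS : f = (fun x => \sum_i phi i * e i x).
  by rewrite fE; apply: dec => i; rewrite negb_or negbK => /andP[/eqP].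
have gS : g = (fun x => \sum_i psi i * e i x).
  by rewrite gE; apply: dec => i; rewrite negb_or !negbK => /andP[_ /eqP].
have e1 x : \sum_i normc (e i x) <= 1.
  rewrite (bigD1 (c x))// big1 => [|i ix].
    by rewrite Monoid.mulm1 eE normc_real eqxx andbT; case: (J _); rewrite ?normr1 ?normr0.
  by rewrite eE eq_sym (negbTE ix) andbF normc0.
have LT := bic_L2 bT.
have mT h : L2 h -> cmeasurable (T h) by move=> Lh; apply: L2_measurable (LT _ Lh).
have mTe i : measurable_fun setT (fun x => normc (T (e i) x)).
  by apply: measurable_normc; exact: mT.
pose b i := bell p (phi i) (psi i).
have b0 i : 0 <= b i by exact: bell_ge0.
apply: (@le_trans _ _ (\int[nu]_x (\sum_i b i * normc (T (e i) x))%:E)%E).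
  apply: ae_ge0_le_integral => //.
  - by move=> x _; rewrite lee_fin bell_ge0.
  - by apply/measurable_EFinP; apply: measurable_bell; exact: mT.
  - by move=> x _; rewrite lee_fin; apply: sumr_ge0 => i _; rewrite mulr_ge0 ?normc_ge0.
  - apply/measurable_EFinP; apply: measurable_sum => i.
    by apply: measurable_funM.
  have Tf := bic_sum bT (index_enum I) phi Le; rewrite -fS in Tf.
  have Tg := bic_sum bT (index_enum I) psi Le; rewrite -gS in Tg.
  have k1 := bic_kernel_le1 bT Le e1.
  move: Tf Tg k1; apply: filterS3 => x -> -> k1 _; rewrite lee_fin.
  under eq_bigr do rewrite mulrC.
  under [X in bell _ _ X]eq_bigr do rewrite mulrC.
  apply: le_trans (bell_jensen p1 p2 _ _ k1) _.
  by apply: ler_sum => i _; rewrite mulrC.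
have sumE (h : I -> X -> R) : (forall i, measurable_fun setT (h i)) -> (forall i x, 0 <= h i x) ->
    (\int[nu]_x (\sum_i b i * h i x)%:E = \sum_i (b i)%:E * \int[nu]_x (h i x)%:E)%E.
  move=> mh h0; under eq_integral do rewrite -sumEFin.
  rewrite ge0_integral_sum//.
  - apply: eq_bigr => i _; rewrite -ge0_integralZl_EFin//.
      by move=> x _; rewrite lee_fin.
    exact/measurable_EFinP.
  - by move=> i; apply/measurable_EFinP; exact: measurable_funM.
  - by move=> i x _; rewrite lee_fin mulr_ge0.
rewrite sumE//; last by move=> *; exact: normc_ge0.
apply: (@le_trans _ _ (\sum_i (b i)%:E * \int[nu]_x (normc (e i x))%:E)%E).
  apply: lee_sum => i _; apply: lee_wpmul2l; first by rewrite lee_fin.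
  have := bic_norm1 bT (Le i); rewrite /mom.
  under eq_integral do rewrite powRr1 ?normc_ge0//.
  by under [X in (_ <= X)%E -> _]eq_integral do rewrite powRr1 ?normc_ge0//.
rewrite -sumE//; first last.
- by move=> *; exact: normc_ge0.
- by move=> i; apply: measurable_normc.
rewrite le_eqVlt; apply/orP; left; apply/eqP; apply: eq_integral => x _.
congr (_%:E); rewrite fE gE [\sum_i _](bigD1 (c x))// big1 => [|i ix].
  rewrite Monoid.mulm1 eE normc_real eqxx andbT /b.
  have [_|] := boolP (J _); first by rewrite normr1 mulr1.
  by rewrite /J negb_or !negbK => /andP[/eqP p00 /eqP p01]; rewrite /= p00 p01 bell0// mul0r.
by rewrite eE eq_sym (negbTE ix) andbF normc0 mulr0.
Qed.

(** Joint step functions approximate f and g. The left side passes to the limit by Fatou, along a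
    subsequence on which the images converge almost everywhere; the right side by dominated
    convergence, whose majorant is integrable because f is in L^p and g in L^q. *)
Lemma bell_step f g : L2 f -> Lp nu p%:E f -> L2 g -> Lp nu q%:E g ->
  (bellm (T f) (T g) <= bellm f g)%E.
Proof.
move=> Lf Lpf Lg Lqg.
have mf := L2_measurable Lf; have mg := L2_measurable Lg.
have [F [G [sFG FG Ff Gg]]] := csimple2_approx mf mg.
have mFG n : cmeasurable (F n) /\ cmeasurable (G n).
  have [I [c [phi [psi [mc -> ->]]]]] := sFG n.
  by split; split; apply: (measurable_finfactor (fun i => _ (_ i)) mc).
have mF n := (mFG n).1; have mG n := (mFG n).2.
have LF n : L2 (F n) by apply: (Lp_le two_gt0 Lf) => //; apply: aeW => x; have [] := FG n x.
have LG n : L2 (G n) by apply: (Lp_le two_gt0 Lg) => //; apply: aeW => x; have [] := FG n x.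
have cF := mom_dominated two_gt0 Lf mF (fun n x => (FG n x).1) Ff.
have cG := mom_dominated two_gt0 Lg mG (fun n x => (FG n x).2) Gg.
(* The rate that [ae_cvg_geometric] requires at exponent 2. *)
pose c n : R := 1 * (2 * 2 `^ 2) ^- n.
have c0 n : 0 < c n by rewrite /c mul1r invr_gt0 exprn_gt0// mulr_gt0// powR_gt0.
have Hk n : {m | [/\ (n <= m)%N, (mom nu 2 (fun x => F m x - f x)%R <= (c n)%:E)%E &
    (mom nu 2 (fun x => G m x - g x)%R <= (c n)%:E)%E]}.
  apply: cid; have [N1 _ H1] := cvg_near_le (c0 n) cF.
  have [N2 _ H2] := cvg_near_le (c0 n) cG.
  exists (n + (N1 + N2))%N; split; first exact: leq_addr.
    by apply: H1; rewrite /= addnCA leq_addr.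
  by apply: H2; rewrite /= addnA leq_addl.
pose k n := projT1 (Hk n).
have kn n : (n <= k n)%N by have [] := projT2 (Hk n).
have LT := bic_L2 bT.
have mT h : L2 h -> cmeasurable (T h) by move=> Lh; apply: L2_measurable (LT _ Lh).
have TB h h' : L2 h -> L2 h' -> (mom nu 2 (fun x => T h x - T h' x)%R <=
    mom nu 2 (fun x => h x - h' x)%R)%E.
  move=> Lh Lh'; apply: le_trans (bic_norm2 bT (Lp_sub two_gt0 Lh Lh')).
  rewrite (@mom_ae _ _ _ nu 2 _ (T (fun x => h x - h' x)%R))//.
  - by apply: cmeasurableB; exact: mT.
  - by apply: mT; exact: Lp_sub.
  have := bic_lin bT (-1) Lh' Lh; apply: filterS => x.
  rewrite (_ : (fun x => -1 * h' x + h x) = (fun x => h x - h' x)).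
    by move=> ->; rewrite mulN1r addrC.
  by apply/funext => y; rewrite mulN1r addrC.
have TF : \forall x \ae nu, normc (T (F (k n)) x - T f x) @[n --> \oo] --> 0.
  apply: (@ae_cvg_geometric _ _ _ nu 2 1) => //; try by [exact: mT|move=> n; exact: mT].
  by move=> n; apply: le_trans (TB _ _ _ _) _ => //; have [] := projT2 (Hk n).
have TG : \forall x \ae nu, normc (T (G (k n)) x - T g x) @[n --> \oo] --> 0.
  apply: (@ae_cvg_geometric _ _ _ nu 2 1) => //; try by [exact: mT|move=> n; exact: mT].
  by move=> n; apply: le_trans (TB _ _ _ _) _ => //; have [] := projT2 (Hk n).
apply: (@fatou_cvg _ _ _ nu (fun n x => bell p (T (F (k n)) x) (T (G (k n)) x)) _
  (fun n => bellm (F (k n)) (G (k n)))).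
- by move=> n; apply: measurable_bell; exact: mT.
- by apply: measurable_bell; exact: mT.
- by move=> n x; exact: bell_ge0.
- by move=> x; exact: bell_ge0.
- by move: TF TG; apply: filterS2 => x; exact: bell_cvg.
- by move=> n; apply: bell_step_simple.
apply: (@subseq_cvg _ (fun n => bellm (F n) (G n))) => //.
have /(LpP nu _ p0)[_ pf] := Lpf; have /(LpP nu _ q0)[_ qg] := Lqg.
have [] := @dominated_convergence _ _ _ nu setT measurableT
  (fun n x => (bell p (F n x) (G n x))%:E) (fun x => (bell p (f x) (g x))%:E)
  (fun x => ((2 / (p - 1) + 1) * normc (f x) `^ p + 2 * normc (g x) `^ q)%:E) => //.
- by move=> n; apply/measurable_EFinP; exact: measurable_bell.
- by apply/measurable_EFinP; exact: measurable_bell.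
- apply: aeW => x _; apply/cvg_EFin; first exact: nearW.
  exact: bell_cvg.
- apply/integrableP; split.
    by apply/measurable_EFinP; apply: measurable_funD; apply: measurable_funM => //;
      exact: measurable_normc_powR.
  under eq_integral => x _ do rewrite gee0_abs ?lee_fin ?addr_ge0 ?mulr_ge0 ?powR_ge0// EFinD !EFinM.
  rewrite ge0_integralD//; try by [apply: measurable_funeM; exact: measurable_mom];
    try by move=> x _; rewrite -EFinM lee_fin mulr_ge0 ?powR_ge0.
  rewrite !ge0_integralZl_EFin//; try by [exact: measurable_mom];
    try by move=> x _; rewrite lee_fin powR_ge0.
  by rewrite lte_add_pinfty// lte_mul_pinfty ?lee_fin.
- apply: aeW => x n _; rewrite gee0_abs ?lee_fin ?bell_ge0//.
  have [Fx Gx] := FG n x.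
  apply: le_trans (bell_upper p1 _ _) _; apply: lerD; apply: ler_wpM2l => //;
    by apply: ge0_ler_powR; rewrite ?nnegrE ?normc_ge0 ?(ltW p0) ?(ltW q0).
Qed.

End BellmanFlow.

(** * Bounded functional calculus *)

(** Integrals are built from simple functions, which evaluate the set function on measurable sets
    only. This neutralises the values of [spectral_dist] elsewhere, about which nothing is known. *)
Lemma eq_setfun_integral {d} {T : measurableType d} {R : realType}
    (m1 m2 : set T -> \bar R) (f : T -> \bar R) :
  (forall A, measurable A -> m1 A = m2 A) -> integral m1 setT f = integral m2 setT f.
Proof.
move=> m12; have S (h : {nnsfun T >-> R}) : sintegral m1 h = sintegral m2 h.
  by apply: eq_fsbigr => r _; rewrite m12.
by rewrite /integral; congr (ereal_sup _ - ereal_sup _)%E; apply/seteqP; split;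
  move=> _ [h hf <-]; exists h; rewrite ?S.
Qed.

Section SpectralMeasure.
Context {dX} {X : measurableType dX} {R : realType}.
Variable nu : {measure set X -> \bar R}.
Context {dO} {Omega : measurableType dO}.
Variable E : set Omega -> (X -> R[i]) -> (X -> R[i]).
Hypothesis hE : spectral_measure nu E.
Implicit Types (f g h : X -> R[i]) (A B : set Omega) (m : Omega -> R).
Local Notation L2 := (Lp nu 2%:E).
Local Notation rin := (rin nu).

Let two_gt0 : 0 < 2 :> R. Proof. by []. Qed.

Lemma E_L2 A f : measurable A -> L2 f -> L2 (E A f).
Proof. by move=> mA Lf; case: hE => /(_ _ mA) [[_ _ _ H _] _ _] _ _; exact: H. Qed.

Lemma E_ae A f g : measurable A -> L2 f -> L2 g ->
  (\forall x \ae nu, f x = g x) -> \forall x \ae nu, E A f x = E A g x.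
Proof.
move=> mA Lf Lg fg; case: hE => /(_ _ mA) [[_ _ H _ _] _ _] _ _.
by have [|_ /aeqP] := H f g Lf (L2_measurable Lg); first exact/aeqP.
Qed.

Lemma E_lin A (a : R[i]) f g : measurable A -> L2 f -> L2 g ->
  \forall x \ae nu, E A (fun x => a * f x + g x) x = a * E A f x + E A g x.
Proof.
move=> mA Lf Lg; case: hE => /(_ _ mA) [[_ _ _ _ H] _ _] _ _.
by have [_ /aeqP] := H a f g Lf Lg.
Qed.

Lemma E_idem A f : measurable A -> L2 f -> \forall x \ae nu, E A (E A f) x = E A f x.
Proof.
by move=> mA Lf; case: hE => /(_ _ mA) [_ H _] _ _; apply/aeqP; exact: H.
Qed.

Lemma E_sym A f g : measurable A -> L2 f -> L2 g -> rin (E A f) g = rin f (E A g).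
Proof.
move=> mA Lf Lg; case: hE => /(_ _ mA) [_ _ H] _ _.
by have := H _ _ Lf Lg; rewrite !innerE => -[].
Qed.

Lemma E_setT f : L2 f -> \forall x \ae nu, E setT f x = f x.
Proof. by move=> Lf; case: hE => _ H _; apply/aeqP; exact: H. Qed.

Lemma rin_aer f g g' : L2 f -> L2 g -> L2 g' -> (\forall x \ae nu, g x = g' x) ->
  rin f g = rin f g'.
Proof.
move=> Lf Lg Lg' gg'.
exact: (rin_ae (L2_measurable Lf) (L2_measurable Lf) (L2_measurable Lg)
  (L2_measurable Lg') (aeW _ (fun x => erefl (f x))) gg').
Qed.

Lemma rin_ael f f' g : L2 f -> L2 f' -> L2 g -> (\forall x \ae nu, f x = f' x) ->
  rin f g = rin f' g.
Proof. by move=> *; rewrite !(rinC nu _ g); exact: rin_aer. Qed.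

Lemma E_quad A f : measurable A -> L2 f -> rin (E A f) (E A f) = rin (E A f) f.
Proof.
move=> mA Lf; have LE := E_L2 mA Lf.
rewrite -E_sym//.
by apply: rin_ael => //; [exact: E_L2|exact: E_idem].
Qed.

Lemma E_quad_ge0 A f : measurable A -> L2 f -> 0 <= rin (E A f) f.
Proof. by move=> mA Lf; rewrite -E_quad// rin_ge0. Qed.

Let Esum (F : nat -> set Omega) n f : (forall k, measurable (F k)) -> L2 f ->
  L2 (fun x => \sum_(k < n) E (F k) f x).
Proof. by move=> mF Lf; apply: Lp_sum => // k; exact: E_L2. Qed.

Lemma rin_suml (n : nat) (F : nat -> X -> R[i]) g : (forall k, L2 (F k)) -> L2 g ->
  rin (fun x => \sum_(k < n) F k x)%R g = \sum_(k < n) rin (F k) g.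
Proof.
move=> LF Lg; elim: n => [|n IH].
  rewrite big_ord0 /(rin _ _); under eq_integral do rewrite big_ord0 dot0l.
  by rewrite integral0.
rewrite big_ord_recr /= -IH -rinDl//; last by apply: Lp_sum.
by congr rin; apply/funext => x; rewrite big_ord_recr.
Qed.

Lemma E_sigma (F : nat -> set Omega) f g : (forall k, measurable (F k)) ->
  trivIset setT F -> L2 f -> L2 g ->
  \sum_(k < n) rin (E (F k) f) g @[n --> \oo] --> rin (E (\bigcup_k F k) f) g.
Proof.
move=> mF tF Lf Lg; case: hE => _ _ /(_ F mF tF f Lf) H.
have mU : measurable (\bigcup_k F k) by exact: bigcup_measurable.
apply/cvgrPdist_le => e e0.
(* Since c (1 + <g, g>) = e, Cauchy-Schwarz yields c^2 <g, g> <= e^2. *)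
pose c := e / (1 + rin g g).
have g1 : 0 < 1 + rin g g by rewrite ltr_wpDr ?rin_ge0.
have c0 : 0 < c by rewrite divr_gt0.
apply: filterS (cvg_near_le c0 H) => n Hn.
set D := fun x => _ in Hn.
have LD : L2 D by apply: Lp_sub => //; [exact: E_L2|exact: Esum].
have DD : rin D D <= c ^+ 2.
  rewrite -lee_fin -rinxx// momE// -powR_mulrn ?(ltW c0)// -poweR_EFin.
  by apply: le_poweR => //; exact: Lnorm_ge0.
rewrite -(@rin_suml n (fun k => E (F k) f))// => [|k]; last exact: E_L2.
rewrite -rinBl//; last 2 first.
- exact: E_L2.
- exact: Esum.
rewrite -(@ler_pXn2r _ 2) ?nnegrE ?(ltW e0)// real_normK ?num_real//.
apply: le_trans (rin_CS LD Lg) _.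
apply: (@le_trans _ _ (c ^+ 2 * (1 + rin g g) ^+ 2)).
  apply: ler_pM; rewrite ?rin_ge0// expr2; have := rin_ge0 nu g; nra.
by rewrite -exprMn /c divfK// gt_eqF.
Qed.

(** For the constant family of empty sets the partial sums n c converge, so their increment c is
    0. *)
Lemma E_set0 f g : L2 f -> L2 g -> rin (E set0 f) g = 0.
Proof.
have t0 : trivIset [set: nat] (fun=> @set0 Omega) by move=> i j _ _ [x []].
move=> Lf Lg; have := @E_sigma (fun=> set0) f g (fun=> measurable0) t0 Lf Lg.
rewrite bigcup0//; set c := rin _ _ => H.
have H1 : \sum_(k < n.+1) c @[n --> \oo] --> c.
  by apply: (@subseq_cvg _ (fun n => \sum_(k < n) c) S) => // ; exact: H.
have : (fun _ : nat => c) @ \oo --> (0 : R).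
  rewrite -[X in _ --> X](subrr c).
  rewrite (_ : (fun=> c) = (fun n => \sum_(k < n.+1) c - \sum_(k < n) c)).
    exact: cvgB H1 H.
  by apply/funext => n; rewrite big_ord_recr /= addrAC subrr add0r.
by move/cvg_lim => <-//; apply/esym; apply: lim_cst.
Qed.

Lemma E_setU A B f g : measurable A -> measurable B -> A `&` B = set0 ->
  L2 f -> L2 g -> rin (E (A `|` B) f) g = rin (E A f) g + rin (E B f) g.
Proof.
move=> mA mB AB Lf Lg.
have m2 k : measurable (bigcup2 A B k).
  by case: k => [|[|k]] //=; exact: measurable0.
have := @E_sigma (bigcup2 A B) f g m2 _ Lf Lg.
rewrite bigcup2E -trivIset_bigcup2 => /(_ AB) H.
have /cvg_lim <- // := H.
apply: lim_near_cst => //; exists 2%N => // n /= n2.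
rewrite -(subnKC n2) big_split_ord /= big_ord_recr big_ord1 /=.
by rewrite big1 ?addr0// => i _; rewrite E_set0.
Qed.

(** Put h = E_B g, so that E_B h = h. Idempotence of the projection of the union, expanded by
    additivity, forces <E_A h, E_B h> = 0, and this number equals <E_A h, h> = |E_A h|^2. *)
Lemma E_disj A B f g : measurable A -> measurable B -> A `&` B = set0 ->
  L2 f -> L2 g -> rin (E A f) (E B g) = 0.
Proof.
move=> mA mB AB Lf Lg.
pose h := E B g; have Lh : L2 h by exact: E_L2.
have LAh := E_L2 mA Lh; have LBh := E_L2 mB Lh.
have mU : measurable (A `|` B) by exact: measurableU.
have LU := E_L2 mU Lh.
have UE : \forall x \ae nu, E (A `|` B) h x = E A h x + E B h x.
  apply: (rin_separates LU (Lp_add two_gt0 LAh LBh)) => k Lk.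
  by rewrite rinDl// E_setU.
have BhE : \forall x \ae nu, E B h x = h x by exact: E_idem.
have : rin (E A h) (E A h) = 0.
  have := E_quad mU Lh.
  rewrite (rin_ae (L2_measurable LU) (L2_measurable (Lp_add two_gt0 LAh LBh))
    (L2_measurable LU) (L2_measurable (Lp_add two_gt0 LAh LBh)) UE UE).
  rewrite rin_sqrD// E_setU// !E_quad//.
  by rewrite (rin_aer LAh LBh Lh BhE) => ?; lra.
move/(rin_eq0 LAh) => A0.
rewrite E_sym// -/h.
by rewrite rinC (rin_ael LAh (Lp0 nu two_gt0) Lf A0) /(rin _ _);
  under eq_integral do rewrite dot0l; rewrite integral0.
Qed.

(** Split A and B along their intersection; the parts outside it contribute nothing by [E_disj]. *)
Lemma E_setI A B f g : measurable A -> measurable B -> L2 f -> L2 g ->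
  rin (E A f) (E B g) = rin (E (A `&` B) f) g.
Proof.
move=> mA mB Lf Lg.
have mI : measurable (A `&` B) by exact: measurableI.
have mAD : measurable (A `\` B) by exact: measurableD.
have mBD : measurable (B `\` A) by exact: measurableD.
have LfI := E_L2 mI Lf; have LB := E_L2 mB Lg.
have -> : rin (E A f) (E B g) = rin (E (A `&` B) f) (E B g).
  rewrite -{1}(setUIDK A B) E_setU//.
    rewrite (E_disj mAD mB) ?addr0//.
    by apply/seteqP; split => x //= -[[]].
  by apply/seteqP; split => x //= -[[_ ?] []].
rewrite rinC.
have -> : rin (E B g) (E (A `&` B) f) = rin (E (A `&` B) g) (E (A `&` B) f).
  rewrite -{1}(setUIDK B A) E_setU//.
  - rewrite (E_disj mBD mI) ?addr0// 1?(setIC B)//.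
    by apply/seteqP; split => x //= -[[_ +] []].
  - exact: measurableI.
  - by apply/seteqP; split => x //= -[[_ ?] []].
rewrite (E_sym mI Lg LfI) (rinC nu g).
by apply: rin_ael => //; [exact: E_L2|exact: E_idem].
Qed.

End SpectralMeasure.

(** * Bounded measurable symbols *)

Definition bmeas {d} {T : measurableType d} {R : realType} (m : T -> R) : Prop :=
  measurable_fun setT m /\ exists M, forall l, `|m l| <= M.

Section BoundedMeasurable.
Context {d} {T : measurableType d} {R : realType}.
Implicit Types m : T -> R.

Lemma bmeas_indic A : measurable A -> bmeas (\1_A : T -> R).
Proof.
move=> mA; split; first exact: measurable_indic.
by exists 1 => l; rewrite indicE; case: (_ \in _); rewrite ?normr1 ?normr0.
Qed.

Lemma bmeas_cst (c : R) : bmeas (cst c : T -> R).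
Proof. by split; [exact: measurable_cst|exists `|c|]. Qed.

Lemma bmeas_lin (a : R) m1 m2 : bmeas m1 -> bmeas m2 ->
  bmeas (fun l => a * m1 l + m2 l).
Proof.
move=> [mm1 [M1 b1]] [mm2 [M2 b2]]; split.
  by apply: measurable_funD => //; exact: measurable_funM.
exists (`|a| * M1 + M2) => l; apply: le_trans (ler_normD _ _) _.
by rewrite normrM; apply: lerD => //; exact: ler_wpM2l.
Qed.

Lemma bmeasM m1 m2 : bmeas m1 -> bmeas m2 -> bmeas (fun l => m1 l * m2 l).
Proof.
move=> [mm1 [M1 b1]] [mm2 [M2 b2]]; split; first exact: measurable_funM.
by exists (M1 * M2) => l; rewrite normrM; exact: ler_pM.
Qed.

(** A symbol with values in [0, 1] is the uniform limit of its binary expansion, a combination of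
    indicators; an affine change of values reduces bounded symbols to this case. *)
Lemma bmeas_ind (P : (T -> R) -> Prop) :
  (forall A, measurable A -> P \1_A) ->
  (forall (a : R) m1 m2, bmeas m1 -> bmeas m2 -> P m1 -> P m2 ->
    P (fun l => a * m1 l + m2 l)) ->
  (forall m, bmeas m -> (forall e, 0 < e -> exists m',
     [/\ bmeas m', P m' & forall l, `|m l - m' l| <= e]) -> P m) ->
  forall m, bmeas m -> P m.
Proof.
move=> P1 Plin Plim.
have P01 m : measurable_fun setT m -> (forall l, 0 <= m l <= 1) -> P m.
  move=> mm m01; apply: Plim => [|e e0].
    by split => //; exists 1 => l; have /andP[? ?] := m01 l; rewrite ger0_norm.
  have [n Hn] : exists n, 2^-1 ^+ n <= e.
    have := @cvg_geometric R 1 2^-1; rewrite ger0_norm ?invr_ge0// invf_lt1// ltr1n.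
    move=> /(_ isT) /cvgrPdist_le /(_ e e0) [N _ HN]; exists N.
    have := HN N (leqnn N); rewrite /geometric /= mul1r sub0r normrN.
    by rewrite ger0_norm// exprn_ge0 ?invr_ge0.
  suff [s [bs Ps Hs]] : exists s, [/\ bmeas s, P s & forall l, 0 <= m l - s l <= 2^-1 ^+ n].
    exists s; split => // l; have /andP[? ?] := Hs l.
    by rewrite ger0_norm//; exact: le_trans Hn.
  elim: n {Hn} => [|n [s [bs Ps Hs]]].
    exists \1_set0; split; [exact: bmeas_indic|exact: P1|].
    by move=> l; rewrite indicE in_set0 subr0 expr0.
  (* The set where the next binary digit of m is 1. *)
  pose A : set T := [set l | 2^-1 ^+ n.+1 <= m l - s l].
  have mA : measurable A.
    have ms : measurable_fun setT (fun l => m l - s l).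
      by apply: measurable_funB => //; have [] := bs.
    rewrite (_ : A = (fun l => m l - s l) @^-1` `[2^-1 ^+ n.+1, +oo[%classic).
      by rewrite -[X in measurable X]setTI; exact: ms.
    by apply/seteqP; split => l /=; rewrite in_itv /= andbT.
  exists (fun l => 2^-1 ^+ n.+1 * \1_A l + s l); split.
  - by apply: bmeas_lin => //; exact: bmeas_indic.
  - by apply: Plin => //; [exact: bmeas_indic|exact: P1].
  move=> l; have := Hs l; rewrite indicE; have [|] := boolP (l \in A).
    rewrite inE /A /= exprS mulr1 => Al /andP[H1 H2].
    by apply/andP; split; lra.
  rewrite notin_setE /A /= exprS mulr0 add0r => /negP; rewrite -ltNge => Al /andP[H1 H2].
  by apply/andP; split; lra.
move=> m [mm [M0 b0]].
pose M := `|M0| + 1; have Mp : 0 < M by rewrite ltr_wpDl.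
have b l : `|m l| <= M by apply: le_trans (b0 l) _; rewrite /M; have := ler_norm M0; lra.
pose m' l := (m l + M) / (2 * M).
have bm' : bmeas m'.
  split; first by apply: measurable_funM => //; exact: measurable_funD.
  exists 1 => l; have := b l; rewrite ler_norml => /andP[b1 b2].
  by rewrite ger0_norm ?divr_ge0 ?mulr_ge0 ?(ltW Mp)// ?ler_pdivrMr ?mulr_gt0//; lra.
have Pm' : P m'.
  apply: P01; first by case: bm'.
  move=> l; have := b l; rewrite ler_norml => /andP[b1 b2].
  rewrite /m' divr_ge0 ?mulr_ge0 ?(ltW Mp)//=; last lra.
  by rewrite ler_pdivrMr ?mulr_gt0//; lra.
have Pc : P (fun l => - M * \1_setT l + (\1_set0 l)).
  by apply: Plin; try exact: bmeas_indic; exact: P1.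
rewrite (_ : m = (fun l => (2 * M) * m' l + (- M * \1_setT l + (\1_set0 l)))).
  by apply: Plin => //; apply: bmeas_lin; exact: bmeas_indic.
apply/funext => l; rewrite !indicE in_setT in_set0 /m' /= mulr1 addr0.
by field; rewrite gt_eqF.
Qed.

Lemma bmeas_integrable (mu : {measure set T -> \bar R}) m : (mu setT < +oo)%E ->
  bmeas m -> mu.-integrable setT (fun l => (m l)%:E).
Proof.
move=> muT [mm [M b]]; apply/integrableP; split; first exact/measurable_EFinP.
apply: (@le_lt_trans _ _ (\int[mu]_l (cst `|M|%:E) l)%E).
  apply: ge0_le_integral => //; first by apply: measurableT_comp => //; exact/measurable_EFinP.
  by move=> l _; rewrite lee_fin; apply: le_trans (b l) _; exact: ler_norm.
by rewrite integral_cst//= lte_mul_pinfty ?lee_fin.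
Qed.

End BoundedMeasurable.

(** The quadratic form <m(L) f, f> read off the spectral distribution; the rest of the calculus is
    obtained from it by polarisation. *)
HB.lock Definition quad {dX} {X : measurableType dX} {R : realType}
    (nu : {measure set X -> \bar R}) {dO} {Omega : measurableType dO}
    (E : set Omega -> (X -> R[i]) -> (X -> R[i])) (m : Omega -> R) (f : X -> R[i]) : R :=
  fine (integral (spectral_dist nu E f) setT (fun l => (m l)%:E)).

Section Calculus.
Context {dX} {X : measurableType dX} {R : realType}.
Variable nu : {measure set X -> \bar R}.
Context {dO} {Omega : measurableType dO}.
Variable E : set Omega -> (X -> R[i]) -> (X -> R[i]).
Hypothesis hE : spectral_measure nu E.
Implicit Types (f g h : X -> R[i]) (A B : set Omega) (m : Omega -> R).
Local Notation L2 := (Lp nu 2%:E).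
Local Notation rin := (rin nu).

Local Notation quad := (quad nu E).

Let two_gt0 : 0 < 2 :> R. Proof. by []. Qed.

(* [spectral_dist] need not be non-negative on non-measurable sets; the junk
   value 0 turns it into a measure. *)
Definition sdist f A : \bar R :=
  if pselect (measurable A) then (rin (E A f) f)%:E else 0%E.

Lemma sdistE f A : measurable A -> sdist f A = (rin (E A f) f)%:E.
Proof. by rewrite /sdist; case: pselect. Qed.

Section FixedVector.
Variable f : X -> R[i].
Hypothesis Lf : L2 f.

Let sdist0 : sdist f set0 = 0%E.
Proof. by rewrite sdistE// (E_set0 hE). Qed.

Let sdist_ge0 A : (0 <= sdist f A)%E.
Proof.
by rewrite /sdist; case: pselect => [mA|//] /=; rewrite lee_fin (E_quad_ge0 hE).
Qed.

Let sdist_sigma : semi_sigma_additive (sdist f).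
Proof.
move=> F mF tF mU; rewrite sdistE//.
rewrite (_ : (fun n => _) = (fun n => (\sum_(k < n) rin (E (F k) f) f)%:E)).
  apply/cvg_EFin; first exact: nearW.
  exact: (E_sigma hE mF tF Lf Lf).
apply/funext => n; rewrite -sumEFin big_mkord; apply: eq_bigr => k _.
by rewrite sdistE.
Qed.

Definition spm : {measure set Omega -> \bar R} :=
  HB.pack (sdist f) (isMeasure.Build _ _ _ (sdist f) sdist0 sdist_ge0 sdist_sigma).

Lemma spmE A : measurable A -> spm A = (rin (E A f) f)%:E.
Proof. exact: sdistE. Qed.

Lemma spm_setT : spm setT = (rin f f)%:E.
Proof.
by rewrite spmE//; congr (_%:E); apply: rin_ael => //; [exact: (E_L2 hE)|exact: (E_setT hE)].
Qed.

Lemma spm_fin : (spm setT < +oo)%E.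
Proof. by rewrite spm_setT ltry. Qed.

Lemma spectral_dist_integral (phi : Omega -> \bar R) :
  integral (spectral_dist nu E f) setT phi = integral spm setT phi.
Proof.
apply: eq_setfun_integral => A mA.
by rewrite spmE// /spectral_dist innerE.
Qed.

End FixedVector.

Lemma EFin_quad m f (Lf : L2 f) : bmeas m ->
  ((quad m f)%:E = \int[spm Lf]_l (m l)%:E)%E.
Proof.
move=> bm; rewrite quad.unlock (spectral_dist_integral Lf) fineK//.
by apply: integrable_fin_num => //; apply: bmeas_integrable => //; exact: spm_fin.
Qed.

Lemma quad_indic A f : measurable A -> L2 f -> quad \1_A f = rin (E A f) f.
Proof.
move=> mA Lf; apply: EFin_inj; rewrite (EFin_quad Lf); last exact: bmeas_indic.
by rewrite integral_indic// setIT spmE.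
Qed.

Lemma quad_lin (a : R) m1 m2 f : bmeas m1 -> bmeas m2 -> L2 f ->
  quad (fun l => a * m1 l + m2 l) f = a * quad m1 f + quad m2 f.
Proof.
move=> b1 b2 Lf; apply: EFin_inj; rewrite EFinD EFinM !(EFin_quad Lf)//; last exact: bmeas_lin.
have i1 := bmeas_integrable (spm_fin Lf) b1; have i2 := bmeas_integrable (spm_fin Lf) b2.
rewrite -integralZl// -integralD//; last exact: integrableZl.
Qed.

Lemma quad_ge0 m f : bmeas m -> (forall l, 0 <= m l) -> L2 f -> 0 <= quad m f.
Proof.
move=> bm m0 Lf; rewrite -lee_fin (EFin_quad Lf)//.
by apply: integral_ge0 => l _; rewrite lee_fin.
Qed.

Lemma quad_le m1 m2 f : bmeas m1 -> bmeas m2 -> (forall l, m1 l <= m2 l) -> L2 f ->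
  quad m1 f <= quad m2 f.
Proof.
move=> b1 b2 m12 Lf; rewrite -subr_ge0.
have -> : quad m2 f - quad m1 f = quad (fun l => -1 * m1 l + m2 l) f.
  by rewrite quad_lin// mulN1r addrC.
apply: quad_ge0 => //; first exact: bmeas_lin.
by move=> l; rewrite mulN1r addrC subr_ge0.
Qed.

Lemma quad_cst (c : R) f : L2 f -> quad (cst c) f = c * rin f f.
Proof.
move=> Lf; apply: EFin_inj; rewrite (EFin_quad Lf); last exact: bmeas_cst.
by have := integral_cst (spm Lf) measurableT c%:E; rewrite spm_setT EFinM => <-.
Qed.

Lemma quad_dist m1 m2 e f : bmeas m1 -> bmeas m2 -> (forall l, `|m1 l - m2 l| <= e) ->
  L2 f -> `|quad m1 f - quad m2 f| <= e * rin f f.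
Proof.
move=> b1 b2 m12 Lf; rewrite -quad_cst// ler_distl; apply/andP; split.
  rewrite lerBlDr.
  have -> : quad m1 f + quad (cst e) f = quad (fun l => 1 * m1 l + cst e l) f.
    by rewrite quad_lin ?mul1r//; exact: bmeas_cst.
  apply: quad_le => //; first by apply: bmeas_lin => //; exact: bmeas_cst.
  by move=> l; have := m12 l; rewrite ler_norml mul1r /= => /andP[]; lra.
have -> : quad m2 f + quad (cst e) f = quad (fun l => 1 * m2 l + cst e l) f.
  by rewrite quad_lin ?mul1r//; exact: bmeas_cst.
apply: quad_le => //; first by apply: bmeas_lin => //; exact: bmeas_cst.
by move=> l; have := m12 l; rewrite ler_norml mul1r /= => /andP[]; lra.
Qed.

(** A set of full spectral measure: symbols have to be compared, bounded or convergent only on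
    it. *)
Definition carrier (D : set Omega) : Prop := measurable D /\
  forall f, L2 f -> \forall x \ae nu, E D f x = f x.

Lemma carrier_setT : carrier setT.
Proof. by split => // f Lf; exact: (E_setT hE). Qed.

Lemma spm_carrier D f (Lf : L2 f) : carrier D -> \forall l \ae spm Lf, D l.
Proof.
move=> [mD ED]; exists (~` D); split => //; first exact: measurableC.
have mDC : measurable (~` D) by exact: measurableC.
have LD := E_L2 hE mDC Lf.
rewrite spmE//; congr (_%:E).
have <- : rin (E (~` D) f) (E D f) = rin (E (~` D) f) f.
  by apply: rin_aer => //; [exact: (E_L2 hE)|exact: ED].
by rewrite (E_disj hE)//; rewrite setICl.
Qed.

Lemma quad_cvg D (m_ : nat -> Omega -> R) m (M : R) f : carrier D ->
  (forall n, bmeas (m_ n)) -> bmeas m -> (forall n l, D l -> `|m_ n l| <= M) ->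
  (forall l, D l -> m_ n l @[n --> \oo] --> m l) -> L2 f ->
  quad (m_ n) f @[n --> \oo] --> quad m f.
Proof.
move=> cD bm_ bm mM m_m Lf.
have [] := @dominated_convergence _ _ _ (spm Lf) setT measurableT
  (fun n l => (m_ n l)%:E) (fun l => (m l)%:E) (cst M%:E).
- by move=> n; apply/measurable_EFinP; have [] := bm_ n.
- by apply/measurable_EFinP; have [] := bm.
- apply: filterS (spm_carrier Lf cD) => l Dl _; apply/cvg_EFin; first exact: nearW.
  exact: m_m.
- exact: (bmeas_integrable (spm_fin Lf) (bmeas_cst M)).
- by apply: filterS (spm_carrier Lf cD) => l Dl n _; rewrite lee_fin mM.
move=> _ _; rewrite -EFin_quad// => /fine_cvg /=.
by under eq_fun do rewrite /= -EFin_quad//=.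
Qed.

Lemma quad_eq_carrier D m1 m2 f : carrier D -> bmeas m1 -> bmeas m2 ->
  (forall l, D l -> m1 l = m2 l) -> L2 f -> quad m1 f = quad m2 f.
Proof.
move=> cD b1 b2 m12 Lf; apply: EFin_inj; rewrite !(EFin_quad Lf)//.
apply: ae_eq_integral => //.
- by apply/measurable_EFinP; have [] := b1.
- by apply/measurable_EFinP; have [] := b2.
- by apply: filterS (spm_carrier Lf cD) => l Dl _; rewrite m12.
Qed.

End Calculus.

Section BoundedFunctionals.
Context {d} {T : measurableType d} {R : realType}.
Implicit Types (m : T -> R) (F G : (T -> R) -> R).

(** Continuity is for uniform convergence, to match the limits in [bmeas_ind]. Identities between
    such functionals can then be checked on indicators, where they concern projections. *)
Definition blin F : Prop :=
  (forall (a : R) m1 m2, bmeas m1 -> bmeas m2 ->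
     F (fun l => a * m1 l + m2 l) = a * F m1 + F m2) /\
  (exists2 K, 0 <= K & forall m1 m2 e, bmeas m1 -> bmeas m2 ->
     (forall l, `|m1 l - m2 l| <= e) -> `|F m1 - F m2| <= K * e).

Lemma blin_add F G : blin F -> blin G -> blin (fun m => F m + G m).
Proof.
move=> [F1 [K K0 F2]] [G1 [K' K'0 G2]]; split.
  by move=> a m1 m2 b1 b2; rewrite F1// G1//; ring.
exists (K + K') => [|m1 m2 e b1 b2 me]; first exact: addr_ge0.
rewrite opprD addrACA; apply: le_trans (ler_normD _ _) _.
by rewrite mulrDl; apply: lerD; [exact: F2|exact: G2].
Qed.

Lemma blin_scale (c : R) F : blin F -> blin (fun m => c * F m).
Proof.
move=> [F1 [K K0 F2]]; split.
  by move=> a m1 m2 b1 b2; rewrite F1//; ring.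
exists (`|c| * K) => [|m1 m2 e b1 b2 me]; first exact: mulr_ge0.
by rewrite -mulrBr normrM -mulrA; apply: ler_wpM2l => //; exact: F2.
Qed.

Lemma blin_mul m0 F : bmeas m0 -> blin F -> blin (fun m => F (fun l => m l * m0 l)).
Proof.
move=> bm0 [F1 [K K0 F2]]; split.
  move=> a m1 m2 b1 b2; rewrite -F1; try exact: bmeasM.
  by congr F; apply/funext => l; ring.
have [_ [M bM]] := bm0.
exists (K * `|M|) => [|m1 m2 e b1 b2 me]; first exact: mulr_ge0.
rewrite -mulrA; apply: F2; try exact: bmeasM.
move=> l; rewrite -mulrBl normrM mulrC; apply: ler_pM => //.
exact: le_trans (bM l) (ler_norm _).
Qed.

Lemma blin_eq F G : blin F -> blin G ->
  (forall A, measurable A -> F \1_A = G \1_A) -> forall m, bmeas m -> F m = G m.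
Proof.
move=> [F1 [K K0 F2]] [G1 [K' K'0 G2]] FG; apply: bmeas_ind => [//|a m1 m2 b1 b2|m bm H].
  by rewrite F1// G1// => -> ->.
apply/eqP; rewrite -subr_eq0 -normr_le0; apply/ler_addgt0Pr => e e0.
have k0 : 0 < K + K' + 1 by rewrite ltr_wpDl ?addr_ge0.
have [m' [bm' FGm mm']] := H (e / (K + K' + 1)) (divr_gt0 e0 k0).
have := F2 _ _ _ bm bm' mm'; have := G2 _ _ _ bm bm' mm'; rewrite FGm distrC => g1 f1.
have -> : F m - G m = (F m - G m') + (G m' - G m) by rewrite addrA subrK.
apply: le_trans (ler_normD _ _) _; rewrite add0r; apply: le_trans (lerD f1 g1) _.
rewrite -mulrDl mulrCA ger_pMr// ler_pdivrMr// mul1r; lra.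
Qed.

End BoundedFunctionals.

HB.lock Definition fc {dX} {X : measurableType dX} {R : realType}
    (nu : {measure set X -> \bar R}) {dO} {Omega : measurableType dO}
    (E : set Omega -> (X -> R[i]) -> (X -> R[i])) (m : Omega -> R) :
    (X -> R[i]) -> (X -> R[i]) :=
  spectral_integral nu E (fun l => (m l)%:C).

Section FunctionalCalculus.
Context {dX} {X : measurableType dX} {R : realType}.
Variable nu : {measure set X -> \bar R}.
Context {dO} {Omega : measurableType dO}.
Variable E : set Omega -> (X -> R[i]) -> (X -> R[i]).
Hypothesis hE : spectral_measure nu E.
Implicit Types (f g h : X -> R[i]) (A B : set Omega) (m : Omega -> R).
Local Notation L2 := (Lp nu 2%:E).
Local Notation rin := (rin nu).
Local Notation quad := (quad nu E).
Local Notation fc := (fc nu E).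

Let two_gt0 : 0 < 2 :> R. Proof. by []. Qed.
Let L2D f g : L2 f -> L2 g -> L2 (fun x => f x + g x). Proof. exact: Lp_add. Qed.
Let L2B f g : L2 f -> L2 g -> L2 (fun x => f x - g x). Proof. exact: Lp_sub. Qed.
Let L2Z (a : R[i]) f : L2 f -> L2 (fun x => a * f x). Proof. exact: Lp_scale. Qed.

Lemma E_add A f g : measurable A -> L2 f -> L2 g ->
  \forall x \ae nu, E A (fun x => f x + g x) x = E A f x + E A g x.
Proof.
move=> mA Lf Lg; have := E_lin hE 1 mA Lf Lg; apply: filterS => x.
by under eq_fun do rewrite mul1r; rewrite mul1r.
Qed.

Lemma E_scale A (a : R[i]) f : measurable A -> L2 f ->
  \forall x \ae nu, E A (fun x => a * f x) x = a * E A f x.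
Proof.
move=> mA Lf; have := E_lin hE (a - 1) mA Lf Lf; apply: filterS => x.
rewrite (_ : (fun y => (a - 1) * f y + f y) = (fun y => a * f y)).
  by rewrite mulrBl mul1r subrK.
by apply/funext => y; rewrite mulrBl mul1r subrK.
Qed.

Lemma rinE_add A f g h : measurable A -> L2 f -> L2 g -> L2 h ->
  rin (E A (fun x => f x + g x)) h = rin (E A f) h + rin (E A g) h.
Proof.
move=> mA Lf Lg Lh; rewrite -rinDl//; try exact: (E_L2 hE).
apply: rin_ael (E_add mA Lf Lg) => //; first exact/(E_L2 hE)/L2D.
by apply: L2D; exact: (E_L2 hE).
Qed.

Lemma rinE_scale A (a : R[i]) f h : measurable A -> L2 f -> L2 h ->
  rin (E A (fun x => a * f x)) h = rin (fun x => a * E A f x) h.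
Proof.
move=> mA Lf Lh; apply: rin_ael (E_scale a mA Lf) => //; first exact/(E_L2 hE)/L2Z.
exact/L2Z/(E_L2 hE).
Qed.

(** Real polarisation: this is Re <m(L) f, g>, and the imaginary part is recovered by replacing g
    with i g. *)
Definition rform m f g : R :=
  (quad m (fun x => f x + g x)%R - quad m (fun x => f x - g x)%R) / 4.

Lemma rform_indic A f g : measurable A -> L2 f -> L2 g ->
  rform \1_A f g = rin (E A f) g.
Proof.
move=> mA Lf Lg; rewrite /rform !(quad_indic hE)//; try by [exact: L2D|exact: L2B].
have Lg' : L2 (fun x => - g x) by exact: Lp_opp.
have LAf := E_L2 hE mA Lf; have LAg := E_L2 hE mA Lg.
have LAg' := E_L2 hE mA Lg'.
rewrite !rinE_add//; try by [exact: L2D|exact: L2B].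
rewrite !rinDr//.
have EN h : L2 h -> rin (E A (fun x => - g x)) h = - rin (E A g) h.
  move=> Lh; rewrite -rinNl//.
  rewrite (_ : (fun x => - g x) = (fun x => -1 * g x)); last first.
    by apply/funext => x; rewrite mulN1r.
  rewrite rinE_scale//; congr rin; apply/funext => x; exact: mulN1r.
rewrite !EN// !rinNr// (E_sym hE mA Lg Lf) (rinC nu g).
by field.
Qed.

Lemma blin_quad f : L2 f -> blin (quad ^~ f).
Proof.
move=> Lf; split; first by move=> *; rewrite (quad_lin hE).
exists (rin f f); first exact: rin_ge0.
by move=> m1 m2 e b1 b2 me; rewrite mulrC (quad_dist hE).
Qed.

Lemma blin_rform f g : L2 f -> L2 g -> blin (fun m => rform m f g).
Proof.
move=> Lf Lg.
have := blin_add (blin_scale 4^-1 (blin_quad (L2D Lf Lg)))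
  (blin_scale (- 4^-1) (blin_quad (L2B Lf Lg))).
congr blin; apply/funext => m; rewrite /rform.
by move: (quad _ _) (quad _ _) => a b; ring.
Qed.

Lemma rform_dist m1 m2 e f g : bmeas m1 -> bmeas m2 ->
  (forall l, `|m1 l - m2 l| <= e) -> L2 f -> L2 g ->
  `|rform m1 f g - rform m2 f g| <= e * (rin f f + rin g g) / 2.
Proof.
move=> b1 b2 me Lf Lg.
have Q1 := quad_dist hE b1 b2 me (L2D Lf Lg).
have Q2 := quad_dist hE b1 b2 me (L2B Lf Lg).
rewrite rin_sqrD// in Q1; rewrite rin_sqrB// in Q2.
rewrite /rform; move: (quad _ _) (quad _ _) (quad _ _) (quad _ _) Q1 Q2 => a b c c'.
by rewrite !ler_norml => /andP[? ?] /andP[? ?]; apply/andP; split; lra.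
Qed.

Lemma rformC m f g : bmeas m -> L2 f -> L2 g -> rform m f g = rform m g f.
Proof.
move=> bm Lf Lg; apply: (blin_eq (blin_rform Lf Lg) (blin_rform Lg Lf) _ bm) => A mA.
by rewrite !rform_indic// (E_sym hE)// rinC.
Qed.

Lemma rformDr m f g h : bmeas m -> L2 f -> L2 g -> L2 h ->
  rform m f (fun x => g x + h x)%R = rform m f g + rform m f h.
Proof.
move=> bm Lf Lg Lh; apply: (blin_eq (blin_rform Lf (L2D Lg Lh))
  (blin_add (blin_rform Lf Lg) (blin_rform Lf Lh)) _ bm) => A mA.
rewrite !rform_indic//; last exact: L2D.
by rewrite rinDr//; exact: (E_L2 hE).
Qed.

(** On indicators this is complex linearity of the projections, and both sides are determined by
    indicators. *)
Lemma rform_cE m f g (a : R[i]) : bmeas m -> L2 f -> L2 g ->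
  rform m (fun x => a * f x)%R g = rform m f (fun x => conjc a * g x)%R.
Proof.
move=> bm Lf Lg.
apply: (blin_eq (blin_rform (L2Z a Lf) Lg) (blin_rform Lf (L2Z _ Lg)) _ bm) => A mA.
by rewrite !rform_indic//; try exact: L2Z; rewrite rinE_scale// rinMl.
Qed.

Lemma rform_diag m f : bmeas m -> L2 f -> rform m f f = quad m f.
Proof.
move=> bm Lf; apply: (blin_eq (blin_rform Lf Lf) (blin_quad Lf) _ bm) => A mA.
by rewrite rform_indic// (quad_indic hE).
Qed.

Lemma rform_cst (c : R) f g : L2 f -> L2 g -> rform (cst c) f g = c * rin f g.
Proof.
move=> Lf Lg; rewrite /rform !(quad_cst hE)//; try by [exact: L2D|exact: L2B].
by rewrite rin_sqrD// rin_sqrB//; field.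
Qed.

Lemma rform_cvg D (m_ : nat -> Omega -> R) m (M : R) f g : carrier nu E D ->
  (forall n, bmeas (m_ n)) -> bmeas m -> (forall n l, D l -> `|m_ n l| <= M) ->
  (forall l, D l -> m_ n l @[n --> \oo] --> m l) -> L2 f -> L2 g ->
  rform (m_ n) f g @[n --> \oo] --> rform m f g.
Proof.
move=> cD bm_ bm mM mm Lf Lg; apply: cvgMl; apply: cvgB.
- exact: (quad_cvg hE cD bm_ bm mM mm (L2D Lf Lg)).
- exact: (quad_cvg hE cD bm_ bm mM mm (L2B Lf Lg)).
Qed.

Lemma rform_eq_carrier D m1 m2 f g : carrier nu E D -> bmeas m1 -> bmeas m2 ->
  (forall l, D l -> m1 l = m2 l) -> L2 f -> L2 g -> rform m1 f g = rform m2 f g.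
Proof.
move=> cD b1 b2 m12 Lf Lg; rewrite /rform !(quad_eq_carrier hE cD b1 b2 m12)//.
  exact: L2B.
exact: L2D.
Qed.

(** The vector is built along [bmeas_ind]: projections for indicators, and at a uniform limit the
    vectors found for the approximating symbols form a Cauchy sequence in L^2. *)
Lemma calculus_exists m : bmeas m -> forall f, L2 f ->
  exists2 h, L2 h & forall g, L2 g -> rin h g = rform m f g.
Proof.
move: m; apply: bmeas_ind.
- move=> A mA f Lf; exists (E A f); first exact: (E_L2 hE).
  by move=> g Lg; rewrite rform_indic.
- move=> a m1 m2 b1 b2 H1 H2 f Lf.
  have [h1 Lh1 h1E] := H1 f Lf; have [h2 Lh2 h2E] := H2 f Lf.
  exists (fun x => a%:C * h1 x + h2 x) => [|g Lg]; first by apply: L2D => //; exact: L2Z.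
  rewrite rinDl// ?rinZl ?h1E ?h2E//; last exact: L2Z.
  by have [-> //] := blin_rform Lf Lg.
move=> m bm H f Lf.
(* The rate required by [Lp_complete] at exponent 2, that is 8^-n. *)
pose c n : R := (2 * 2 `^ 2) ^- n.
have c0 n : 0 < c n by rewrite invr_gt0 exprn_gt0// mulr_gt0// powR_gt0.
have cE n : c n = 8 ^- n.
  by rewrite /c powR_mulrn//; congr (_ ^- _); rewrite expr2; ring.
have c1 n : c n <= 1.
  by rewrite cE invf_le1 ?exprn_gt0// exprn_ege1// ler1n.
have cnd n k : (n <= k)%N -> c k <= c n.
  move=> nk; rewrite !cE lef_pV2 ?posrE ?exprn_gt0//.
  by apply: ler_weXn2l => //; rewrite ler1n.
have Hn n : {h | L2 h /\ (exists2 m', bmeas m' /\ (forall l, `|m l - m' l| <= c n / 2) &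
    forall g, L2 g -> rin h g = rform m' f g)}.
  apply: cid; have [m' [bm' Hm' mm']] := H (c n / 2) (divr_gt0 (c0 n) two_gt0).
  by have [h Lh hE'] := Hm' f Lf; exists h; split => //; exists m'.
pose u n := projT1 (Hn n).
have Lu n : L2 (u n) by have [] := projT2 (Hn n).
have ub n g : L2 g -> `|rform m f g - rin (u n) g| <= c n / 2 * (rin f f + rin g g) / 2.
  by move=> Lg; have [_ [m' [bm' mm'] ->//]] := projT2 (Hn n); exact: rform_dist.
have uc n k : (n <= k)%N ->
    (mom nu 2 (fun x => u k x - u n x)%R <= (rin f f * (2 * 2 `^ 2) ^- n)%:E)%E.
  (* The two approximations are tested against their own difference w; since c n <= 1, the term in
     <w, w> on the right is absorbed. *)
  move=> nk; set w := fun x => _; have Lw : L2 w by exact: L2B.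
  rewrite rinxx// lee_fin -/(c n).
  have ww : rin w w = rin (u k) w - rin (u n) w by rewrite {1}/w rinBl.
  have := ub n w Lw; have := ub k w Lw.
  rewrite !ler_norml => /andP[a1 a2] /andP[a3 a4].
  have r0 := rin_ge0 nu w; have f0 := rin_ge0 nu f.
  have s0 : 0 <= rin f f + rin w w by exact: addr_ge0.
  have ck : c k / 2 * (rin f f + rin w w) / 2 <= c n / 2 * (rin f f + rin w w) / 2.
    apply: ler_wpM2r; first by rewrite invr_ge0.
    apply: ler_wpM2r => //; apply: ler_wpM2r; first by rewrite invr_ge0.
    exact: cnd.
  have : c n * rin w w <= rin w w by rewrite ler_piMl.
  by move: ww a1 a2 a3 a4 ck; lra.
have [h Lh [_ hc]] := Lp_complete two_gt0 Lu uc.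
exists h => // g Lg.
have g1 : rin (u n) g @[n --> \oo] --> rform m f g.
  have B n : `|rform m f g - rin (u n) g| <= c n * (rin f f + rin g g).
    apply: le_trans (ub n g Lg) _.
    have : 0 <= c n * (rin f f + rin g g) by rewrite mulr_ge0 ?addr_ge0 ?rin_ge0// ltW.
    by lra.
  have cc : c n * (rin f f + rin g g) @[n --> \oo] --> 0.
    rewrite -[X in _ --> X](mul0r (rin f f + rin g g)); apply: cvgMl.
    have := @cvg_geometric R 1 8^-1; rewrite ger0_norm ?invr_ge0// invf_lt1// ltr1n.
    move=> /(_ isT); rewrite (_ : geometric 1 8^-1 = c)//.
    by apply/funext => n; rewrite cE /geometric /= mul1r exprVn.
  apply/cvgrPdist_le => e e0; move/cvgrPdist_le : cc => /(_ e e0).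
  apply: filterS => n; rewrite sub0r normrN => H1; apply: le_trans (B n) _.
  exact: le_trans (ler_norm _) H1.
have g2 : rin (u n) g @[n --> \oo] --> rin h g.
  have B n : (rin (u n) g - rin h g) ^+ 2 <= c n * (rin f f * rin g g).
    rewrite -rinBl//; apply: le_trans (rin_CS (L2B (Lu n) Lh) Lg) _.
    rewrite mulrA; apply: ler_wpM2r; first exact: rin_ge0.
    by have := hc n; rewrite rinxx ?lee_fin; [rewrite mulrC|exact: L2B].
  have cc : c n * (rin f f * rin g g) @[n --> \oo] --> 0.
    rewrite -[X in _ --> X](mul0r (rin f f * rin g g)); apply: cvgMl.
    have := @cvg_geometric R 1 8^-1; rewrite ger0_norm ?invr_ge0// invf_lt1// ltr1n.
    move=> /(_ isT); rewrite (_ : geometric 1 8^-1 = c)//.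
    by apply/funext => n; rewrite cE /geometric /= mul1r exprVn.
  apply/cvgrPdist_le => e e0; have e20 : 0 < e ^+ 2 by rewrite exprn_gt0.
  move/cvgrPdist_le : cc => /(_ _ e20).
  apply: filterS => n; rewrite sub0r normrN => H1.
  rewrite distrC -(@ler_pXn2r _ 2) ?nnegrE ?(ltW e0)// real_normK ?num_real//.
  exact: le_trans (B n) (le_trans (ler_norm _) H1).
exact: (cvg_unique (@Rhausdorff R) g2 g1).
Qed.

(** The four terms of the complex polarisation regroup into two real ones. Stated for every real
    symbol because unbounded ones are treated below. *)
Lemma spectral_formE (phi : Omega -> R) f g : L2 f -> L2 g ->
  spectral_form nu E (fun l => (phi l)%:C) f g =
  Complex (rform phi f g) (rform phi f (fun x => 'i%C * g x)%R).
Proof.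
move=> Lf Lg.
have ci h : L2 h -> cintegral (spectral_dist nu E h) (fun l => (phi l)%:C) = (quad phi h)%:C.
  move=> Lh; rewrite /cintegral quad.unlock; congr Complex.
  by rewrite (spectral_dist_integral hE Lh) integral0.
rewrite /spectral_form !big_ord_recr big_ord0 !ci; try exact/L2D/L2Z.
have -> : (fun x => f x + 'i%C ^+ 0 * g x) = (fun x => f x + g x).
  by apply/funext => x; rewrite expr0 mul1r.
have -> : (fun x => f x + 'i%C ^+ 1 * g x) = (fun x => f x + 'i%C * g x).
  by apply/funext => x; rewrite expr1.
have -> : (fun x => f x + 'i%C ^+ 2 * g x) = (fun x => f x - g x).
  by apply/funext => x; rewrite (sqr_i R) mulN1r.
have -> : (fun x => f x + 'i%C ^+ 3 * g x) = (fun x => f x - 'i%C * g x).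
  by apply/funext => x; rewrite exprS (sqr_i R) mulrN1 mulNr.
rewrite /rform; move: (quad _ _) (quad _ _) (quad _ _) (quad _ _) => q0 q1 q2 q3.
rewrite (exprS _ 2) (sqr_i R) expr0 expr1.
have -> : 4^-1 = (4^-1 : R)%:C :> R[i] by rewrite fmorphV rmorph_nat.
by apply: complex_eqP; rewrite !ReImE /=; ring.
Qed.

Lemma spectral_domainE m f : bmeas m -> L2 f ->
  spectral_domain nu E (fun l => (m l)%:C) f.
Proof.
move=> bm Lf; split => //.
have bm2 := bmeasM bm bm.
rewrite (_ : (fun l => _) = (fun l => (m l * m l)%:E)); last first.
  by apply/funext => l; rewrite normc_real real_normK ?num_real// expr2.
by rewrite (spectral_dist_integral hE Lf) -(EFin_quad hE Lf bm2) ltry.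
Qed.

(** [spectral_integral] selects a vector by its pairings with the domain. [calculus_exists] shows
    that such a vector exists, and the domain of a bounded symbol is all of L^2. *)
Lemma fcP m f : bmeas m -> L2 f ->
  L2 (fc m f) /\ forall g, L2 g -> rin (fc m f) g = rform m f g.
Proof.
move=> bm Lf; rewrite fc.unlock /spectral_integral /=.
set S := [set h | _].
have [h Lh hB] := calculus_exists bm Lf.
have SP : exists h, S h.
  exists h; split => // g [Lg _]; rewrite innerE spectral_formE//.
  by rewrite !hB//; exact: L2Z.
have [LS HS] := xgetPex (fun=> 0) SP; split => // g Lg.
have := HS g (spectral_domainE bm Lg).
by rewrite innerE spectral_formE// => -[].
Qed.

Lemma fc_L2 m f : bmeas m -> L2 f -> L2 (fc m f).
Proof. by move=> bm Lf; have [] := fcP bm Lf. Qed.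

Lemma fc_form m f g : bmeas m -> L2 f -> L2 g -> rin (fc m f) g = rform m f g.
Proof. by move=> bm Lf Lg; have [_ ->] := fcP bm Lf. Qed.

Lemma fc_unique m f h : bmeas m -> L2 f -> L2 h ->
  (forall g, L2 g -> rin h g = rform m f g) -> \forall x \ae nu, fc m f x = h x.
Proof.
move=> bm Lf Lh H; apply: (rin_separates (fc_L2 bm Lf) Lh) => g Lg.
by rewrite fc_form// H.
Qed.

(** Reduced to indicators, first for m' and then for m, where it becomes the product rule of the
    projections. *)
Lemma rform_fc m m' f g : bmeas m -> bmeas m' -> L2 f -> L2 g ->
  rform m' (fc m f) g = rform (fun l => m' l * m l) f g.
Proof.
move=> bm bm' Lf Lg; have Lh := fc_L2 bm Lf.
apply: (blin_eq (blin_rform Lh Lg) (blin_mul bm (blin_rform Lf Lg)) _ bm') => A mA.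
rewrite rform_indic// (E_sym hE)// fc_form//; last exact: (E_L2 hE).
have -> : (fun l => \1_A l * m l) = (fun l => m l * \1_A l).
  by apply/funext => l; rewrite mulrC.
apply: (blin_eq (blin_rform Lf (E_L2 hE mA Lg))
  (blin_mul (bmeas_indic mA) (blin_rform Lf Lg)) _ bm) => B mB.
rewrite rform_indic//; last exact: (E_L2 hE).
rewrite (E_setI hE)//; have -> : (fun l => \1_B l * \1_A l) = \1_(B `&` A) :> (_ -> R).
  by rewrite indicI.
by rewrite rform_indic//; exact: measurableI.
Qed.

Lemma fc_comp m m' f : bmeas m -> bmeas m' -> L2 f ->
  \forall x \ae nu, fc m' (fc m f) x = fc (fun l => m' l * m l) f x.
Proof.
move=> bm bm' Lf; have bmm := bmeasM bm' bm.
apply: fc_unique => //; [exact: fc_L2|exact: fc_L2|].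
by move=> g Lg; rewrite fc_form// rform_fc.
Qed.

Lemma fc_fc_form m m' f g : bmeas m -> bmeas m' -> L2 f -> L2 g ->
  rin (fc m f) (fc m' g) = rform (fun l => m' l * m l) f g.
Proof.
move=> bm bm' Lf Lg; rewrite rinC fc_form//; last exact: fc_L2.
rewrite rformC//; last exact: fc_L2.
exact: rform_fc.
Qed.

Lemma fc_lin m (a : R[i]) f g : bmeas m -> L2 f -> L2 g ->
  \forall x \ae nu, fc m (fun x => a * f x + g x) x = a * fc m f x + fc m g x.
Proof.
move=> bm Lf Lg; have La := L2Z a Lf; have Lag := L2D La Lg.
have [L1 L3] := (fc_L2 bm Lf, fc_L2 bm Lg).
apply: fc_unique => //; first by apply: L2D => //; exact: L2Z.
move=> h Lh; rewrite rinDl//; last exact: L2Z.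
rewrite rinMl !fc_form//; last exact: L2Z.
by rewrite -rform_cE// !(rformC bm _ Lh)// rformDr.
Qed.

Lemma fc_eq_carrier D m1 m2 f : carrier nu E D -> bmeas m1 -> bmeas m2 ->
  (forall l, D l -> m1 l = m2 l) -> L2 f -> \forall x \ae nu, fc m1 f x = fc m2 f x.
Proof.
move=> cD b1 b2 m12 Lf; apply: fc_unique => //; first exact: fc_L2.
by move=> g Lg; rewrite fc_form//; apply/esym; exact: (rform_eq_carrier cD).
Qed.

End FunctionalCalculus.

(** * Unbounded symbols and semigroups *)

Section UnboundedIntegral.
Context {dX} {X : measurableType dX} {R : realType}.
Variable nu : {measure set X -> \bar R}.
Context {dO} {Omega : measurableType dO}.
Variable E : set Omega -> (X -> R[i]) -> (X -> R[i]).
Hypothesis hE : spectral_measure nu E.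
Implicit Types (f g h u : X -> R[i]) (m : Omega -> R).
Local Notation L2 := (Lp nu 2%:E).
Local Notation rin := (rin nu).
Local Notation quad := (quad nu E).
Local Notation fc := (fc nu E).
Local Notation rform := (rform nu E).

Let two_gt0 : 0 < 2 :> R. Proof. by []. Qed.
Let L2D f g : L2 f -> L2 g -> L2 (fun x => f x + g x). Proof. exact: Lp_add. Qed.
Let L2B f g : L2 f -> L2 g -> L2 (fun x => f x - g x). Proof. exact: Lp_sub. Qed.
Let L2Z (a : R[i]) f : L2 f -> L2 (fun x => a * f x). Proof. exact: Lp_scale. Qed.

Lemma spectral_dist_ae f g (psi : Omega -> \bar R) : L2 f -> L2 g ->
  (\forall x \ae nu, f x = g x) ->
  integral (spectral_dist nu E f) setT psi = integral (spectral_dist nu E g) setT psi.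
Proof.
move=> Lf Lg fg; apply: eq_setfun_integral => A mA.
rewrite /spectral_dist !innerE /=; congr (_%:E).
by apply: (rin_ae _ _ (L2_measurable Lf) (L2_measurable Lg) (E_ae hE mA Lf Lg fg) fg);
  apply: L2_measurable; exact: (E_L2 hE).
Qed.

Lemma quad_ae m f g : L2 f -> L2 g -> (\forall x \ae nu, f x = g x) -> quad m f = quad m g.
Proof. by move=> Lf Lg fg; rewrite quad.unlock (spectral_dist_ae _ Lf Lg fg). Qed.

Lemma quad_unit m (a : R[i]) f : normc a = 1 -> bmeas m -> L2 f ->
  quad m (fun x => a * f x) = quad m f.
Proof.
move=> a1 bm Lf; rewrite -!(rform_diag hE)//; last exact: L2Z.
rewrite (rform_cE hE)//; last exact: L2Z.
by have -> : (fun x => conjc a * (a * f x)) = f by apply/funext => x; rewrite mulrA conjc_unit// mul1r.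
Qed.

Lemma quad_parallelogram m f g : bmeas m -> L2 f -> L2 g ->
  quad m (fun x => f x + g x) + quad m (fun x => f x - g x) =
  2 * quad m f + 2 * quad m g.
Proof.
move=> bm Lf Lg; have LD := L2D Lf Lg; have LB := L2B Lf Lg.
apply: (blin_eq (blin_add (blin_quad hE LD) (blin_quad hE LB))
  (blin_add (blin_scale 2 (blin_quad hE Lf)) (blin_scale 2 (blin_quad hE Lg))) _ bm).
move=> A mA; rewrite !(quad_indic hE)// -!(E_quad hE)//.
have LAf := E_L2 hE mA Lf; have LAg := E_L2 hE mA Lg.
have -> : rin (E A (fun x => f x + g x)) (E A (fun x => f x + g x)) =
    rin (E A f) (E A f) + 2 * rin (E A f) (E A g) + rin (E A g) (E A g).
  have H := E_add hE mA Lf Lg; have LED := E_L2 hE mA LD; have LDE := L2D LAf LAg.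
  rewrite -rin_sqrD//.
  exact: (rin_ae (L2_measurable LED) (L2_measurable LDE) (L2_measurable LED)
    (L2_measurable LDE) H H).
have -> : rin (E A (fun x => f x - g x)) (E A (fun x => f x - g x)) =
    rin (E A f) (E A f) - 2 * rin (E A f) (E A g) + rin (E A g) (E A g).
  have LED := E_L2 hE mA LB; have LDE := L2B LAf LAg.
  have H : \forall x \ae nu, E A (fun x => f x - g x) x = E A f x - E A g x.
    have := E_lin hE (-1) mA Lg Lf; apply: filterS => x.
    under eq_fun do rewrite mulN1r addrC.
    by rewrite mulN1r addrC.
  rewrite -rin_sqrB//.
  exact: (rin_ae (L2_measurable LED) (L2_measurable LDE) (L2_measurable LED)
    (L2_measurable LDE) H H).
by ring.
Qed.

Section FixedSymbol.
Variable phi : Omega -> R.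
Hypothesis mphi : measurable_fun setT phi.

Let sq n : Omega -> R := fun l => Num.min (phi l ^+ 2) n%:R.

Let sq_ge0 n l : 0 <= sq n l. Proof. by rewrite le_min sqr_ge0 ler0n. Qed.

Let bsq n : bmeas (sq n).
Proof.
split; first by apply: measurable_minr => //; exact: measurable_funX.
by exists n%:R => l; rewrite ger0_norm// ge_min lexx orbT.
Qed.

(** The domain of an unbounded symbol is expressed through truncated squares, which are bounded, so
    that identities of the bounded calculus apply to it. *)
Lemma spectral_domainP f : L2 f ->
  spectral_domain nu E (fun l => (phi l)%:C) f <->
  exists B, forall n, quad (sq n) f <= B.
Proof.
move=> Lf; rewrite /spectral_domain /=.
have mphi2 : measurable_fun setT (fun l => phi l ^+ 2) by exact: measurable_funX.
have -> : (fun l => (normc (phi l)%:C ^+ 2)%:E) = (fun l => (phi l ^+ 2)%:E).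
  by apply/funext => l; rewrite normc_real real_normK ?num_real.
rewrite (spectral_dist_integral hE Lf); split => [[_ fin]|[B HB]].
  exists (fine (\int[spm hE Lf]_l (phi l ^+ 2)%:E)%E) => n.
  rewrite -lee_fin (EFin_quad hE Lf)// fineK.
    apply: ge0_le_integral => //.
    - by move=> l _; rewrite lee_fin.
    - by apply/measurable_EFinP; have [] := bsq n.
    - exact/measurable_EFinP.
    - by move=> l _; rewrite lee_fin ge_min lexx.
  by rewrite ge0_fin_numE//; apply: integral_ge0 => l _; rewrite lee_fin sqr_ge0.
split => //; apply: (@le_lt_trans _ _ B%:E); last by rewrite ltry.
apply: (@fatou_cvg _ _ _ (spm hE Lf) (fun n l => sq n l) (fun l => phi l ^+ 2) (fun=> B%:E)) => //.
- by move=> n; have [] := bsq n.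
- by move=> l; exact: sqr_ge0.
- apply: aeW => l; apply: cvg_near_cst.
  have [N _ HN] := nbhs_infty_ger (phi l ^+ 2); exists N => // n Nn.
  by rewrite /sq min_l//; exact: HN.
- by move=> n; rewrite -EFin_quad// lee_fin.
- exact: cvg_cst.
Qed.

Lemma spectral_domain_unit (a : R[i]) f : normc a = 1 ->
  spectral_domain nu E (fun l => (phi l)%:C) f ->
  spectral_domain nu E (fun l => (phi l)%:C) (fun x => a * f x).
Proof.
move=> a1 df; have Lf : L2 f by case: df.
have [B HB] := (spectral_domainP Lf).1 df.
by apply/(spectral_domainP (L2Z a Lf)); exists B => n; rewrite quad_unit.
Qed.

(** The parallelogram law for the truncated squares, after dropping the non-negative form of f -
    g. *)
Lemma spectral_domainD f g :
  spectral_domain nu E (fun l => (phi l)%:C) f ->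
  spectral_domain nu E (fun l => (phi l)%:C) g ->
  spectral_domain nu E (fun l => (phi l)%:C) (fun x => f x + g x).
Proof.
move=> df dg; have Lf : L2 f by case: df. have Lg : L2 g by case: dg.
have [B HB] := (spectral_domainP Lf).1 df; have [B' HB'] := (spectral_domainP Lg).1 dg.
apply/(spectral_domainP (L2D Lf Lg)); exists (2 * B + 2 * B') => n.
have := quad_parallelogram (bsq n) Lf Lg.
have := quad_ge0 hE (bsq n) (sq_ge0 n) (L2B Lf Lg).
by have := HB n; have := HB' n; lra.
Qed.

Lemma spectral_domainB f g :
  spectral_domain nu E (fun l => (phi l)%:C) f ->
  spectral_domain nu E (fun l => (phi l)%:C) g ->
  spectral_domain nu E (fun l => (phi l)%:C) (fun x => f x - g x).
Proof.
move=> df dg; have -> : (fun x => f x - g x) = (fun x => f x + -1 * g x).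
  by apply/funext => x; rewrite mulN1r.
apply: (spectral_domainD df); apply: (spectral_domain_unit _ dg).
by rewrite normc_opp ComplexField.Normc.normc1.
Qed.

Let A n : set Omega := [set l | `|phi l| <= n%:R].

Let mA n : measurable (A n).
Proof.
rewrite (_ : A n = (fun l => `|phi l|) @^-1` `]-oo, n%:R]%classic).
  by rewrite -[X in measurable X]setTI; apply: measurableT_comp.
by apply/seteqP; split => l /=; rewrite in_itv.
Qed.

Let tr n : Omega -> R := fun l => phi l * \1_(A n) l.

Let btr n : bmeas (tr n).
Proof.
split; first by apply: measurable_funM => //; exact: measurable_indic.
exists n%:R => l; rewrite /tr indicE; have [|_] := boolP (l \in A n).
  by rewrite inE /A /= mulr1.
by rewrite mulr0 normr0.
Qed.

Let near_A l : \forall n \near \oo, l \in A n.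
Proof.
have [N _ HN] := nbhs_infty_ger `|phi l|; exists N => // n Nn.
by rewrite inE /A /=; exact: HN.
Qed.

Let tr_cvg l : tr n l @[n --> \oo] --> phi l.
Proof.
apply: cvg_near_cst; have := near_A l; apply: filterS => n lA.
by rewrite /tr indicE lA mulr1.
Qed.

Let quad_tr f : spectral_domain nu E (fun l => (phi l)%:C) f ->
  quad (tr n) f @[n --> \oo] --> quad phi f.
Proof.
move=> df; have Lf : L2 f by case: df.
have i2 : (spm hE Lf).-integrable setT (fun l => (phi l ^+ 2)%:E).
  apply/integrableP; split; first by apply/measurable_EFinP; exact: measurable_funX.
  under eq_integral => l _ do rewrite gee0_abs ?lee_fin ?sqr_ge0//.
  rewrite -spectral_dist_integral; case: df => _.
  have -> // : (fun l => (normc (phi l)%:C ^+ 2)%:E) = (fun l => (phi l ^+ 2)%:E).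
  by apply/funext => l; rewrite normc_real real_normK ?num_real.
(* The function 1 + phi^2 dominates |phi| and is integrable because f lies in the domain. *)
have i1 : (spm hE Lf).-integrable setT (fun l => (1 + phi l ^+ 2)%:E).
  have := integrableD measurableT (bmeas_integrable (spm_fin hE Lf) (bmeas_cst 1)) i2.
  by apply: eq_integrable => // l _.
have [] := @dominated_convergence _ _ _ (spm hE Lf) setT measurableT
  (fun n l => (tr n l)%:E) (fun l => (phi l)%:E) (fun l => (1 + phi l ^+ 2)%:E).
- by move=> n; apply/measurable_EFinP; have [] := btr n.
- exact/measurable_EFinP.
- apply: aeW => l _; apply/cvg_EFin; first exact: nearW.
  exact: tr_cvg.
- exact: i1.
- apply: aeW => l n _; rewrite lee_fin.
  have : `|tr n l| <= `|phi l|.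
    rewrite /tr normrM ler_piMr// indicE.
    by case: (_ \in _); rewrite ?normr1 ?normr0.
  move/le_trans; apply; rewrite -(real_normK (num_real (phi l))).
  by have := sqr_ge0 (`|phi l| - 1); have := normr_ge0 (phi l); nra.
move=> iphi _; have phiE : (quad phi f)%:E = (\int[spm hE Lf]_l (phi l)%:E)%E.
  rewrite quad.unlock (spectral_dist_integral hE Lf) fineK//.
  exact: integrable_fin_num.
rewrite -phiE => /fine_cvg /=.
by under eq_fun do rewrite /= -(EFin_quad hE Lf)//=.
Qed.

(** Composes the unbounded phi with a bounded m for which phi m is bounded. Only almost everywhere
    equality of u with m(L) f is asked, so that u may be f itself when m is 1 on the spectrum. *)
Lemma spectral_integral_fc m f u : bmeas m -> bmeas (fun l => phi l * m l) ->
  L2 f -> L2 u -> (\forall x \ae nu, u x = fc m f x) ->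
  spectral_domain nu E (fun l => (phi l)%:C) u /\
  \forall x \ae nu, spectral_integral nu E (fun l => (phi l)%:C) u x =
                    fc (fun l => phi l * m l) f x.
Proof.
move=> + bpm; have dom0 m0 f0 u0 : bmeas m0 -> bmeas (fun l => phi l * m0 l) ->
    L2 f0 -> L2 u0 -> (\forall x \ae nu, u0 x = fc m0 f0 x) ->
    spectral_domain nu E (fun l => (phi l)%:C) u0.
  move=> bm [mpm [M bM]] Lf Lu uE; have Lfc := fc_L2 hE bm Lf.
  apply/spectral_domainP => //; exists (M ^+ 2 * rin f0 f0) => n.
  rewrite (quad_ae _ Lu Lfc uE) -(rform_diag hE)// (rform_fc hE)//.
  rewrite (rformC hE) ?(rform_fc hE)//; try by [exact: bmeasM].
  rewrite (rform_diag hE)//; last by apply: bmeasM => //; exact: bmeasM.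
  rewrite -(quad_cst hE)//; apply: (quad_le hE) => //.
  - by apply: bmeasM => //; exact: bmeasM.
  - exact: bmeas_cst.
  move=> l /=; rewrite -mulrA -expr2.
  have := bM l; rewrite -(@ler_pXn2r _ 2) ?nnegrE// ?(le_trans _ (bM l))// => H.
  apply: le_trans H; rewrite real_normK ?num_real// exprMn.
  by apply: ler_wpM2r; [exact: sqr_ge0|rewrite ge_min lexx].
move=> bm Lf Lu uE; have Lfc := fc_L2 hE bm Lf.
have du := dom0 m f u bm bpm Lf Lu uE; split => //.
have L0 := fc_L2 hE bpm Lf.
rewrite /spectral_integral /=; set S := [set h | _].
(* Both sides are limits along the truncations [tr n] of phi, for which the bounded calculus
   multiplies symbols. *)
have key g : spectral_domain nu E (fun l => (phi l)%:C) g ->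
    rin (fc (fun l => phi l * m l) f) g = rform phi u g.
  move=> dg; have Lg : L2 g by case: dg.
  have c1 : rform (tr n) u g @[n --> \oo] --> rform phi u g.
    apply: cvgMl; apply: cvgB; apply: quad_tr.
      exact: spectral_domainD.
    exact: spectral_domainB.
  have c2 : rform (tr n) u g @[n --> \oo] --> rin (fc (fun l => phi l * m l) f) g.
    rewrite (fc_form hE)//.
    rewrite (_ : (fun n => rform (tr n) u g) = (fun n => rform (fun l => tr n l * m l) f g)).
      have [mpm [M bM]] := bpm.
      apply: (rform_cvg hE (carrier_setT hE) _ bpm (M := M)) => //.
      - by move=> n; exact: bmeasM.
      - move=> n l _; apply: le_trans (bM l).
        rewrite /tr mulrAC normrM ler_piMr// indicE.
        by case: (_ \in _); rewrite ?normr1 ?normr0.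
      - by move=> l _; apply: cvgMl; exact: tr_cvg.
    apply/funext => n; rewrite -(rform_fc hE)//.
    rewrite /(rform _ _ _); congr ((_ - _) / _); apply: quad_ae; try by [exact: L2D|exact: L2B].
      by apply: filterS uE => x ->.
    by apply: filterS uE => x ->.
  exact: (cvg_unique (@Rhausdorff R) c2 c1).
have SP : exists h, S h.
  exists (fc (fun l => phi l * m l) f); split => // g dg.
  have Lg : L2 g by case: dg.
  have di := spectral_domain_unit (normc_i : normc ('i%C : R[i]) = 1) dg.
  by rewrite innerE (spectral_formE hE _ Lu Lg); congr Complex; exact: key.
have [LS HS] := xgetPex (fun=> 0) SP.
apply: (rin_separates LS L0) => k Lk.
(* The selected vector is known only by its pairings with the domain. The projections of k to |phi|
   <= n lie in the domain and converge weakly to k, which settles all pairings. *)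
have bA n : bmeas (\1_(A n) : Omega -> R) by exact: bmeas_indic.
have E1 n h : L2 h -> rin h (fc \1_(A n) k) = rform \1_(A n) h k.
  by move=> Lh; rewrite rinC (fc_form hE)// (rformC hE).
have lim1 h : L2 h -> rform \1_(A n) h k @[n --> \oo] --> rin h k.
  move=> Lh; rewrite -[X in _ --> X]mul1r -(rform_cst hE)//.
  apply: (rform_cvg hE (carrier_setT hE) _ (bmeas_cst 1) (M := 1)) => //.
    by move=> n l _; rewrite indicE; case: (_ \in _); rewrite ?normr1 ?normr0.
  move=> l _; apply: cvg_near_cst; have := near_A l; apply: filterS => n lA.
  by rewrite indicE lA.
have eqn n : rform \1_(A n) (xget (fun=> 0) S) k =
    rform \1_(A n) (fc (fun l => phi l * m l) f) k.
  rewrite -!E1//.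
  have dk : spectral_domain nu E (fun l => (phi l)%:C) (fc \1_(A n) k).
    apply: (dom0 \1_(A n) k) => //; [exact: btr|exact: (fc_L2 hE)|].
    exact: aeW.
  have := HS _ dk; rewrite innerE (spectral_formE hE _ Lu (fc_L2 hE (bA n) Lk)).
  by move=> -[-> _]; rewrite (key _ dk).
have := lim1 _ LS; rewrite (funext eqn) => l1.
exact: (cvg_unique (@Rhausdorff R) l1 (lim1 _ L0)).
Qed.

End FixedSymbol.

End UnboundedIntegral.

(** * Exponentials as limits of resolvents *)

Section ExponentialLimit.
Context {R : realType}.
Implicit Types x y t : R.

(** Both bounds come from 1 + x <= e^x. With z = y / (n+1), the number 1 / (1 + z) is at least
    e^(-z); being 1 - z / (1 + z), it is also at most e^(-z / (1 + z)). *)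
Lemma cvg_expn_resolvent y : 0 <= y ->
  (1 + y / n.+1%:R)^-1 ^+ n.+1 @[n --> \oo] --> expR (- y).
Proof.
move=> y0.
have z0 n : 0 <= y / n.+1%:R by rewrite divr_ge0.
have z1 n : 0 < 1 + y / n.+1%:R by rewrite ltr_wpDr.
apply: (@squeeze_cvgr _ _ _ _ (fun=> expR (- y))
  (fun n => expR (- (y / (1 + y / n.+1%:R))))).
- apply: nearW => n; apply/andP; split.
    have -> : - y = (- (y / n.+1%:R)) *+ n.+1.
      by rewrite mulNrn -(mulr_natr (y / _)) divfK.
    rewrite -(mulr_natl (- _)) expRM_natl; apply: lerXn2r; rewrite ?nnegrE ?expR_ge0 ?invr_ge0 ?(ltW (z1 n))//.
    by rewrite expRN lef_pV2 ?posrE ?expR_gt0//; exact: expR_ge1Dx.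
  have -> : - (y / (1 + y / n.+1%:R)) = (- (y / n.+1%:R / (1 + y / n.+1%:R))) *+ n.+1.
    have := z1 n; rewrite mulNrn -(mulr_natr (y / _ / _)).
    move: (n.+1%:R) (pnatr_eq0 R n.+1) => N /negbT N0 zN; congr (- _); field.
    by rewrite N0 /= (_ : N + y = N * (1 + y / N)) ?mulf_neq0 ?(gt_eqF zN)//; field.
  rewrite -(mulr_natl (- _)) expRM_natl; apply: lerXn2r; rewrite ?nnegrE ?expR_ge0 ?invr_ge0 ?(ltW (z1 n))//.
  apply: le_trans (expR_ge1Dx _).
  rewrite le_eqVlt; apply/orP; left; apply/eqP.
  by have := z1 n; move: (y / _) => z z1'; field; rewrite gt_eqF.
- exact: cvg_cst.
- apply: continuous_cvg; first exact: continuous_expR.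
  apply: cvgN; rewrite -[X in _ --> X]divr1; apply: cvgMr.
  apply: cvgV; first exact: oner_neq0.
  rewrite -[X in _ --> X]addr0; apply: cvgD; first exact: cvg_cst.
  rewrite -[X in _ --> X](mulr0 y); apply: cvgMr.
  exact: cvg_harmonic.
Qed.

End ExponentialLimit.

Lemma measurable_funV_ge0 {d} {T : measurableType d} {R : realType} (f : T -> R) :
  measurable_fun setT f -> (forall x, 0 <= f x) ->
  measurable_fun setT (fun x => (f x)^-1).
Proof.
move=> mf f0; rewrite (_ : (fun x => _) = (fun x => f x `^ -1)).
  exact: (measurableT_comp (measurable_powR _) mf).
by apply/funext => x; rewrite powR_inv1.
Qed.

Section Resolvent.
Context {R : realType}.
Implicit Types (x e t : R).

Definition posind x : R := \1_(`[0, +oo[%classic : set R) x.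

Lemma posindE x : posind x = if 0 <= x then 1 else 0.
Proof.
rewrite /posind indicE; case: ifPn => [x0|x0].
  by rewrite mem_set//= in_itv /= x0.
by rewrite memNset//= in_itv /= andbT; exact/negP.
Qed.

Lemma measurable_posind : measurable_fun setT posind.
Proof. by apply: measurable_indic; exact: measurable_itv. Qed.

Let maxge1 e x : 0 < e -> 1 <= 1 + e * Num.max x 0.
Proof. by move=> e0; rewrite lerDl mulr_ge0 ?(ltW e0)// le_max lexx orbT. Qed.

(* [posind] extends these functions by 0 off the spectrum, so that they are
   bounded on the whole line. *)
Definition resolvent e x : R := (1 + e * Num.max x 0)^-1 * posind x.

Lemma resolvent_ge0 e x : 0 < e -> 0 <= resolvent e x.
Proof.
move=> e0; rewrite /resolvent mulr_ge0//.
  by rewrite invr_ge0 (le_trans _ (maxge1 x e0)).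
Qed.

Lemma resolvent_le1 e x : 0 < e -> `|resolvent e x| <= 1.
Proof.
move=> e0; rewrite ger0_norm ?resolvent_ge0// /resolvent -[leRHS]mulr1.
have h := maxge1 x e0; apply: ler_pM => //.
- by rewrite invr_ge0 (le_trans _ h).
- by rewrite invf_le1// (lt_le_trans _ h).
- by rewrite posindE; case: ifP.
Qed.

Lemma measurable_resolvent e : 0 < e -> measurable_fun setT (resolvent e).
Proof.
move=> e0; apply: measurable_funM; last exact: measurable_posind.
apply: measurable_funV_ge0 => [|x]; last by rewrite (le_trans _ (maxge1 x e0)).
apply: measurable_funD => //; apply: measurable_funM => //.
exact: measurable_maxr.
Qed.

Lemma mul_resolvent e x : 0 < e -> 0 <= x ->
  x * resolvent e x = e^-1 * (1 - resolvent e x).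
Proof.
move=> e0 x0; rewrite /resolvent posindE x0 mulr1 max_l//.
by field; rewrite !gt_eqF// ltr_wpDr// mulr_ge0// ltW.
Qed.

Lemma mul_resolvent_le e x : 0 < e -> `|x * resolvent e x| <= e^-1.
Proof.
move=> e0; have [x0|x0] := leP 0 x; last first.
  by rewrite /resolvent posindE (lt_geF x0) !mulr0 normr0 invr_ge0 ltW.
rewrite mul_resolvent// ger0_norm; last first.
  rewrite mulr_ge0 ?invr_ge0 ?(ltW e0)// subr_ge0.
  exact: le_trans (ler_norm _) (resolvent_le1 x e0).
by rewrite ler_piMr ?invr_ge0 ?(ltW e0)// gerBl resolvent_ge0.
Qed.

Definition expind t x : R := expR (- (t * x)) * posind x.

Lemma measurable_expind t : measurable_fun setT (expind t).
Proof.
apply: measurable_funM; last exact: measurable_posind.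
apply: measurableT_comp; first exact: measurable_expR.
by apply: measurable_funN; exact: measurable_funM.
Qed.

Lemma expind_ge0 t x : 0 <= expind t x.
Proof. by rewrite /expind mulr_ge0 ?expR_ge0// posindE; case: ifP. Qed.

Lemma expind_le1 t x : 0 <= t -> expind t x <= 1.
Proof.
move=> t0; rewrite /expind posindE; case: ifPn => x0; last by rewrite mulr0.
by rewrite mulr1 -expR0 ler_expR oppr_le0 mulr_ge0.
Qed.

End Resolvent.

(** * Matching the joint calculus with each semigroup *)

Section Representations.
Context {dX} {X : measurableType dX} {R : realType}.
Variable nu : {measure set X -> \bar R}.
Implicit Types (f g h u : X -> R[i]).
Local Notation L2 := (Lp nu 2%:E).
Local Notation rin := (rin nu).

Let two_gt0 : 0 < 2 :> R. Proof. by []. Qed.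
Let L2B f g : L2 f -> L2 g -> L2 (fun x => f x - g x). Proof. exact: Lp_sub. Qed.
Let L2D f g : L2 f -> L2 g -> L2 (fun x => f x + g x). Proof. exact: Lp_add. Qed.

Section OneMeasure.
Context {dO} {Omega : measurableType dO}.
Variable E : set Omega -> (X -> R[i]) -> (X -> R[i]).
Hypothesis hE : spectral_measure nu E.
Local Notation quad := (quad nu E).
Local Notation fc := (fc nu E).
Local Notation rform := (rform nu E).

Lemma rform_ae m f g h : L2 f -> L2 g -> L2 h -> (\forall x \ae nu, f x = g x) ->
  rform m f h = rform m g h.
Proof.
move=> Lf Lg Lh fg; rewrite /(rform _ _ _); congr ((_ - _) / _); apply: (quad_ae hE).
- exact: L2D.
- exact: L2D.
- by apply: filterS fg => x ->.
- exact: L2B.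
- exact: L2B.
- by apply: filterS fg => x ->.
Qed.

Lemma fc_ae m f g : bmeas m -> L2 f -> L2 g -> (\forall x \ae nu, f x = g x) ->
  \forall x \ae nu, fc m f x = fc m g x.
Proof.
move=> bm Lf Lg fg; apply: (fc_unique hE bm Lf (fc_L2 hE bm Lg)) => h Lh.
by rewrite (fc_form hE bm Lg Lh); apply/esym; exact: rform_ae.
Qed.

Lemma fc_cst1 f : L2 f -> \forall x \ae nu, fc (cst 1) f x = f x.
Proof.
move=> Lf; apply: (fc_unique hE (bmeas_cst 1) Lf Lf) => g Lg.
by rewrite (rform_cst hE 1 Lf Lg) mul1r.
Qed.

Lemma carrier_of_quad D : measurable D ->
  (forall f, L2 f -> quad \1_(~` D) f = 0) -> carrier nu E D.
Proof.
move=> mD H; split=> // f Lf; have LD := E_L2 hE mD Lf.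
have mC := measurableC mD.
have := H f Lf; rewrite (quad_indic hE mC Lf) => C0.
have T : rin f f = rin (E D f) f + rin (E (~` D) f) f.
  rewrite -(E_setU hE mD mC (setICr D) Lf Lf) setUv.
  apply: esym; exact: (rin_ael (E_L2 hE measurableT Lf) Lf Lf (E_setT hE Lf)).
have : rin (fun x => E D f x - f x) (fun x => E D f x - f x) = 0.
  by rewrite (rin_sqrB LD Lf) (E_quad hE mD Lf) T C0; ring.
move=> /(rin_eq0 (L2B LD Lf)); apply: filterS => x /eqP.
by rewrite subr_eq0 => /eqP.
Qed.

Variable phi : Omega -> R.
Hypothesis mphi : measurable_fun setT phi.
Variable L : operator X R.
Hypothesis linL : linear_operator nu 2%:E L.
Hypothesis posL : nonneg_operator nu L.
Hypothesis LE : operator_eq nu L (spectral_integral nu E (fun l => (phi l)%:C)).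

Lemma operator_fc m f : bmeas m -> bmeas (fun l => phi l * m l) -> L2 f ->
  domain L (fc m f) /\ \forall x \ae nu, L (fc m f) x = fc (fun l => phi l * m l) f x.
Proof.
move=> bm bpm Lf; have Lu := fc_L2 hE bm Lf; case: LE => domE opE.
have [du uE] := spectral_integral_fc hE mphi bm bpm Lf Lu (aeW _ (fun x => erefl _)).
have dL : domain L (fc m f) by rewrite domE.
split=> //; have /aeqP e := opE _ dL.
by apply: filterS2 e uE => x -> ->.
Qed.

Lemma rin_operator_ge0 u : domain L u -> 0 <= rin (L u) u.
Proof. by move=> du; have := posL du; rewrite innerE lecE /= => /andP[]. Qed.

(** Where - (n+1) <= phi <= - 1 / (n+1), the form of L is at most - 1 / (n+1) times that of the
    corresponding projection, so positivity of L makes the projection vanish. These sets increase to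
    phi < 0. *)
Lemma carrier_nonneg : carrier nu E [set l | 0 <= phi l].
Proof.
have mD : measurable [set l | 0 <= phi l].
  rewrite (_ : mkset _ = phi @^-1` `[0, +oo[%classic).
    by rewrite -[X in measurable X]setTI; exact: mphi.
  by apply/seteqP; split => l /=; rewrite in_itv /= andbT.
apply: carrier_of_quad => // f Lf.
pose A n : set Omega := phi @^-1` `[- n.+1%:R, - n.+1%:R^-1]%classic.
have mA n : measurable (A n).
  by rewrite -[X in measurable X]setTI; exact: mphi.
have bA n : bmeas (\1_(A n) : Omega -> R) by exact: bmeas_indic.
have A0 n : quad \1_(A n) f = 0.
  have bp : bmeas (fun l => phi l * \1_(A n) l).
    split; first by apply: measurable_funM => //; exact: measurable_indic.
    exists n.+1%:R => l; rewrite indicE; have [|_] := boolP (l \in A n).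
      rewrite inE /A /= in_itv /= mulr1 => /andP[l1 l2].
      rewrite ler0_norm; first by rewrite lerNl.
      by apply: le_trans l2 _; rewrite oppr_le0 invr_ge0.
    by rewrite mulr0 normr0.
  have [du uE] := operator_fc (bA n) bp Lf.
  have Lu := fc_L2 hE (bA n) Lf; have L0 := fc_L2 hE bp Lf.
  have LL : L2 (L (fc \1_(A n) f)) by case: linL => _ _ _ H _; exact: H.
  have := rin_operator_ge0 du; rewrite (rin_ael LL L0 Lu uE).
  rewrite (fc_fc_form hE bp (bA n) Lf Lf) => p0.
  have b1 := bmeasM (bA n) bp.
  move: p0; rewrite (rform_diag hE b1 Lf) => p0.
  have b2 : bmeas (fun l => (- n.+1%:R^-1 : R) * \1_(A n) l + cst (0 : R) l).
    exact: (bmeas_lin _ (bA n) (bmeas_cst 0)).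
  have : quad (fun l => \1_(A n) l * (phi l * \1_(A n) l)) f <=
         quad (fun l => (- n.+1%:R^-1 : R) * \1_(A n) l + cst (0 : R) l) f.
    apply: (quad_le hE b1 b2 _ Lf) => l; rewrite indicE /= addr0.
    have [|_] := boolP (l \in A n); last by rewrite !mul0r mulr0.
    by rewrite inE /A /= in_itv /= !mulr1 mul1r => /andP[].
  rewrite (quad_lin hE _ (bA n) (bmeas_cst 0) Lf) (quad_cst hE _ Lf) mul0r addr0.
  have i0 l : 0 <= (\1_(A n) l : R) by rewrite indicE.
  have := quad_ge0 hE (bA n) i0 Lf.
  move: p0; move: (quad _ f) (quad \1_(A n) f) => a b a0 b0 ab.
  have n0 : 0 < n.+1%:R^-1 :> R by rewrite invr_gt0.
  by apply/eqP; rewrite eq_le b0 andbT; move: n0 ab; move: (_^-1) => c c0 ab; nra.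
have bC : bmeas (\1_(~` [set l | 0 <= phi l]) : Omega -> R).
  by apply: bmeas_indic; exact: measurableC.
have := quad_cvg hE (carrier_setT hE) bA bC (M := 1) _ _ Lf.
rewrite (funext A0) => H.
have {}H : (fun=> 0 : R) @ \oo --> quad \1_(~` [set l | 0 <= phi l]) f.
  apply: H => [n l _|l _].
    by rewrite indicE; case: (_ \in _); rewrite ?normr1 ?normr0.
  apply: cvg_near_cst.
  have [l0|l0] := leP 0 (phi l).
    apply: nearW => n; rewrite !indicE; congr (_%:R).
    rewrite (memNset (A := ~` _)) /=; last by apply.
    rewrite memNset// /A /= in_itv /= => /andP[_].
    by apply/negP; rewrite -ltNge (lt_le_trans _ l0)// oppr_lt0 invr_gt0.
  have [N1 _ HN1] := nbhs_infty_ger (- phi l).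
  have [N2 _ HN2] := nbhs_infty_ger (- phi l)^-1.
  exists (maxn N1 N2) => // n /=; rewrite geq_max => /andP[n1 n2].
  rewrite !indicE; congr (_%:R).
  rewrite (mem_set (A := ~` _)) /=; last by apply/negP; rewrite -ltNge.
  rewrite mem_set// /A /= in_itv /=; apply/andP; split.
    rewrite lerNl; apply: le_trans (HN1 n n1) _; by rewrite ler_nat.
  have p0 : 0 < - phi l by rewrite oppr_gt0.
  rewrite lerNr -[leRHS]invrK lef_pV2 ?posrE ?invr_gt0//.
  by apply: le_trans (HN2 n n2) _; rewrite ler_nat.
exact: (cvg_unique (@Rhausdorff R) H (cvg_cst 0)).
Qed.

End OneMeasure.

(** * Two spectral representations of one operator *)

Section TwoMeasures.
Context {d1} {O1 : measurableType d1} {d2} {O2 : measurableType d2}.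
Variable E1 : set O1 -> (X -> R[i]) -> (X -> R[i]).
Variable E2 : set O2 -> (X -> R[i]) -> (X -> R[i]).
Hypothesis hE1 : spectral_measure nu E1.
Hypothesis hE2 : spectral_measure nu E2.
Variables (phi1 : O1 -> R) (phi2 : O2 -> R).
Hypothesis mphi1 : measurable_fun setT phi1.
Hypothesis mphi2 : measurable_fun setT phi2.
Variable L : operator X R.
Hypothesis linL : linear_operator nu 2%:E L.
Hypothesis posL : nonneg_operator nu L.
Hypothesis LE1 : operator_eq nu L (spectral_integral nu E1 (fun l => (phi1 l)%:C)).
Hypothesis LE2 : operator_eq nu L (spectral_integral nu E2 (fun l => (phi2 l)%:C)).

Let bres {d} {O : measurableType d} (phi : O -> R) e : measurable_fun setT phi ->
  0 < e -> bmeas (fun l => resolvent e (phi l)).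
Proof.
move=> mphi e0; split; first by apply: measurableT_comp => //; exact: measurable_resolvent.
by exists 1 => l; exact: resolvent_le1.
Qed.

Let bpres {d} {O : measurableType d} (phi : O -> R) e : measurable_fun setT phi ->
  0 < e -> bmeas (fun l => phi l * resolvent e (phi l)).
Proof.
move=> mphi e0; split; first by apply: measurable_funM => //; have [] := bres mphi e0.
by exists e^-1 => l; exact: mul_resolvent_le.
Qed.

(** This is (1 + e L) u = f for u the resolvent of f; the identity of symbols behind it holds on phi
    >= 0, which carries the spectral measure. *)
Let resolvent_eqn {d} {O : measurableType d} (E : set O -> (X -> R[i]) -> (X -> R[i]))
    (phi : O -> R) (hE : spectral_measure nu E) (mphi : measurable_fun setT phi)
    (LE : operator_eq nu L (spectral_integral nu E (fun l => (phi l)%:C))) e f :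
  0 < e -> L2 f -> domain L (fc nu E (fun l => resolvent e (phi l)) f) /\
   \forall x \ae nu, L (fc nu E (fun l => resolvent e (phi l)) f) x =
     (e^-1)%:C * (f x - fc nu E (fun l => resolvent e (phi l)) f x).
Proof.
move=> e0 Lf; have br := bres mphi e0; have bp := bpres mphi e0.
have [du uE] := operator_fc hE mphi LE br bp Lf; split => //.
have cD := carrier_nonneg hE mphi linL posL LE.
have Lu := fc_L2 hE br Lf.
have LW : L2 (fun x => (e^-1)%:C * (f x - fc nu E (fun l => resolvent e (phi l)) f x)).
  by apply: Lp_scale => //; exact: L2B.
have : \forall x \ae nu, fc nu E (fun l => phi l * resolvent e (phi l)) f x =
    (e^-1)%:C * (f x - fc nu E (fun l => resolvent e (phi l)) f x).
  apply: (fc_unique hE bp Lf LW) => g Lg.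
  rewrite (rinZl _ (L2B Lf Lu) Lg) (rinBl Lf Lu Lg) (fc_form hE br Lf Lg).
  have -> : rin f g = rform nu E (cst 1) f g by rewrite (rform_cst hE _ Lf Lg) mul1r.
  have bl := blin_rform hE Lf Lg.
  have bm : bmeas (fun l => - e^-1 * resolvent e (phi l) + e^-1 * cst (1 : R) l).
    exact: (bmeas_lin (- e^-1) br (bmeas_cst (e^-1 * 1))).
  have eqc l : 0 <= phi l -> phi l * resolvent e (phi l) =
      - e^-1 * resolvent e (phi l) + e^-1 * cst (1 : R) l.
    by move=> l0; rewrite mul_resolvent//=; ring.
  rewrite (rform_eq_carrier hE cD bp bm eqc Lf Lg).
  have b1 : bmeas (fun l : O => e^-1 * cst (1 : R) l + cst (0 : R) l).
    exact: (bmeas_lin e^-1 (bmeas_cst 1) (bmeas_cst 0)).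
  have [blD _] := bl.
  have := blD (- e^-1) _ _ br b1.
  have := blD (e^-1) (cst 1) (cst 0) (bmeas_cst 1) (bmeas_cst 0).
  rewrite (rform_cst hE 0 Lf Lg) mul0r addr0 => -> .
  rewrite (_ : (fun l => _) = (fun l => - e^-1 * resolvent e (phi l) + e^-1 * cst (1 : R) l)).
    by move=> ->; ring.
  by apply/funext => l /=; rewrite addr0.
by apply: filterS2 uE => x -> ->.
Qed.

(* Both sides solve (1 + e L) u = f, whose solution is unique as L >= 0. *)
Lemma fc_resolvent e f : 0 < e -> L2 f -> \forall x \ae nu,
  fc nu E1 (fun l => resolvent e (phi1 l)) f x =
  fc nu E2 (fun l => resolvent e (phi2 l)) f x.
Proof.
move=> e0 Lf; have [du1] := resolvent_eqn hE1 mphi1 LE1 e0 Lf.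
have [du2] := resolvent_eqn hE2 mphi2 LE2 e0 Lf.
have := fc_L2 hE1 (bres mphi1 e0) Lf; have := fc_L2 hE2 (bres mphi2 e0) Lf.
move: (fc nu E1 _ f) (fc nu E2 _ f) du1 du2 => u1 u2 du1 du2 Lu2 Lu1 e2 e1.
case: linL => _ _ _ LL lin.
have [dw /aeqP ew] := lin (-1) _ _ du2 du1.
have Lw : L2 (fun x => -1 * u2 x + u1 x) by apply: L2D => //; exact: Lp_scale.
have := rin_operator_ge0 posL dw.
have LZ : L2 (fun x => (- e^-1)%:C * (-1 * u2 x + u1 x)) by exact: Lp_scale.
have H : \forall x \ae nu, L (fun x => -1 * u2 x + u1 x) x =
   (- e^-1)%:C * (-1 * u2 x + u1 x).
  apply: filterS3 e1 e2 ew => x -> -> ->; rewrite rmorphN /=; ring.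
rewrite (rin_ael (LL _ dw) LZ Lw H) (rinZl _ Lw Lw) => h.
have w0 : rin (fun x => -1 * u2 x + u1 x) (fun x => -1 * u2 x + u1 x) = 0.
  apply/eqP; rewrite eq_le rin_ge0 andbT; move: h.
  by rewrite mulNr oppr_ge0 pmulr_rle0// invr_gt0.
have := rin_eq0 Lw w0; apply: filterS => x /eqP.
by rewrite mulN1r addrC subr_eq0 => /eqP.
Qed.

Lemma fc_resolventX e n f : 0 < e -> L2 f -> \forall x \ae nu,
  fc nu E1 (fun l => resolvent e (phi1 l) ^+ n) f x =
  fc nu E2 (fun l => resolvent e (phi2 l) ^+ n) f x.
Proof.
move=> e0 Lf.
have bX (d : measure_display) (O : measurableType d) (phi : O -> R) k : measurable_fun setT phi ->
    bmeas (fun l => resolvent e (phi l) ^+ k).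
  move=> mphi; split; first by apply: measurable_funX; have [] := bres mphi e0.
  by exists 1 => l; rewrite normrX exprn_ile1// resolvent_le1.
elim: n => [|n IH].
  have := fc_cst1 hE1 Lf; have := fc_cst1 hE2 Lf.
  rewrite (_ : cst 1 = (fun l => resolvent e (phi2 l) ^+ 0))//.
  rewrite (_ : cst 1 = (fun l => resolvent e (phi1 l) ^+ 0))//.
  by apply: filterS2 => x -> ->.
have c1 := fc_comp hE1 (bX _ _ phi1 n mphi1) (bres mphi1 e0) Lf.
have c2 := fc_comp hE2 (bX _ _ phi2 n mphi2) (bres mphi2 e0) Lf.
have L1 := fc_L2 hE1 (bX _ _ phi1 n mphi1) Lf.
have L3 := fc_L2 hE2 (bX _ _ phi2 n mphi2) Lf.
have c3 := fc_resolvent e0 L1.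
have c4 := fc_ae hE2 (bres mphi2 e0) L1 L3 IH.
rewrite (_ : (fun l => resolvent e (phi1 l) ^+ n.+1) =
  (fun l => resolvent e (phi1 l) * resolvent e (phi1 l) ^+ n)); last first.
  by apply/funext => l; rewrite exprS.
rewrite (_ : (fun l => resolvent e (phi2 l) ^+ n.+1) =
  (fun l => resolvent e (phi2 l) * resolvent e (phi2 l) ^+ n)); last first.
  by apply/funext => l; rewrite exprS.
have : \forall x \ae nu,
    fc nu E1 (fun l => resolvent e (phi1 l)) (fc nu E1 (fun l => resolvent e (phi1 l) ^+ n) f) x =
    fc nu E2 (fun l => resolvent e (phi2 l)) (fc nu E2 (fun l => resolvent e (phi2 l) ^+ n) f) x.
  by apply: filterS2 c3 c4 => x -> ->.
by apply: filterS3 c1 c2 => x <- <-.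
Qed.

(** Agreement of the powers of resolvents passes to the exponential by the Euler limit, taken inside
    the forms. *)
Lemma fc_expind t f : 0 < t -> L2 f -> \forall x \ae nu,
  fc nu E1 (fun l => expind t (phi1 l)) f x = fc nu E2 (fun l => expind t (phi2 l)) f x.
Proof.
move=> t0 Lf.
have bexp (d : measure_display) (O : measurableType d) (phi : O -> R) :
    measurable_fun setT phi -> bmeas (fun l => expind t (phi l)).
  move=> mphi; split; first by apply: measurableT_comp => //; exact: measurable_expind.
  by exists 1 => l; rewrite ger0_norm ?expind_ge0 ?expind_le1// ltW.
have e0 n : 0 < t / n.+1%:R by rewrite divr_gt0.
have bX (d : measure_display) (O : measurableType d) (phi : O -> R) n :
    measurable_fun setT phi -> bmeas (fun l => resolvent (t / n.+1%:R) (phi l) ^+ n.+1).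
  move=> mphi; split; first by apply: measurable_funX; have [] := bres mphi (e0 n).
  by exists 1 => l; rewrite normrX exprn_ile1// resolvent_le1.
have lim (d : measure_display) (O : measurableType d)
    (E : set O -> (X -> R[i]) -> (X -> R[i])) (phi : O -> R) :
    spectral_measure nu E -> measurable_fun setT phi ->
    operator_eq nu L (spectral_integral nu E (fun l => (phi l)%:C)) ->
    forall g, L2 g ->
    rform nu E (fun l => resolvent (t / n.+1%:R) (phi l) ^+ n.+1) f g @[n --> \oo] -->
    rform nu E (fun l => expind t (phi l)) f g.
  move=> hE mphi LE g Lg.
  apply: (rform_cvg hE (carrier_nonneg hE mphi linL posL LE) (fun n => bX _ _ _ n mphi)
    (bexp _ _ _ mphi) (M := 1) _ _ Lf Lg) => [n l _|l l0].
    by rewrite normrX exprn_ile1// resolvent_le1.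
  rewrite /expind posindE l0 mulr1.
  have := cvg_expn_resolvent (mulr_ge0 (ltW t0) l0).
  rewrite (_ : (fun n => _) = (fun n => resolvent (t / n.+1%:R) (phi l) ^+ n.+1))//.
  apply/funext => n; rewrite /resolvent posindE l0 mulr1 max_l//.
  by rewrite mulrAC.
have L1 := fc_L2 hE2 (bexp _ _ _ mphi2) Lf.
apply: (fc_unique hE1 (bexp _ _ _ mphi1) Lf L1) => g Lg.
rewrite (fc_form hE2 (bexp _ _ _ mphi2) Lf Lg).
have l1 := lim _ _ _ _ hE1 mphi1 LE1 g Lg; have l2 := lim _ _ _ _ hE2 mphi2 LE2 g Lg.
move: l1; rewrite (_ : (fun n => _) =
    (fun n => rform nu E2 (fun l => resolvent (t / n.+1%:R) (phi2 l) ^+ n.+1) f g)).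
  by move=> l1; exact: (cvg_unique (@Rhausdorff R) l2 l1).
apply/funext => n; have b1 := bX _ _ _ n mphi1; have b2 := bX _ _ _ n mphi2.
rewrite -(fc_form hE1 b1 Lf Lg) -(fc_form hE2 b2 Lf Lg).
exact: (rin_ael (fc_L2 hE1 b1 Lf) (fc_L2 hE2 b2 Lf) Lg (fc_resolventX _ (e0 n) Lf)).
Qed.

End TwoMeasures.
(** The symbol e^(-t l) is unbounded on the negative half-line. As f equals its image under the
    projection [posind], the bounded symbol [expind t] can take its place. *)
Lemma semigroup_fc (EL : set (measurableTypeR R) -> (X -> R[i]) -> (X -> R[i]))
    (L : operator X R) t f : linear_operator nu 2%:E L -> nonneg_operator nu L ->
  spectral_measure_of nu L EL -> 0 < t -> L2 f ->
  \forall x \ae nu, semigroup nu EL t f x = fc nu EL (expind t) f x.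
Proof.
move=> linL posL [hE LE] t0 Lf.
have cD := carrier_nonneg hE (@measurable_id _ _ setT) linL posL LE.
pose psi : measurableTypeR R -> R := fun l => expR (- (t * l)).
have mpsi : measurable_fun setT psi.
  apply: measurableT_comp; first exact: measurable_expR.
  by apply: measurable_funN; exact: measurable_funM.
have bm : bmeas (@posind R : measurableTypeR R -> R) by exact: bmeas_indic.
have bp : bmeas (fun l => psi l * posind l).
  split; first exact: measurable_expind.
  by exists 1 => l; rewrite ger0_norm ?(expind_ge0 t l) ?(expind_le1 l (ltW t0)).
have fE : \forall x \ae nu, f x = fc nu EL (@posind R) f x.
  have e1 := fc_eq_carrier hE cD bm (bmeas_cst 1) _ Lf.
  have : \forall x \ae nu, fc nu EL (@posind R) f x = fc nu EL (cst 1) f x.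
    by apply: e1 => l /= l0; rewrite posindE l0.
  by apply: filterS2 (fc_cst1 hE Lf) => x -> ->.
by have [] := spectral_integral_fc hE mpsi bm bp Lf Lf fE.
Qed.

End Representations.

(** * Telescoping along the semigroups *)

Section Contractions.
Context {dX} {X : measurableType dX} {R : realType}.
Variable nu : {measure set X -> \bar R}.
Context {dO} {Omega : measurableType dO}.
Variable E : set Omega -> (X -> R[i]) -> (X -> R[i]).
Hypothesis hE : spectral_measure nu E.
Implicit Types (f g h u : X -> R[i]).
Local Notation L2 := (Lp nu 2%:E).
Local Notation fc := (fc nu E).

(** Holds for f outside the domain as well: when nothing can be selected, [xget] returns 0. *)
Lemma spectral_integral_L2 {d'} {O : measurableType d'}
    (F : set O -> (X -> R[i]) -> (X -> R[i])) (m : O -> R[i]) f :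
  L2 (spectral_integral nu F m f).
Proof.
rewrite /spectral_integral /=; case: xgetP => [h _ [] //|_].
exact: Lp0.
Qed.

Section OneContraction.
Variable m : Omega -> R.
Hypothesis bm : bmeas m.
Hypothesis m1 : forall l, `|m l| <= 1.
Variable S : (X -> R[i]) -> (X -> R[i]).
Hypothesis SL2 : forall f, L2 (S f).
Hypothesis SE : forall f, L2 f -> \forall x \ae nu, S f x = fc m f x.
Hypothesis Snorm : forall q f, (1 <= q)%E -> Lp nu q f -> L2 f ->
  (Lpnorm nu q (S f) <= Lpnorm nu q f)%E.

Lemma fc_mom_le q f : 1 <= q -> L2 f -> (mom nu q (fc m f) <= mom nu q f)%E.
Proof.
move=> q1 Lf; have q0 : 0 < q by exact: lt_le_trans q1.
have [fin|] := ltP (mom nu q f) +oo%E; last by rewrite leye_eq => /eqP ->; rewrite leey.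
have Lqf : Lp nu q%:E f by apply/(LpP _ _ q0); split=> //; exact: L2_measurable Lf.
rewrite -(mom_ae _ (L2_measurable (SL2 f)) (L2_measurable (fc_L2 hE bm Lf)) (SE Lf)).
by apply: Lpnorm_le_mom => //; apply: Snorm => //; rewrite lee_fin.
Qed.

Lemma fc_bicontraction : bicontraction nu (fc m).
Proof.
split.
- by move=> f Lf; exact: (fc_L2 hE bm Lf).
- by move=> a f g Lf Lg; exact: (fc_lin hE a bm Lf Lg).
- by move=> f Lf; apply: fc_mom_le => //; rewrite ler1n.
- by move=> f Lf; exact: fc_mom_le.
move=> f Lf f1.
(* On a space of measure 0 the L^oo norm is 0 by definition, not an essential supremum; there every
   property holds almost everywhere. *)
have [nu0|nu0] := leP (nu setT) 0%E.
  exists setT; split => //.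
  by apply/eqP; rewrite eq_le nu0 measure_ge0.
have fle : (Lpnorm nu +oo%E f <= 1)%E.
  rewrite /Lpnorm unlock nu0; apply/ess_supP; apply: aeW => x.
  by rewrite /= lee_fin ger0_norm ?normc_ge0.
have Lf1 : Lp nu +oo%E f.
  by split; [exact: L2_measurable Lf|apply: le_lt_trans fle _; exact: ltry].
have := le_trans (Snorm (leey _) Lf1 Lf) fle.
rewrite /Lpnorm unlock nu0 => /ess_supP H.
apply: filterS2 (SE Lf) H => x <-.
by rewrite /= lee_fin ger0_norm ?normc_ge0.
Qed.

End OneContraction.
End Contractions.
Section BoundedMeasurableOps.
Context {d} {T : measurableType d} {R : realType}.

Lemma bmeas_prod (I : finType) (F : I -> T -> R) : (forall i, bmeas (F i)) ->
  bmeas (fun l => \prod_i F i l).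
Proof.
move=> bF; rewrite (_ : (fun l => _) = (fun l => \prod_(i <- enum I) F i l)); last first.
  by apply/funext => l; rewrite big_enum.
elim: (enum I) => [|i s IH].
  by under eq_fun do rewrite big_nil; exact: (bmeas_cst 1).
by under eq_fun do rewrite big_cons; exact: bmeasM.
Qed.

Lemma bmeas_sum n (F : nat -> T -> R) : (forall i, bmeas (F i)) ->
  bmeas (fun l => \sum_(i < n) F i l).
Proof.
move=> bF; elim: n => [|n IH].
  by under eq_fun do rewrite big_ord0; exact: (bmeas_cst 0).
rewrite (_ : (fun l => _) = (fun l => 1 * F n l + \sum_(i < n) F i l)).
  exact: bmeas_lin.
by apply/funext => l; rewrite big_ord_recr mul1r addrC.
Qed.

Lemma bmeasX n (m : T -> R) : bmeas m -> bmeas (fun l => m l ^+ n).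
Proof.
move=> bm; elim: n => [|n IH].
  by under eq_fun do rewrite expr0; exact: (bmeas_cst 1).
by under eq_fun do rewrite exprS; exact: bmeasM.
Qed.

End BoundedMeasurableOps.

HB.lock Definition momr {dX} {X : measurableType dX} {R : realType}
    (nu : {measure set X -> \bar R}) (r : R) (f : X -> R[i]) : R := fine (mom nu r f).

HB.lock Definition bellr {dX} {X : measurableType dX} {R : realType}
    (nu : {measure set X -> \bar R}) (p : R) (f g : X -> R[i]) : R :=
  fine (\int[nu]_x (bell p (f x) (g x))%:E)%E.

Lemma EFin_momr {dX} {X : measurableType dX} {R : realType}
    (nu : {measure set X -> \bar R}) (r : R) (f : X -> R[i]) :
  0 < r -> Lp nu r%:E f -> (momr nu r f)%:E = mom nu r f.
Proof.
by move=> r0 /(LpP _ _ r0) [_ H]; rewrite momr.unlock fineK// ge0_fin_numE ?mom_ge0.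
Qed.

Lemma momr_ge0 {dX} {X : measurableType dX} {R : realType}
    (nu : {measure set X -> \bar R}) (r : R) (f : X -> R[i]) : 0 <= momr nu r f.
Proof. by rewrite momr.unlock fine_ge0// mom_ge0. Qed.

Lemma momrN {dX} {X : measurableType dX} {R : realType}
    (nu : {measure set X -> \bar R}) (r : R) (f : X -> R[i]) :
  momr nu r (fun x => - f x) = momr nu r f.
Proof. by rewrite momr.unlock momN. Qed.

Section Telescoping.
Context {dX} {X : measurableType dX} {R : realType}.
Variable nu : {measure set X -> \bar R}.
Context {dO} {Omega : measurableType dO}.
Variable E : set Omega -> (X -> R[i]) -> (X -> R[i]).
Hypothesis hE : spectral_measure nu E.
Implicit Types (f g h u : X -> R[i]).
Local Notation L2 := (Lp nu 2%:E).
Local Notation rin := (rin nu).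
Local Notation fc := (fc nu E).
Local Notation rform := (rform nu E).

Variable I : finType.
Variable lam : I -> Omega -> R.
Hypothesis mlam : forall i, measurable_fun setT (lam i).
Hypothesis cD : carrier nu E [set l | forall i, 0 <= lam i l].

Local Notation T i t := (fc (fun l => expind t (lam i l))).
Hypothesis bT : forall i t, 0 < t -> bicontraction nu (T i t).
Hypothesis momT : forall i t q f, 0 < t -> 1 <= q -> L2 f ->
  (mom nu q (T i t f) <= mom nu q f)%E.

Variables p q : R.
Hypotheses (p1 : 1 < p) (p2 : p <= 2) (qE : q = p / (p - 1)).

Let two_gt0 : 0 < 2 :> R. Proof. by []. Qed.
Let p0 : 0 < p. Proof. exact: lt_trans p1. Qed.
Let pm0 : 0 < p - 1. Proof. by rewrite subr_gt0. Qed.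
Let q1 : 1 <= q. Proof. by rewrite qE ler_pdivlMr// mul1r lerBlDr lerDl. Qed.
Let q0 : 0 < q. Proof. exact: lt_le_trans q1. Qed.

Local Notation bellr := (bellr nu p).

Let bell_fin f g : Lp nu p%:E f -> Lp nu q%:E g ->
  nu.-integrable setT (fun x => (bell p (f x) (g x))%:E).
Proof.
move=> Lf Lg; have ff := EFin_momr p0 Lf; have fg := EFin_momr q0 Lg.
case: Lf Lg => [mf _] [mg _].
apply/integrableP; split.
  by apply/measurable_EFinP; exact: measurable_bell.
under eq_integral => x _ do rewrite gee0_abs ?lee_fin ?bell_ge0//.
have := bellm_le nu p1 p2 mf mg; rewrite -qE => H; apply: le_lt_trans H _.
rewrite -ff -fg -!EFinM -EFinD; exact: ltry.
Qed.

Let bellrE f g : Lp nu p%:E f -> Lp nu q%:E g ->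
  (bellr f g)%:E = (\int[nu]_x (bell p (f x) (g x))%:E)%E.
Proof.
by move=> Lf Lg; rewrite bellr.unlock fineK//; apply: integrable_fin_num (bell_fin Lf Lg).
Qed.

Lemma bellr_ge0 f g : 0 <= bellr f g.
Proof.
by rewrite bellr.unlock; apply: fine_ge0; apply: integral_ge0 => x _; rewrite lee_fin bell_ge0.
Qed.

Lemma bellr_le f g : Lp nu p%:E f -> Lp nu q%:E g ->
  bellr f g <= (2 / (p - 1) + 1) * momr nu p f + 2 * momr nu q g.
Proof.
move=> Lf Lg; rewrite -lee_fin (bellrE Lf Lg) EFinD !EFinM.
rewrite (EFin_momr p0 Lf) (EFin_momr q0 Lg).
by have := bellm_le nu p1 p2 (proj1 Lf) (proj1 Lg); rewrite -qE.
Qed.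

Lemma bellr_ae f f' g g' : Lp nu p%:E f -> Lp nu p%:E f' -> Lp nu q%:E g ->
  Lp nu q%:E g' -> (\forall x \ae nu, f x = f' x) -> (\forall x \ae nu, g x = g' x) ->
  bellr f g = bellr f' g'.
Proof.
move=> [mf _] [mf' _] [mg _] [mg' _] ff gg; rewrite bellr.unlock; apply: (congr1 fine).
apply: ae_eq_integral; first exact: measurableT.
- by apply/measurable_EFinP; exact: (measurable_bell p1 p2 mf mg).
- by apply/measurable_EFinP; exact: (measurable_bell p1 p2 mf' mg').
- by apply: filterS2 ff gg => x -> ->.
Qed.

Lemma bellr_neg f g : L2 f -> L2 g -> Lp nu p%:E f -> Lp nu q%:E g ->
  bellr (fun x => - f x) g = bellr f g + 2 * rin f g.
Proof.
move=> Lf Lg Lpf Lqg; apply: EFin_inj.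
rewrite bellrE//; last exact: Lp_opp.
rewrite EFinD EFinM bellrE// EFin_rin// -integralZl//; last exact: integrable_dot.
rewrite -integralD//; last first.
- by apply: integrableZl => //; exact: integrable_dot.
- exact: bell_fin.
by apply: eq_integral => x _; rewrite bellN// EFinD EFinM.
Qed.

Lemma bellr_step i t f g : 0 < t -> L2 f -> L2 g -> Lp nu p%:E f -> Lp nu q%:E g ->
  Lp nu p%:E (T i t f) -> Lp nu q%:E (T i t g) ->
  bellr (T i t f) (T i t g) <= bellr f g.
Proof.
move=> t0 Lf Lg Lpf Lqg LTf LTg; rewrite -lee_fin (bellrE LTf LTg) (bellrE Lpf Lqg).
by move: Lqg; rewrite qE => Lqg'; exact: (bell_step p1 p2 (bT i t0) Lf Lpf Lg Lqg').
Qed.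

Section FixedPair.
Variables f g : X -> R[i].
Hypotheses (Lf : L2 f) (Lg : L2 g) (Lpf : Lp nu p%:E f) (Lqg : Lp nu q%:E g).

(** The symbol e records the flow applied so far. The two integrability clauses keep the Bellman
    integrals finite, so that energies can be subtracted. *)
Definition admissible (e : Omega -> R) : Prop :=
  [/\ bmeas e, Lp nu p%:E (fc e f) & Lp nu q%:E (fc e g)].

Definition energy (e : Omega -> R) : R := bellr (fun x => - fc e f x) (fc e g).

Local Notation x_ t i := (fun l => expind t (lam i l)).

Lemma bmeas_expind i t : 0 <= t -> bmeas (x_ t i).
Proof.
move=> t0; split; first by apply: measurableT_comp; [exact: measurable_expind|].
by exists 1 => l; rewrite ger0_norm ?expind_ge0 ?expind_le1.
Qed.

(* By [bellN] the energy is the Bellman integral of (f_e, g_e), which decreases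
   along the flow, plus 2 Re <f_e, g_e> = 2 [rform (e^2) f g]. *)
Lemma admissible_step i t e : 0 < t -> admissible e ->
  [/\ admissible (fun l => expind t (lam i l) * e l),
      energy (fun l => expind t (lam i l) * e l) <= energy e &
      rform (fun l => (1 - expind t (lam i l) ^+ 2) * e l ^+ 2) f g <=
        (energy e - energy (fun l => expind t (lam i l) * e l)) / 2].
Proof.
move=> t0 [be Le Lge]; have bx := bmeas_expind i (ltW t0).
have bxe := bmeasM bx be.
have L2e := fc_L2 hE be Lf; have L2ge := fc_L2 hE be Lg.
have L2xe := fc_L2 hE bxe Lf; have L2gxe := fc_L2 hE bxe Lg.
have cf := fc_comp hE be bx Lf; have cg := fc_comp hE be bx Lg.
have LpT r u : 1 <= r -> L2 u -> Lp nu r%:E u -> Lp nu r%:E (T i t u).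
  move=> r1 Lu Lru; have r0 : 0 < r by exact: lt_le_trans r1.
  apply/(LpP _ _ r0); split; first exact: L2_measurable (fc_L2 hE bx Lu).
  apply: le_lt_trans (momT _ t0 r1 Lu) _.
  by have [] := (LpP _ _ r0).1 Lru.
have LTf : Lp nu p%:E (T i t (fc e f)) by exact: (LpT _ _ (ltW p1) L2e Le).
have LTg : Lp nu q%:E (T i t (fc e g)) by exact: (LpT _ _ q1 L2ge Lge).
have Lxe : Lp nu p%:E (fc (fun l => expind t (lam i l) * e l) f).
  exact: (Lp_ae p0 LTf (L2_measurable L2xe) cf).
have Lgxe : Lp nu q%:E (fc (fun l => expind t (lam i l) * e l) g).
  exact: (Lp_ae q0 LTg (L2_measurable L2gxe) cg).
have adm : admissible (fun l => expind t (lam i l) * e l) by split.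
have L2N := Lp_opp two_gt0 L2e; have LpN := Lp_opp p0 Le.
have LpTN : Lp nu p%:E (T i t (fun x => - fc e f x)) by exact: (LpT _ _ (ltW p1) L2N LpN).
have TN : \forall x \ae nu, T i t (fun x => - fc e f x) x =
     - fc (fun l => expind t (lam i l) * e l) f x.
  have := fc_lin hE (-1) bx L2e (Lp0 nu two_gt0).
  have T0 := bic0 (bT i t0).
  apply: filterS3 T0 cf => x h0 hc.
  rewrite (_ : (fun y => -1 * fc e f y + 0) = (fun y => - fc e f y)).
    by move=> ->; rewrite h0 hc addr0 mulN1r.
  by apply/funext => y; rewrite addr0 mulN1r.
have dec : energy (fun l => expind t (lam i l) * e l) <= energy e.
  rewrite /energy -(bellr_ae LpTN (Lp_opp p0 Lxe) LTg Lgxe TN cg).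
  exact: (bellr_step t0 L2N L2ge LpN Lge LpTN LTg).
have dec2 : bellr (fc (fun l => expind t (lam i l) * e l) f)
    (fc (fun l => expind t (lam i l) * e l) g) <= bellr (fc e f) (fc e g).
  rewrite -(bellr_ae LTf Lxe LTg Lgxe cf cg).
  exact: (bellr_step t0 L2e L2ge Le Lge LTf LTg).
split => //.
have e1 : energy e = bellr (fc e f) (fc e g) + 2 * rform (fun l => e l * e l) f g.
  by rewrite /energy (bellr_neg L2e L2ge Le Lge) (fc_fc_form hE be be Lf Lg).
have e2 : energy (fun l => expind t (lam i l) * e l) =
    bellr (fc (fun l => expind t (lam i l) * e l) f)
    (fc (fun l => expind t (lam i l) * e l) g) +
    2 * rform (fun l => (expind t (lam i l) * e l) * (expind t (lam i l) * e l)) f g.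
  by rewrite /energy (bellr_neg L2xe L2gxe Lxe Lgxe) (fc_fc_form hE bxe bxe Lf Lg).
have [bl _] := blin_rform hE Lf Lg.
have := bl (-1) _ _ (bmeasM bxe bxe) (bmeasM be be).
rewrite (_ : (fun l => -1 * _ + _) =
  (fun l => (1 - expind t (lam i l) ^+ 2) * e l ^+ 2)); last first.
  by apply/funext => l; ring.
move=> ->; rewrite e1 e2; move: dec2; move: (rform _ _ _) (rform _ _ _) (bellr _ _) (bellr _ _).
by move=> a b c c'; lra.
Qed.

Lemma admissible_seq (s : seq I) (t : I -> R) e : (forall i, 0 < t i) -> admissible e ->
  admissible (fun l => (\prod_(i <- s) expind (t i) (lam i l)) * e l) /\
  energy (fun l => (\prod_(i <- s) expind (t i) (lam i l)) * e l) <= energy e.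
Proof.
move=> t0 ae; elim: s => [|i s [IH1 IH2]].
  by under eq_fun do rewrite big_nil mul1r.
have [H1 H2 _] := admissible_step i (t0 i) IH1.
by under eq_fun do rewrite big_cons -mulrA; split=> //; exact: le_trans IH2.
Qed.

(* The r-th semigroup is applied first; the others only lower the energy. *)
Lemma energy_cycle r (t : I -> R) e : (forall i, 0 < t i) -> admissible e ->
  let e' := fun l => (\prod_i expind (t i) (lam i l)) * e l in
  admissible e' /\
  rform (fun l => (1 - expind (t r) (lam r l) ^+ 2) * e l ^+ 2) f g <=
    (energy e - energy e') / 2.
Proof.
move=> t0 ae /=; have [H1 H2 H3] := admissible_step r (t0 r) ae.
have := admissible_seq [seq i <- enum I | i != r] t0 H1.
rewrite (_ : (fun l => _ * _) = (fun l => (\prod_i expind (t i) (lam i l)) * e l)).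
  move=> [H4 H5]; split => //; apply: le_trans H3 _.
  by rewrite ler_pM2r ?invr_gt0// lerB.
by apply/funext => l; rewrite (bigD1 r)//= big_filter big_enum_cond/= mulrA (mulrC (expind _ _)).
Qed.

(** One cycle multiplies the symbol by P, the product of all exponentials. Each summand is bounded
    by half an energy drop, so the sum telescopes to at most half the initial energy, the final one
    being non-negative. *)
Lemma energy_sum r (t : I -> R) N : (forall i, 0 < t i) ->
  rform (fun l => \sum_(n < N) (1 - expind (t r) (lam r l) ^+ 2) *
     ((\prod_i expind (t i) (lam i l)) ^+ n) ^+ 2) f g <=
  (2 / (p - 1) + 1) * momr nu p f + 2 * momr nu q g.
Proof.
move=> t0; pose P l := \prod_i expind (t i) (lam i l).
have bP : bmeas P.
  by apply: bmeas_prod => i; exact/bmeas_expind/ltW.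
have bx := bmeasX 2 (bmeas_expind r (ltW (t0 r))).
have bc : bmeas (fun l => 1 - expind (t r) (lam r l) ^+ 2).
  rewrite (_ : (fun l => _) = (fun l => -1 * expind (t r) (lam r l) ^+ 2 + cst (1 : R) l)).
    exact: (bmeas_lin (-1) bx (bmeas_cst 1)).
  by apply/funext => l /=; rewrite mulN1r addrC.
have bPn n : bmeas (fun l => P l ^+ n) by exact: bmeasX.
have bterm n : bmeas (fun l => (1 - expind (t r) (lam r l) ^+ 2) * (P l ^+ n) ^+ 2).
  exact: (bmeasM bc (bmeasX 2 (bPn n))).
have bsum n : bmeas (fun l => \sum_(k < n) (1 - expind (t r) (lam r l) ^+ 2) * (P l ^+ k) ^+ 2).
  exact: (@bmeas_sum _ _ _ n (fun k l => (1 - expind (t r) (lam r l) ^+ 2) * (P l ^+ k) ^+ 2)).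
have f1 := fc_cst1 hE Lf; have g1 := fc_cst1 hE Lg.
have L2f1 := fc_L2 hE (bmeas_cst 1) Lf; have L2g1 := fc_L2 hE (bmeas_cst 1) Lg.
have f1' : \forall x \ae nu, f x = fc (cst 1) f x by apply: filterS f1 => x ->.
have g1' : \forall x \ae nu, g x = fc (cst 1) g x by apply: filterS g1 => x ->.
have Lpf1 := Lp_ae p0 Lpf (L2_measurable L2f1) f1'.
have Lqg1 := Lp_ae q0 Lqg (L2_measurable L2g1) g1'.
have H n : admissible (fun l => P l ^+ n) /\
   rform (fun l => \sum_(k < n) (1 - expind (t r) (lam r l) ^+ 2) * (P l ^+ k) ^+ 2) f g <=
   (energy (cst 1) - energy (fun l => P l ^+ n)) / 2.
  elim: n => [|n [IH1 IH2]].
    rewrite (_ : (fun l => P l ^+ 0) = cst 1); last by apply/funext => l; rewrite expr0.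
    split; first by split => //; exact: (bmeas_cst 1).
    under eq_fun do rewrite big_ord0.
    by rewrite (rform_cst hE 0 Lf Lg) mul0r subrr mul0r.
  have [H1 H2] := energy_cycle r t0 IH1.
  rewrite (_ : (fun l => P l ^+ n.+1) = (fun l => \prod_i expind (t i) (lam i l) * P l ^+ n)).
    split => //.
    have [bl _] := blin_rform hE Lf Lg.
    rewrite (_ : (fun l => \sum_(k < n.+1) _) = (fun l => 1 * ((1 - expind (t r) (lam r l) ^+ 2) * (P l ^+ n) ^+ 2) + \sum_(k < n) (1 - expind (t r) (lam r l) ^+ 2) * (P l ^+ k) ^+ 2)).
      rewrite (bl 1 _ _ (bterm n) (bsum n)) mul1r.
      apply: le_trans (lerD H2 IH2) _.
      by move: (energy _) (energy _) (energy _) => a b c; lra.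
    by apply/funext => l; rewrite big_ord_recr /= mul1r [LHS]addrC.
  by apply/funext => l; rewrite exprS.
have [_ H2] := H N; apply: le_trans H2 _.
have En : 0 <= energy (fun l => P l ^+ N) by exact: bellr_ge0.
have -> : energy (cst 1) = bellr (fun x => - f x) g.
  apply: bellr_ae => //; try exact: Lp_opp.
  by apply: filterS f1 => x ->.
have := bellr_le (Lp_opp p0 Lpf) Lqg; rewrite momrN.
move: En; have := bellr_ge0 (fun x => - f x) g; move: (bellr _ _) (energy _) => a b; lra.
Qed.

End FixedPair.
End Telescoping.

(** * The scalar limit of the telescoped symbols *)

Section DifferenceQuotients.
Context {R : realType}.
Implicit Types a L t x : R.

Lemma expRN_le x : 0 <= x -> expR (- x) <= (1 + x)^-1.
Proof.
move=> x0; rewrite expRN lef_pV2 ?posrE ?expR_gt0 ?ltr_wpDr//.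
exact: expR_ge1Dx.
Qed.

(** The symbol of [energy_sum] at a point of the spectrum, where a is the r-th weighted coordinate
    and L the weighted sum of all coordinates: the r-th factor is e^(-t a) and the product is e^(-t
    L). *)
Definition quotient_sum t N a L : R :=
  \sum_(n < N) (1 - expR (- (t * a)) ^+ 2) * (expR (- (t * L)) ^+ n) ^+ 2.

Lemma quotient_sumE t N a L :
  quotient_sum t N a L * (1 - expR (- (2 * t * L))) =
  (1 - expR (- (2 * t * a))) * (1 - expR (- (2 * t * L * N%:R))).
Proof.
have sq x : expR (- (t * x)) ^+ 2 = expR (- (2 * t * x)).
  by rewrite -expRM_natl; congr expR; ring.
rewrite /quotient_sum -mulr_sumr sq -[LHS]mulrA; congr (_ * _).
under eq_bigr do rewrite -exprM mulnC exprM sq.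
rewrite mulrC -opprB mulNr -subrX1 opprB; congr (_ - _).
by rewrite -expRM_natl; congr expR; ring.
Qed.

Lemma quotient_sum_ge0 t N a L : 0 <= t -> 0 <= a -> 0 <= quotient_sum t N a L.
Proof.
move=> t0 a0; apply: sumr_ge0 => n _; apply: mulr_ge0; last exact: sqr_ge0.
rewrite subr_ge0 exprn_ile1 ?expR_ge0// -expR0 ler_expR oppr_le0.
exact: mulr_ge0.
Qed.

(** The sum increases with a, and for a = L it telescopes to 1 - e^(-2 t L N). *)
Lemma quotient_sum_le1 t N a L : 0 <= t -> 0 <= a -> a <= L -> quotient_sum t N a L <= 1.
Proof.
move=> t0 a0 aL; have L0 := le_trans a0 aL.
apply: (@le_trans _ _ (quotient_sum t N L L)).
  apply: ler_sum => n _; apply: ler_wpM2r; first exact: sqr_ge0.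
  rewrite lerB// lerXn2r ?nnegrE ?expR_ge0//.
  by rewrite ler_expR lerN2 ler_wpM2l.
rewrite /quotient_sum -mulr_sumr.
under eq_bigr do rewrite -exprM mulnC exprM.
set y := expR _ ^+ 2; rewrite -opprB mulNr -subrX1 opprB gerBl.
by rewrite exprn_ge0// sqr_ge0.
Qed.

(** The closed form combined with x / (1 + x) <= 1 - e^(-x) <= x, at u = 2 t a, v = 2 t L and w = 2
    t L N. *)
Lemma quotient_sum_bounds t N a L : 0 < t -> 0 <= a -> 0 < L ->
  a / L / (1 + 2 * t * a) * (1 - (1 + 2 * t * L * N%:R)^-1) <= quotient_sum t N a L
    <= a / L * (1 + 2 * t * L).
Proof.
move=> t0 a0 L0; have := quotient_sumE t N a L.
have t20 : 0 < 2 * t by rewrite mulr_gt0.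
have v0 : 0 < 2 * t * L by rewrite mulr_gt0.
have u0 : 0 <= 2 * t * a by rewrite mulr_ge0// ltW.
have w0 : 0 <= 2 * t * L * N%:R by rewrite mulr_ge0// ltW.
have aL : a / L = (2 * t * a) / (2 * t * L) by field; rewrite !gt_eqF.
rewrite aL.
have := expRN_le w0; have := expRN_le u0; have := expRN_le (ltW v0).
have := expR_ge1Dx (- (2 * t * L * N%:R)); have := expR_ge1Dx (- (2 * t * a)).
have := expR_ge1Dx (- (2 * t * L)); have := expR_gt0 (- (2 * t * L * N%:R)).
move: (quotient_sum t N a L) u0 v0 w0 => S.
move: (2 * t * a) (2 * t * L) (2 * t * L * N%:R) => u v w u0 v0 w0.
move: (expR (- u)) (expR (- v)) (expR (- w)) => eu ev ew ew0 v1 u1 w1 v2 u2 w2 H.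
have v1' : 0 < 1 + v by lra.
have u1' : 0 < 1 + u by lra.
have d0 : v / (1 + v) <= 1 - ev.
  have -> : v / (1 + v) = 1 - (1 + v)^-1 by field; rewrite gt_eqF.
  by rewrite lerB.
have vv : 0 < v / (1 + v) by rewrite divr_gt0.
have d1 : 0 < 1 - ev by exact: lt_le_trans d0.
have -> : S = (1 - eu) * (1 - ew) / (1 - ev) by rewrite -H mulfK// gt_eqF.
have n1 : u / (1 + u) <= 1 - eu.
  have -> : u / (1 + u) = 1 - (1 + u)^-1 by field; rewrite gt_eqF.
  by rewrite lerB.
have u3 : 0 <= u / (1 + u) by rewrite divr_ge0// ltW.
have w3 : 0 <= 1 - (1 + w)^-1.
  by rewrite subr_ge0 invf_le1 ?ltr_wpDr// lerDl.
apply/andP; split.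
  have -> : u / v / (1 + u) * (1 - (1 + w)^-1) = (u / (1 + u)) * (1 - (1 + w)^-1) / v.
    by field; rewrite !gt_eqF//; rewrite ltr_wpDr.
  apply: ler_pM; first by rewrite mulr_ge0.
  - by rewrite invr_ge0 ltW.
  - by apply: ler_pM => //; rewrite lerB.
  by rewrite lef_pV2 ?posrE//; lra.
have -> : u / v * (1 + v) = u / (v / (1 + v)) by field; rewrite !gt_eqF.
have ew1 : 0 <= 1 - ew by apply: le_trans w3 _; rewrite lerB.
have eu1 : 0 <= 1 - eu by exact: le_trans n1.
apply: ler_pM.
- exact: mulr_ge0.
- by rewrite invr_ge0 ltW.
- by apply: (@le_trans _ _ (u * 1)); [apply: ler_pM => //; lra|rewrite mulr1].
- by rewrite lef_pV2 ?posrE.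
Qed.

(** With step t = 1 / (n+1) and N = (n+1)^2 cycles, t tends to 0 while the total time t N = n+1
    tends to infinity. *)
Lemma quotient_sum_cvg a L : 0 <= a -> a <= L ->
  quotient_sum n.+1%:R^-1 (n.+1 ^ 2) a L @[n --> \oo] --> a / L.
Proof.
(* If L = 0 then a = 0: every summand vanishes, and a / L is 0 by the convention on inverses. *)
move=> a0 aL; have := le_trans a0 aL; rewrite le_eqVlt => /predU1P[L0|L0].
  have {}a0 : a = 0 by apply/eqP; rewrite eq_le a0 L0 aL.
  rewrite a0 mul0r (_ : (fun n => _) = (fun=> 0)); first exact: cvg_cst.
  apply/funext => n; rewrite /quotient_sum big1// => k _.
  by rewrite mulr0 oppr0 expR0 expr1n subrr mul0r.
have hh : harmonic (n : nat) @[n --> \oo] --> (0 : R) by exact: cvg_harmonic.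
have h1 (c : R) : 1 + c * n.+1%:R^-1 @[n --> \oo] --> (1 : R).
  rewrite -[X in _ --> X]addr0; apply: cvgD; first exact: cvg_cst.
  by rewrite -[X in _ --> X](mulr0 c); apply: cvgMr.
apply: (@squeeze_cvgr _ _ _ _
  (fun n => a / L / (1 + 2 * a * n.+1%:R^-1) * (1 - (1 + 2 * L * n.+1%:R)^-1))
  (fun n => a / L * (1 + 2 * L * n.+1%:R^-1))).
- apply: nearW => n; have n0 : 0 < n.+1%:R^-1 :> R by rewrite invr_gt0.
  have := quotient_sum_bounds (n.+1 ^ 2) n0 a0 L0; rewrite natrX.
  rewrite (_ : 2 * n.+1%:R^-1 * L * n.+1%:R ^+ 2 = 2 * L * n.+1%:R); last first.
    by move: (n.+1%:R) (pnatr_eq0 R n.+1) => N /negbT N0; field.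
  by rewrite (mulrAC 2 _ a) (mulrAC 2 _ L).
- rewrite -[X in _ --> X]mulr1; apply: cvgM.
    rewrite -[X in _ --> X]divr1; apply: cvgMr; apply: cvgV => //; exact: oner_neq0.
  rewrite -[X in _ --> X]subr0; apply: cvgB; first exact: cvg_cst.
  apply: (@squeeze0 _ _ (fun n => (2 * L)^-1 * n.+1%:R^-1)) => [n|].
    rewrite -invfM; apply/andP; split; first by rewrite invr_ge0 addr_ge0// !mulr_ge0// ltW.
    by rewrite lef_pV2 ?posrE ?mulr_gt0 ?ltr_wpDl ?mulr_gt0// lerDr.
  by rewrite -[X in _ --> X](mulr0 (2 * L)^-1); apply: cvgMr.
- by rewrite -[X in _ --> X]mulr1; apply: cvgMr.
Qed.

End DifferenceQuotients.

(** * Fractional powers *)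

Section FractionalPower.
Context {R : realType}.
Variable s : R.
Hypotheses (s0 : 0 < s) (s1 : s < 1).
Implicit Types (x z d : R) (n : nat).

(* Up to normalisation, (1 + v) z / (1 + v z) with v = e^x.  Summing over x in
   d Z discretises z^s = c \int_0^oo v^(-s) z / (1 + v z) dv. *)
Definition dyad x z : R := expR (x * (1 - s)) * z / (1 + expR x * z).

Let den_gt0 x z : 0 <= z -> 0 < 1 + expR x * z.
Proof. by move=> z0; rewrite ltr_wpDr// mulr_ge0// expR_ge0. Qed.

Lemma dyad_ge0 x z : 0 <= z -> 0 <= dyad x z.
Proof.
by move=> z0; rewrite divr_ge0// ?(ltW (den_gt0 _ _))// mulr_ge0// expR_ge0.
Qed.

Lemma dyad_homo x z z' : 0 <= z -> z <= z' -> dyad x z <= dyad x z'.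
Proof.
move=> z0 zz; have z'0 := le_trans z0 zz.
rewrite ler_pdivrMr ?den_gt0// mulrAC ler_pdivlMr ?den_gt0//.
have : 0 <= expR (x * (1 - s)) * (z' - z) by rewrite mulr_ge0 ?expR_ge0 ?subr_ge0.
by lra.
Qed.

(** Geometric decay as x tends to - oo; the next bound gives it as x tends to + oo. Together they
    make the sum over d Z converge. *)
Lemma dyad_le1 x z : 0 <= z -> z <= 1 -> dyad x z <= expR (x * (1 - s)).
Proof.
move=> z0 z1; rewrite ler_pdivrMr ?den_gt0// ler_pM2l ?expR_gt0//.
by apply: le_trans z1 _; rewrite lerDl mulr_ge0 ?expR_ge0.
Qed.

Lemma dyad_le2 x z : 0 <= z -> dyad x z <= expR (- (x * s)).
Proof.
move=> z0; rewrite ler_pdivrMr ?den_gt0// [leRHS]mulrDr [_ * (_ * z)]mulrA -expRD mulr1.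
have -> : - (x * s) + x = x * (1 - s) by ring.
by rewrite lerDr expR_ge0.
Qed.

(** Multiplying z by e^d moves the lattice d Z onto itself up to the factor e^(s d), the same factor
    as for z^s. *)
Lemma dyad_shift x d z : dyad x (expR d * z) = expR (s * d) * dyad (x + d) z.
Proof.
rewrite /dyad !mulrA -!expRD.
by congr (expR _ * _ / _); ring.
Qed.

(** The indices run over - n, ..., n - 1, each lattice point once. *)
Definition dyadic_sum d n z : R :=
  \sum_(k < n) (dyad (k%:R * d) z + dyad (- k.+1%:R * d) z).

Lemma dyadic_sum_ge0 d n z : 0 <= z -> 0 <= dyadic_sum d n z.
Proof. by move=> z0; apply: sumr_ge0 => k _; rewrite addr_ge0 ?dyad_ge0. Qed.

Lemma dyadic_sum_homo d n z z' : 0 <= z -> z <= z' -> dyadic_sum d n z <= dyadic_sum d n z'.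
Proof. by move=> z0 zz; apply: ler_sum => k _; rewrite lerD ?dyad_homo. Qed.

(** The shift gains the lattice point n and loses the point - n. *)
Lemma dyadic_sum_shift d n z :
  dyadic_sum d n (expR d * z) =
  expR (s * d) * (dyadic_sum d n z + dyad (n%:R * d) z - dyad (- n%:R * d) z).
Proof.
rewrite /dyadic_sum; elim: n => [|n IH].
  by rewrite !big_ord0 oppr0 addrK mulr0.
rewrite !big_ord_recr /= IH !dyad_shift.
have -> : n%:R * d + d = n.+1%:R * d by rewrite -natr1; ring.
have -> : - n.+1%:R * d + d = - n%:R * d by rewrite -natr1; ring.
by ring.
Qed.

Section FixedStep.
Variable d : R.
Hypothesis d0 : 0 < d.

Let expn_lt1 c : 0 < c -> expR (- (d * c)) < 1.
Proof. by move=> c0; rewrite -expR0 ltr_expR oppr_lt0 mulr_gt0. Qed.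

Let expnE c n : expR (- (d * c)) ^+ n = expR (- n%:R * d * c).
Proof. by rewrite -expRM_natl; congr expR; ring. Qed.

Let expn_cvg c : 0 < c -> expR (- n%:R * d * c) @[n --> \oo] --> (0 : R).
Proof.
move=> c0; under eq_fun do rewrite -expnE.
by apply: cvg_expr; rewrite ger0_norm ?expR_ge0// expn_lt1.
Qed.

Let geo_sum_le c n : 0 < c ->
  \sum_(k < n) expR (- k%:R * d * c) <= (1 - expR (- (d * c)))^-1.
Proof.
move=> c0; under eq_bigr do rewrite -expnE.
have l1 : 0 < 1 - expR (- (d * c)) by rewrite subr_gt0 expn_lt1.
rewrite -[leRHS]mul1r ler_pdivlMr// mulrC -opprB mulNr -subrX1 opprB.
by rewrite gerBl exprn_ge0// expR_ge0.
Qed.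

Let os0 : 0 < 1 - s. Proof. by rewrite subr_gt0. Qed.

Lemma dyadic_sum_le n z : 0 <= z -> z <= 1 -> dyadic_sum d n z <=
  (1 - expR (- (d * s)))^-1 + (1 - expR (- (d * (1 - s))))^-1.
Proof.
move=> z0 z1; rewrite /dyadic_sum big_split /=; apply: lerD.
  apply: le_trans (geo_sum_le n s0); apply: ler_sum => k _.
  by apply: le_trans (dyad_le2 _ z0) _; rewrite !mulNr.
apply: le_trans (geo_sum_le n os0); apply: ler_sum => k _.
apply: le_trans (dyad_le1 _ z0 z1) _; rewrite ler_expR !mulNr lerN2.
by apply: ler_wpM2r; [exact: ltW|apply: ler_wpM2r; [exact: ltW|rewrite ler_nat]].
Qed.

Definition dyadic_series z : R := limn (dyadic_sum d ^~ z).

Lemma dyadic_series_cvg z : 0 <= z -> z <= 1 ->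
  dyadic_sum d n z @[n --> \oo] --> dyadic_series z.
Proof.
move=> z0 z1; apply: nondecreasing_is_cvgn.
  apply/nondecreasing_seqP => n; rewrite /dyadic_sum big_ord_recr /=.
  by rewrite lerDl addr_ge0 ?dyad_ge0.
by exists ((1 - expR (- (d * s)))^-1 + (1 - expR (- (d * (1 - s))))^-1) => _ [n _ <-];
  exact: dyadic_sum_le.
Qed.

Lemma dyadic_series_ge0 z : 0 <= z -> z <= 1 -> 0 <= dyadic_series z.
Proof.
move=> z0 z1; apply: (ler_cvg_to (cvg_cst 0) (dyadic_series_cvg z0 z1)).
by apply: nearW => n; exact: dyadic_sum_ge0.
Qed.

Lemma dyadic_series_homo z z' : 0 <= z -> z <= z' -> z' <= 1 ->
  dyadic_series z <= dyadic_series z'.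
Proof.
move=> z0 zz z'1.
apply: (ler_cvg_to (dyadic_series_cvg z0 (le_trans zz z'1))
  (dyadic_series_cvg (le_trans z0 zz) z'1)).
by apply: nearW => n; exact: dyadic_sum_homo.
Qed.

Lemma dyadic_series1_gt0 : 0 < dyadic_series 1.
Proof.
apply: (@lt_le_trans _ _ (dyadic_sum d 1 1)).
  rewrite /dyadic_sum big_ord1 ltr_pwDl ?dyad_ge0// /dyad mul0r expR0.
  by rewrite mul0r expR0 !mul1r invr_gt0.
apply: (ler_cvg_to (cvg_cst _) (dyadic_series_cvg ler01 (lexx 1))).
exists 1%N => // n /= n1; rewrite /dyadic_sum -(subnKC n1) big_split_ord /= lerDl.
by apply: sumr_ge0 => k _; rewrite addr_ge0 ?dyad_ge0.
Qed.

Lemma dyadic_series_shift z : 0 <= z -> expR d * z <= 1 ->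
  dyadic_series (expR d * z) = expR (s * d) * dyadic_series z.
Proof.
move=> z0 z1.
have ez0 : 0 <= expR d * z by rewrite mulr_ge0// expR_ge0.
have zz : z <= 1.
  apply: le_trans z1; rewrite ler_peMl//.
  by apply: le_trans (expR_ge1Dx _); rewrite lerDl ltW.
have c1 := dyadic_series_cvg ez0 z1.
have c2 : expR (s * d) * (dyadic_sum d n z + dyad (n%:R * d) z - dyad (- n%:R * d) z)
    @[n --> \oo] --> expR (s * d) * dyadic_series z.
  apply: cvgMr; rewrite -[X in _ --> X]addr0 -[X in _ --> X]subr0.
  apply: cvgB; first apply: cvgD; first exact: dyadic_series_cvg.
    apply: (@squeeze0 _ _ (fun n => expR (- n%:R * d * s))) => [n|]; last exact: expn_cvg.
    by rewrite dyad_ge0//=; apply: le_trans (dyad_le2 _ z0) _; rewrite !mulNr.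
  apply: (@squeeze0 _ _ (fun n => expR (- n%:R * d * (1 - s)))) => [n|]; last exact: expn_cvg.
  by rewrite dyad_ge0//= dyad_le1.
move: c1; under eq_fun do rewrite dyadic_sum_shift.
by move=> c1; exact: (cvg_unique (@Rhausdorff R) c1 c2).
Qed.

(** The series and z^s obey the same relation under multiplication of z by e^d, so it suffices to
    compare them for z in [e^(-d), 1]. There monotonicity puts both, divided by their values at 1,
    between e^(-s d) and 1. The normalising integral is thus never computed. *)
Lemma dyadic_series_power z : 0 <= z -> z <= 1 ->
  z `^ s * expR (- (s * d)) <= dyadic_series z / dyadic_series 1 <=
  z `^ s * expR (s * d).
Proof.
have G1 := dyadic_series1_gt0.
have ed : expR d * expR (- d) = 1 by rewrite -expRD subrr expR0.
have e1 : expR (- d) <= 1 by rewrite -expR0 ler_expR oppr_le0 ltW.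
have Ge : dyadic_series (expR (- d)) = expR (- (s * d)) * dyadic_series 1.
  have := @dyadic_series_shift (expR (- d)) (expR_ge0 _); rewrite ed => /(_ (lexx _)) ->.
  by rewrite mulrA -expRD addNr expR0 mul1r.
(* Induction on j with e^(- j d) <= z: one multiplication by e^d lowers j by 1. *)
suff H : forall (j : nat) z, 0 < z -> z <= 1 -> expR (- (j%:R * d)) <= z ->
    z `^ s * expR (- (s * d)) <= dyadic_series z / dyadic_series 1 <=
    z `^ s * expR (s * d).
  move=> z0 z1; move: z0; rewrite le_eqVlt => /predU1P[<-|z0].
    rewrite powR0 ?gt_eqF// !mul0r.
    have -> : dyadic_series 0 = 0.
      have := dyadic_series_cvg (lexx 0) ler01.
      rewrite (_ : dyadic_sum d ^~ 0 = fun=> 0).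
        by move=> H0; exact: (cvg_unique (@Rhausdorff R) H0 (cvg_cst 0)).
      apply/funext => n; rewrite /dyadic_sum big1// => k _.
      by rewrite /dyad !mulr0 !mul0r addr0.
    by rewrite mul0r lexx.
  have [j Hj] : exists j : nat, - ln z / d <= j%:R.
    have [N _ HN] := nbhs_infty_ger (- ln z / d).
    by exists N; exact: HN (leqnn N).
  apply: (H j) => //.
  rewrite -[leRHS]lnK ?posrE// ler_expR lerNl.
  by rewrite -ler_pdivrMr.
elim=> [|j IH] {}z z0 z1 zj.
  have -> : z = 1 by apply/eqP; rewrite eq_le z1; move: zj; rewrite mul0r oppr0 expR0.
  rewrite powR1 !mul1r divff ?gt_eqF//.
  have ge1 : 1 <= expR (s * d).
    by apply: le_trans (expR_ge1Dx _); rewrite lerDl mulr_ge0 ?ltW.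
  by rewrite expRN invf_le1 ?expR_gt0// ge1.
have [ez|ez] := leP (expR (- d)) z.
  apply/andP; split.
    rewrite ler_pdivlMr//; apply: (@le_trans _ _ (dyadic_series (expR (- d)))).
      rewrite Ge; apply: ler_wpM2r; first exact: ltW.
      rewrite ler_piMl ?expR_ge0//.
      have := ge0_ler_powR (ltW s0) _ _ z1; rewrite powR1; apply; rewrite nnegrE ?ler01//.
      exact: ltW.
    by apply: dyadic_series_homo; rewrite ?expR_ge0.
  rewrite ler_pdivrMr//; apply: (@le_trans _ _ (dyadic_series 1)).
    by apply: dyadic_series_homo => //; exact: ltW.
  rewrite ler_peMl ?(ltW G1)//.
  have : expR (- d) `^ s <= z `^ s.
    by apply: ge0_ler_powR => //; rewrite ?nnegrE ?expR_ge0 ?(ltW s0) ?(ltW z0).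
  rewrite -expRM mulNr (mulrC d) => H.
  apply: le_trans (ler_wpM2r (expR_ge0 (s * d)) H).
  by rewrite -expRD addNr expR0.
have z'1 : expR d * z <= 1.
  by rewrite -ed; apply: ler_wpM2l; [exact: expR_ge0|exact: ltW].
have z'0 : 0 < expR d * z by rewrite mulr_gt0// expR_gt0.
have := IH _ z'0 z'1; rewrite (dyadic_series_shift (ltW z0) z'1).
rewrite powRM ?expR_ge0 ?(ltW z0)// -expRM (mulrC d s) -!mulrA !ler_pM2l ?expR_gt0//.
apply; rewrite -ler_pdivrMl ?expR_gt0//.
apply: le_trans zj; rewrite -expRN -expRD ler_expR -natr1; lra.
Qed.

End FixedStep.

Lemma dyadic_series_power_cvg z : 0 <= z -> z <= 1 ->
  dyadic_series n.+1%:R^-1 z / dyadic_series n.+1%:R^-1 1 @[n --> \oo] --> z `^ s.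
Proof.
move=> z0 z1.
have hh : harmonic (n : nat) @[n --> \oo] --> (0 : R) by exact: cvg_harmonic.
have h1 (c : R) : z `^ s * expR (c * n.+1%:R^-1) @[n --> \oo] --> z `^ s.
  rewrite -[X in _ --> X]mulr1; apply: cvgMr; rewrite -[X in _ --> X]expR0.
  apply: continuous_cvg; first exact: continuous_expR.
  by rewrite -[X in _ --> X](mulr0 c); apply: cvgMr.
apply: (@squeeze_cvgr _ _ _ _ (fun n => z `^ s * expR (- s * n.+1%:R^-1))
  (fun n => z `^ s * expR (s * n.+1%:R^-1))) => //.
apply: nearW => n; rewrite mulNr; apply: dyadic_series_power => //.
Qed.

End FractionalPower.

(** * Multipliers *)

Section Multipliers.
Context {dX} {X : measurableType dX} {R : realType}.
Variable nu : {measure set X -> \bar R}.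
Context {dO} {Omega : measurableType dO}.
Variable E : set Omega -> (X -> R[i]) -> (X -> R[i]).
Hypothesis hE : spectral_measure nu E.
Implicit Types (f g h u : X -> R[i]).
Local Notation L2 := (Lp nu 2%:E).
Local Notation rin := (rin nu).
Local Notation fc := (fc nu E).
Local Notation rform := (rform nu E).

(** For fixed K these symbols form a convex set that contains 0 if K >= 0 and is stable under
    bounded pointwise limits on a carrier. A bound on the real part of the pairing suffices, since f
    may be rotated; it is symmetric in p and q. *)
Definition multiplier (p q K : R) (m : Omega -> R) : Prop :=
  bmeas m /\ forall f g, L2 f -> Lp nu p%:E f -> L2 g -> Lp nu q%:E g ->
    rform m f g <= K * (momr nu p f + momr nu q g).

Section FixedExponents.
Variables p q : R.

Lemma multiplier0 : multiplier p q 0 (cst 0).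
Proof.
split; first exact: bmeas_cst.
by move=> f g Lf _ Lg _; rewrite (rform_cst hE 0 Lf Lg) !mul0r.
Qed.

Lemma multiplier_lin (a K1 K2 : R) m1 m2 : 0 <= a -> multiplier p q K1 m1 ->
  multiplier p q K2 m2 -> multiplier p q (a * K1 + K2) (fun l => a * m1 l + m2 l).
Proof.
move=> a0 [b1 H1] [b2 H2]; split; first exact: bmeas_lin.
move=> f g Lf Lpf Lg Lqg; have [bl _] := blin_rform hE Lf Lg.
rewrite bl// mulrDl -mulrA; apply: lerD; last exact: H2.
by apply: ler_wpM2l => //; exact: H1.
Qed.

Lemma multiplier_sum n (c : nat -> R) K (m : nat -> Omega -> R) :
  (forall k, 0 <= c k) -> (forall k, multiplier p q K (m k)) ->
  multiplier p q ((\sum_(k < n) c k) * K) (fun l => \sum_(k < n) c k * m k l).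
Proof.
move=> c0 H; elim: n => [|n IH].
  by rewrite big_ord0 mul0r; under eq_fun do rewrite big_ord0; exact: multiplier0.
rewrite (_ : (fun l => _) = (fun l => c n * m n l + \sum_(k < n) c k * m k l)).
  rewrite big_ord_recr /= mulrDl addrC.
  exact: multiplier_lin.
by apply/funext => l; rewrite big_ord_recr /= [LHS]addrC.
Qed.

Lemma multiplier_lim D (M K : R) (m_ : nat -> Omega -> R) m : carrier nu E D ->
  (forall n, multiplier p q K (m_ n)) -> bmeas m -> (forall n l, D l -> `|m_ n l| <= M) ->
  (forall l, D l -> m_ n l @[n --> \oo] --> m l) -> multiplier p q K m.
Proof.
move=> cD H bm mM mm; split=> // f g Lf Lpf Lg Lqg.
have c := rform_cvg hE cD (fun n => proj1 (H n)) bm mM mm Lf Lg.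
apply: (ler_cvg_to c (cvg_cst _)).
by apply: nearW => n; have [_] := H n; apply.
Qed.

Lemma multiplier_swap K m : multiplier p q K m -> multiplier q p K m.
Proof.
move=> [bm H]; split=> // f g Lf Lpf Lg Lqg.
by rewrite (rformC hE bm Lf Lg) addrC; exact: H.
Qed.

Lemma multiplier_dual K m f : 1 < p -> q = p / (p - 1) -> 0 < K ->
  multiplier p q K m -> L2 f -> Lp nu p%:E f ->
  (mom nu p (fc m f) <= (dual_const p K)%:E * mom nu p f)%E.
Proof.
move=> p1 qE K0 [bm H] Lf Lpf; have p0 : 0 < p by exact: lt_trans p1.
rewrite -(EFin_momr p0 Lpf) -EFinM.
apply: (dual_bound p1 K0 (fc_L2 hE bm Lf) (momr_ge0 nu p f)) => g Lg Lqg.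
rewrite -qE in Lqg *; rewrite (fc_form hE bm Lf Lg).
by have := H f g Lf Lpf Lg Lqg; rewrite {2}momr.unlock.
Qed.

Section FractionalPowers.
Variable T : Omega -> R.
Hypothesis mT : measurable_fun setT T.
Hypothesis T0 : forall l, 0 <= T l.
Hypothesis T1 : forall l, T l <= 1.
Variable K : R.
Hypothesis multT : forall v, 0 <= v ->
  multiplier p q K (fun l => (1 + v) * T l / (1 + v * T l)).

(** The sums [dyadic_sum], divided by their values at 1, are convex combinations of the symbols (1 +
    v) T / (1 + v T) with v = e^x, so they keep the constant K. The number of terms tends to
    infinity first, then the step d to 0. *)
Lemma multiplier_powR s : 0 < s -> s < 1 -> multiplier p q K (fun l => T l `^ s).
Proof.
move=> s0 s1.
(* The coefficient [dyad s x 1] becomes the weight in the average; the other factor equals 1 at T =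
   1. *)
have dyadE x l : dyad s x (T l) =
    dyad s x 1 * ((1 + expR x) * T l / (1 + expR x * T l)).
  rewrite /dyad !mulr1; have := T0 l; move: (expR (x * _)) (expR x) (expR_gt0 x) => e' e e0 t0.
  have d1 : 0 < 1 + e by lra.
  have d2 : 0 < 1 + e * T l by rewrite ltr_wpDr// mulr_ge0// ltW.
  by field; rewrite !gt_eqF.
have multS d n : multiplier p q (dyadic_sum s d n 1 * K) (fun l => dyadic_sum s d n (T l)).
  pose c k := dyad s (k%:R * d) 1.
  pose c' (k : nat) := dyad s (- k.+1%:R * d) 1.
  have := multiplier_sum n (c := c) (K := K)
    (m := fun k l => (1 + expR (k%:R * d)) * T l / (1 + expR (k%:R * d) * T l))
    (fun k => dyad_ge0 _ _ ler01) (fun k => multT (expR_ge0 _)).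
  have := multiplier_sum n (c := c') (K := K)
    (m := fun k l => (1 + expR (- k.+1%:R * d)) * T l / (1 + expR (- k.+1%:R * d) * T l))
    (fun k => dyad_ge0 _ _ ler01) (fun k => multT (expR_ge0 _)).
  move=> h2 h1; have := multiplier_lin ler01 h1 h2; rewrite mul1r -mulrDl.
  rewrite (_ : _ + _ = dyadic_sum s d n 1); last by rewrite /dyadic_sum big_split.
  congr (multiplier _ _ _ _); apply/funext => l; rewrite mul1r /dyadic_sum big_split /=.
  by congr (_ + _); apply: eq_bigr => k _; rewrite dyadE.
have cT := carrier_setT hE.
have mpow r : measurable_fun setT (fun l => T l `^ r).
  exact: (measurableT_comp (measurable_powR r) mT).
have mS d n : measurable_fun setT (fun l => dyadic_sum s d n (T l)) by case: (multS d n) => -[].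
have bdG d l : 0 < d -> `|dyadic_series s d (T l) / dyadic_series s d 1| <= 1.
  move=> d0; have G1 := dyadic_series1_gt0 s0 s1 d0.
  have G0 := dyadic_series_ge0 s0 s1 d0 (T0 l) (T1 l).
  rewrite ger0_norm ?divr_ge0 ?(ltW G1)// ler_pdivrMr// mul1r.
  exact: dyadic_series_homo.
have multG d : 0 < d -> multiplier p q K (fun l => dyadic_series s d (T l) / dyadic_series s d 1).
  move=> d0; have G1 := dyadic_series1_gt0 s0 s1 d0.
  (* The index starts at 1: the empty sum is 0 and cannot normalise anything. *)
  have P1 n : 0 < dyadic_sum s d n.+1 1.
    rewrite /dyadic_sum big_ord_recl ltr_pwDl//.
      by rewrite ltr_wpDr ?dyad_ge0// /dyad !mulr1 divr_gt0 ?expR_gt0// ltr_wpDr// expR_ge0.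
    by apply: sumr_ge0 => k _; rewrite addr_ge0 ?dyad_ge0.
  have cv l : dyadic_sum s d n.+1 (T l) / dyadic_sum s d n.+1 1 @[n --> \oo] -->
      dyadic_series s d (T l) / dyadic_series s d 1.
    have c z : 0 <= z -> z <= 1 -> dyadic_sum s d n.+1 z @[n --> \oo] --> dyadic_series s d z.
      move=> z0 z1; exact: (subseq_cvg (u := fun n => dyadic_sum s d n z) (k := S)
        (fun n => leqnSn n) (dyadic_series_cvg s0 s1 d0 z0 z1)).
    by apply: cvgM; [exact: c|apply: cvgV; [rewrite gt_eqF|exact: c]].
  have bd n l : `|dyadic_sum s d n.+1 (T l) / dyadic_sum s d n.+1 1| <= 1.
    rewrite ger0_norm ?divr_ge0 ?dyadic_sum_ge0// ler_pdivrMr// mul1r.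
    exact: dyadic_sum_homo.
  apply: (@multiplier_lim setT 1 K
    (fun n l => dyadic_sum s d n.+1 (T l) / dyadic_sum s d n.+1 1)) => //.
    move=> n; have := multiplier_lin (a := (dyadic_sum s d n.+1 1)^-1) _ (multS d n.+1) multiplier0.
    rewrite addr0 mulrA mulVf ?gt_eqF// mul1r invr_ge0 (ltW (P1 n)) => /(_ isT).
    congr (multiplier _ _ _ _); apply/funext => l; rewrite addr0 mulrC//.
  split.
    apply: (measurable_fun_cvg (h := fun n l => dyadic_sum s d n.+1 (T l) / dyadic_sum s d n.+1 1)).
      by move=> n; exact: measurable_funM.
    by move=> l _; exact: cv.
  by exists 1 => l; exact: bdG.
apply: (@multiplier_lim setT 1 K
  (fun n l => dyadic_series s n.+1%:R^-1 (T l) / dyadic_series s n.+1%:R^-1 1)) => //.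
- by move=> n; apply: multG; rewrite invr_gt0.
- split; first exact: mpow.
  exists 1 => l; rewrite ger0_norm ?powR_ge0//.
  have := ge0_ler_powR (ltW s0) _ _ (T1 l); rewrite powR1; apply; rewrite nnegrE ?ler01//.
- by move=> n l _; apply: bdG; rewrite invr_gt0.
by move=> l _; exact: dyadic_series_power_cvg.
Qed.

End FractionalPowers.
End FixedExponents.
End Multipliers.

(** * Weighted ratios as multipliers *)

Section RatioMultipliers.
Context {dX} {X : measurableType dX} {R : realType}.
Variable nu : {measure set X -> \bar R}.
Context {dO} {Omega : measurableType dO}.
Variable E : set Omega -> (X -> R[i]) -> (X -> R[i]).
Hypothesis hE : spectral_measure nu E.
Implicit Types (f g h u : X -> R[i]).
Local Notation L2 := (Lp nu 2%:E).
Local Notation fc := (fc nu E).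

Variable I : finType.
Variable lam : I -> Omega -> R.
Hypothesis mlam : forall i, measurable_fun setT (lam i).
Hypothesis cD : carrier nu E [set l | forall i, 0 <= lam i l].
Hypothesis bT : forall i t, 0 < t -> bicontraction nu (fc (fun l => expind t (lam i l))).
Hypothesis momT : forall i t q f, 0 < t -> 1 <= q -> L2 f ->
  (mom nu q (fc (fun l => expind t (lam i l)) f) <= mom nu q f)%E.

(* This is 0 / 0 = 0 where all the [lam i] are non-positive. *)
Definition ratio (w : I -> R) r l : R :=
  w r * Num.max (lam r l) 0 / \sum_i w i * Num.max (lam i l) 0.

Let max0 x : 0 <= Num.max x (0 : R). Proof. by rewrite le_max lexx orbT. Qed.

Let term_ge0 (w : I -> R) i l : (forall i, 0 < w i) -> 0 <= w i * Num.max (lam i l) 0.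
Proof. by move=> w0; rewrite mulr_ge0// ltW. Qed.

Let sum_ge0 (w : I -> R) l : (forall i, 0 < w i) -> 0 <= \sum_i w i * Num.max (lam i l) 0.
Proof. by move=> w0; apply: sumr_ge0 => i _; exact: term_ge0. Qed.

Let term_le (w : I -> R) r l : (forall i, 0 < w i) ->
  w r * Num.max (lam r l) 0 <= \sum_i w i * Num.max (lam i l) 0.
Proof.
move=> w0; rewrite (bigD1 r)//= lerDl.
by apply: sumr_ge0 => i _; exact: term_ge0.
Qed.

Lemma ratio_ge0 w r l : (forall i, 0 < w i) -> 0 <= ratio w r l.
Proof. by move=> w0; rewrite divr_ge0 ?sum_ge0 ?term_ge0. Qed.

Lemma ratio_le1 w r l : (forall i, 0 < w i) -> ratio w r l <= 1.
Proof.
move=> w0; rewrite /ratio; have := term_le r l w0; have := sum_ge0 l w0.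
move: (\sum_i _) => S; rewrite le_eqVlt => /predU1P[<- _|S0 H].
  by rewrite invr0 mulr0.
by rewrite ler_pdivrMr// mul1r.
Qed.

Lemma bmeas_ratio w r : (forall i, 0 < w i) -> bmeas (ratio w r).
Proof.
move=> w0; split; last by exists 1 => l; rewrite ger0_norm ?ratio_ge0 ?ratio_le1.
have mi i : measurable_fun setT (fun l => w i * Num.max (lam i l) 0).
  by apply: measurable_funM => //; exact: measurable_maxr.
apply: measurable_funM => //; apply: measurable_funV_ge0 => [|l]; last exact: sum_ge0.
exact: measurable_sum.
Qed.

Lemma multiplier_ratio p q w r : 1 < p -> p <= 2 -> q = p / (p - 1) ->
  (forall i, 0 < w i) -> multiplier nu E p q (2 / (p - 1) + 3) (ratio w r).
Proof.
move=> p1 p2 qE w0.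
(* Running the i-th semigroup for time w_i / (n+1) gives its coordinate the weight w_i. *)
pose t n i := w i * n.+1%:R^-1 : R.
have t0 n i : 0 < t n i by rewrite mulr_gt0// invr_gt0.
pose M n l := \sum_(k < n.+1 ^ 2) (1 - expind (t n r) (lam r l) ^+ 2) *
     ((\prod_i expind (t n i) (lam i l)) ^+ k) ^+ 2.
have bx n i : bmeas (fun l => expind (t n i) (lam i l)).
  by apply: (bmeas_expind mlam); exact: ltW.
have bM n : bmeas (M n).
  have bc : bmeas (fun l => 1 - expind (t n r) (lam r l) ^+ 2).
    rewrite (_ : (fun l => _) = (fun l => -1 * expind (t n r) (lam r l) ^+ 2 + cst (1 : R) l)).
      exact: (bmeas_lin (-1) (bmeasX 2 (bx n r)) (bmeas_cst 1)).
    by apply/funext => l /=; rewrite mulN1r addrC.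
  apply: (@bmeas_sum _ _ _ _ (fun k l => (1 - expind (t n r) (lam r l) ^+ 2) *
     ((\prod_i expind (t n i) (lam i l)) ^+ k) ^+ 2)) => k.
  apply: bmeasM => //; apply: bmeasX; apply: bmeasX.
  exact: (bmeas_prod (F := fun i l => expind (t n i) (lam i l)) (bx n)).
have ME n l : (forall i, 0 <= lam i l) ->
    M n l = quotient_sum n.+1%:R^-1 (n.+1 ^ 2) (w r * lam r l) (\sum_i w i * lam i l).
  move=> l0; rewrite /M /quotient_sum; apply: eq_bigr => k _.
  have xE i : expind (t n i) (lam i l) = expR (- (n.+1%:R^-1 * (w i * lam i l))).
    by rewrite /expind posindE l0 mulr1; congr expR; rewrite /t; ring.
  rewrite xE; congr (_ * (_ ^+ _) ^+ _).
  under eq_bigr do rewrite xE.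
  by rewrite -expR_sum sumrN mulr_sumr.
have pl x : 0 <= x -> Num.max x 0 = x :> R by move=> x0; rewrite max_l.
have ale l : (forall i, 0 <= lam i l) -> w r * lam r l <= \sum_i w i * lam i l.
  move=> l0; rewrite (bigD1 r)//= lerDl.
  by apply: sumr_ge0 => i _; rewrite mulr_ge0// ltW.
apply: (@multiplier_lim _ _ _ _ _ _ _ hE p q _ 1 _ M _ cD _ (bmeas_ratio r w0)).
- move=> n; split=> // f g Lf Lpf Lg Lqg.
  have := energy_sum hE mlam bT momT p1 p2 qE Lf Lg Lpf Lqg r (n.+1 ^ 2) (t0 n).
  (* One coefficient for both moments: 2 / (p - 1) + 3 exceeds 2 / (p - 1) + 1 as well as 2. *)
  move/le_trans; apply.
  have := momr_ge0 nu p f; have := momr_ge0 nu q g.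
  have k0 : 0 < 2 / (p - 1) by rewrite divr_gt0// subr_gt0.
  by move: (momr _ _ _) (momr _ _ _) (2 / (p - 1)) k0 => a b c; nra.
- move=> n l /= l0; rewrite ME//.
  have n0 : 0 <= n.+1%:R^-1 :> R by rewrite invr_ge0.
  have a0 : 0 <= w r * lam r l by rewrite mulr_ge0// ltW.
  rewrite ger0_norm; last exact: quotient_sum_ge0.
  by apply: quotient_sum_le1 => //; exact: ale.
move=> l /= l0; rewrite (funext (fun n => ME n l l0)).
have -> : ratio w r l = w r * lam r l / \sum_i w i * lam i l.
  by rewrite /ratio pl//; congr (_ / _); apply: eq_bigr => i _; rewrite pl.
by apply: quotient_sum_cvg; [rewrite mulr_ge0// ltW|exact: ale].
Qed.

Lemma ratio_boost r v l : 0 <= v ->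
  (1 + v) * ratio (fun=> 1) r l / (1 + v * ratio (fun=> 1) r l) =
  ratio (fun i => if i == r then 1 + v else 1) r l.
Proof.
move=> v0; rewrite /ratio eqxx mul1r.
have -> : \sum_i (if i == r then 1 + v else 1) * Num.max (lam i l) 0 =
    \sum_i 1 * Num.max (lam i l) 0 + v * Num.max (lam r l) 0.
  rewrite (bigD1 r)//= eqxx [X in _ = X + _](bigD1 r)//=.
  rewrite (eq_bigr (fun i => 1 * Num.max (lam i l) 0)) => [|i /negPf ->//].
  by move: (\sum_(i | _) _) => S; ring.
have w1 (i : I) : 0 < (fun=> 1 : R) i by exact: ltr01.
have := term_le r l w1; have := sum_ge0 l w1; rewrite mul1r.
have := max0 (lam r l); move: (Num.max (lam r l) 0) (\sum_i _) => a S a0.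
rewrite le_eqVlt => /predU1P[<-|S0] aS.
  (* If the sum of the positive parts is 0, both sides are 0. *)
  have -> : a = 0 by apply/eqP; rewrite eq_le a0 aS.
  by rewrite !(mulr0, mul0r).
have va : 0 <= v * a by exact: mulr_ge0.
by field; rewrite !gt_eqF//= ltr_wpDr.
Qed.

Lemma multiplier_ratio_powR p q r s : 1 < p -> p <= 2 -> q = p / (p - 1) -> 0 < s -> s < 1 ->
  multiplier nu E p q (2 / (p - 1) + 3) (fun l => ratio (fun=> 1) r l `^ s).
Proof.
move=> p1 p2 qE s0 s1.
have w1 (i : I) : 0 < 1 :> R by exact: ltr01.
have [mr _] := bmeas_ratio r w1.
apply: (multiplier_powR hE mr) => // [l|l|v v0].
- exact: ratio_ge0.
- exact: ratio_le1.
rewrite (funext (fun l => ratio_boost r l v0)).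
apply: multiplier_ratio => // i; case: ifP => // _.
by rewrite ltr_wpDr.
Qed.

End RatioMultipliers.

(** * Extension to Lp *)

Section RealMoments.
Context {dX} {X : measurableType dX} {R : realType}.
Variable nu : {measure set X -> \bar R}.
Variable p : R.
Hypothesis p0 : 0 < p.
Implicit Types (f g h : X -> R[i]).
Local Notation Lp := (Lp nu p%:E).
Local Notation momr := (momr nu p).

Lemma momrD f g : Lp f -> Lp g -> momr (fun x => f x + g x) <= 2 `^ p * (momr f + momr g).
Proof.
move=> Lf Lg; rewrite -lee_fin EFinM EFinD (EFin_momr p0 Lf) (EFin_momr p0 Lg).
rewrite (EFin_momr p0 (Lp_add p0 Lf Lg)).
exact: (momD nu (ltW p0) (proj1 Lf) (proj1 Lg)).
Qed.

Lemma momrZ a f : Lp f -> momr (fun x => a * f x) = normc a `^ p * momr f.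
Proof.
move=> Lf; apply: EFin_inj; rewrite EFinM (EFin_momr p0 Lf) (EFin_momr p0 (Lp_scale a p0 Lf)).
exact: (momZ nu p a (proj1 Lf)).
Qed.

Lemma momr_ae f g : Lp f -> Lp g -> (\forall x \ae nu, f x = g x) -> momr f = momr g.
Proof.
by move=> Lf Lg fg; rewrite momr.unlock (mom_ae p (proj1 Lf) (proj1 Lg) fg).
Qed.

Lemma momr_subC f g : momr (fun x => f x - g x) = momr (fun x => g x - f x).
Proof. by rewrite momr.unlock mom_subC. Qed.

Lemma momr_eq0 f : Lp f -> momr f = 0 -> \forall x \ae nu, f x = 0.
Proof.
move=> Lf f0; apply: (mom_eq0 p0 (proj1 Lf)).
by rewrite -(EFin_momr p0 Lf) f0.
Qed.

Lemma momr_trans f g h : Lp f -> Lp g -> Lp h ->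
  momr (fun x => f x - h x) <=
  2 `^ p * (momr (fun x => f x - g x) + momr (fun x => g x - h x)).
Proof.
move=> Lf Lg Lh; have -> : (fun x => f x - h x) = (fun x => (f x - g x) + (g x - h x)).
  by apply/funext => x; rewrite addrA subrK.
by apply: momrD; exact: Lp_sub.
Qed.

Lemma momr_lim_unique (u : nat -> X -> R[i]) f g : (forall n, Lp (u n)) -> Lp f -> Lp g ->
  momr (fun x => u n x - f x) @[n --> \oo] --> 0 ->
  momr (fun x => u n x - g x) @[n --> \oo] --> 0 -> \forall x \ae nu, f x = g x.
Proof.
move=> Lu Lf Lg uf ug; have Lfg := Lp_sub p0 Lf Lg.
have : momr (fun x => f x - g x) = 0.
  apply/eqP; rewrite eq_le momr_ge0 andbT.
  have c : 2 `^ p * (momr (fun x => u n x - f x) + momr (fun x => u n x - g x))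
      @[n --> \oo] --> (0 : R).
    rewrite -[X in _ --> X](mulr0 (2 `^ p)); apply: cvgMr.
    by rewrite -[X in _ --> X]addr0; apply: cvgD.
  apply: (ler_cvg_to (cvg_cst _) c); apply: nearW => n.
  by rewrite (momr_subC (u n) f); exact: momr_trans.
move/(momr_eq0 Lfg); apply: filterS => x /eqP; rewrite subr_eq0.
by move/eqP.
Qed.

(* The factor 2^p comes from the quasi-triangle inequality [momrD]. *)
Lemma momr_lim_le (u : nat -> X -> R[i]) f M : (forall n, Lp (u n)) -> Lp f ->
  momr (fun x => u n x - f x) @[n --> \oo] --> 0 -> (forall n, momr (u n) <= M) ->
  momr f <= 2 `^ p * M.
Proof.
move=> Lu Lf uf uM.
have c : 2 `^ p * (momr (fun x => u n x - f x) + M) @[n --> \oo] --> 2 `^ p * M.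
  apply: cvgMr; rewrite -[X in _ --> X]add0r.
  by apply: cvgD => //; exact: cvg_cst.
apply: (ler_cvg_to (cvg_cst _) c); apply: nearW => n.
have := momrD (Lp_sub p0 Lf (Lu n)) (Lu n).
rewrite (_ : (fun x => f x - u n x + u n x) = f); last by apply/funext => x; rewrite subrK.
move/le_trans; apply; apply: ler_wpM2l; first exact: powR_ge0.
by rewrite momr_subC; apply: lerD.
Qed.

(** Truncations of f, chosen at the rate that [Lp_complete] asks for. *)
Lemma Lp_dense_seq f : Lp f -> exists v : nat -> X -> R[i],
  [/\ forall n, Lp (v n), forall n, Defs.Lp nu 2%:E (v n),
      forall n, momr (v n) <= momr f &
      forall n, momr (fun x => v n x - f x) <= (2 * 2 `^ p) ^- n].
Proof.
move=> Lf; have e0 n : 0 < (2 * 2 `^ p) ^- n :> R.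
  by rewrite invr_gt0 exprn_gt0// mulr_gt0// powR_gt0.
have H n := cid (Lp_dense p0 (ltr0n R 2) (e0 n) Lf).
exists (fun n => projT1 (H n)); split => n; have [L1 L2 L3 L4] := projT2 (H n) => //.
  rewrite -lee_fin (EFin_momr p0 L1) (EFin_momr p0 Lf).
  by apply: (mom_le (ltW p0) (proj1 L1) (proj1 Lf)); exact: aeW.
by rewrite -lee_fin (EFin_momr p0 (Lp_sub p0 L1 Lf)).
Qed.

Lemma geometric_cvg0 : (2 * 2 `^ p) ^- n @[n --> \oo] --> (0 : R).
Proof.
under eq_fun do rewrite -exprVn.
have h : 1 < 2 * 2 `^ p :> R.
  have : 1 <= 2 `^ p :> R by rewrite -[leLHS](powRr0 2) ler_powR ?ler1n// ltW.
  lra.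
apply: cvg_expr; rewrite ger0_norm ?invr_ge0 ?invf_lt1//; lra.
Qed.

End RealMoments.

(** * Extension by continuity from the intersection with L^2 *)

Section Extension.
Context {dX} {X : measurableType dX} {R : realType}.
Variable nu : {measure set X -> \bar R}.
Variable p : R.
Hypothesis p0 : 0 < p.
Implicit Types (f g h : X -> R[i]).
Local Notation Lp := (Lp nu p%:E).
Local Notation L2 := (Defs.Lp nu 2%:E).
Local Notation momr := (momr nu p).

Variable A : (X -> R[i]) -> (X -> R[i]).
Variable B : R.
Hypothesis B0 : 0 <= B.
Hypothesis ALp : forall f, L2 f -> Lp f -> Lp (A f).
Hypothesis Alin : forall (a : R[i]) f g, L2 f -> L2 g ->
  \forall x \ae nu, A (fun x => a * f x + g x) x = a * A f x + A g x.
Hypothesis Abound : forall f, L2 f -> Lp f -> momr (A f) <= B * momr f.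

Let two_gt0 : 0 < 2 :> R. Proof. by []. Qed.
Let pp0 : 0 <= 2 `^ p :> R. Proof. exact: powR_ge0. Qed.
Let K := 2 `^ p * (2 `^ p * B).
Let K0 : 0 <= K. Proof. by rewrite !mulr_ge0. Qed.

Let Asub f g : L2 f -> Lp f -> L2 g -> Lp g ->
  momr (fun x => A f x - A g x) <= B * momr (fun x => f x - g x).
Proof.
move=> L2f Lf L2g Lg.
have L2s := Lp_sub two_gt0 L2f L2g; have Ls := Lp_sub p0 Lf Lg.
apply: le_trans (Abound L2s Ls); rewrite le_eqVlt; apply/orP; left; apply/eqP.
apply: momr_ae => //; first by apply: Lp_sub => //; exact: ALp.
  exact: ALp.
have := Alin (-1) L2g L2f; apply: filterS => x.
rewrite (_ : (fun x => -1 * g x + f x) = (fun x => f x - g x)).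
  by move=> ->; rewrite mulN1r addrC.
by apply/funext => y; rewrite mulN1r addrC.
Qed.

(** The value at f is characterised by its distance to A v for all v in the intersection, and so
    does not refer to an approximating sequence. The constant K carries two factors 2^p, from the
    two uses of the quasi-triangle inequality in the construction of h. *)
Definition extends_at f h := Lp h /\ forall v, L2 v -> Lp v ->
  momr (fun x => A v x - h x) <= K * momr (fun x => v x - f x).

Lemma extends_at_ex f : Lp f -> exists h, extends_at f h.
Proof.
move=> Lf; have [v [Lv L2v vle vf]] := Lp_dense_seq p0 Lf.
have LAv n : Lp (A (v n)) by exact: ALp.
have c0 n : 0 <= (2 * 2 `^ p) ^- n :> R by rewrite invr_ge0 exprn_ge0// mulr_ge0.
have c1 : 1 <= 2 * 2 `^ p :> R.
  have : 1 <= 2 `^ p :> R by rewrite -[leLHS](powRr0 2) ler_powR ?ler1n// ltW.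
  lra.
have c2 : 1 <= 2 `^ p :> R by rewrite -[leLHS](powRr0 2) ler_powR ?ler1n// ltW.
have cdec n m : (n <= m)%N -> (2 * 2 `^ p) ^- m <= (2 * 2 `^ p) ^- n :> R.
  move=> nm; rewrite lef_pV2 ?posrE ?exprn_gt0 ?(lt_le_trans _ c1)//.
  exact: ler_weXn2l.
have ucauchy n m : (n <= m)%N -> (mom nu p (fun x => A (v m) x - A (v n) x)%R <=
    (2 * K * (2 * 2 `^ p) ^- n)%:E)%E.
  move=> nm; rewrite -(EFin_momr p0 (Lp_sub p0 (LAv m) (LAv n))) lee_fin.
  apply: le_trans (Asub (L2v m) (Lv m) (L2v n) (Lv n)) _.
  have := momr_trans p0 (Lv m) Lf (Lv n); rewrite (momr_subC nu p f (v n)).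
  have := vf n; have := vf m; have := cdec _ _ nm.
  rewrite /K; move: (momr _) (momr _) (momr _) (_ ^- m) (_ ^- n) (c0 n) => x y z cm cn cn0 h1 h2 h3 h4.
  have h5 : B * x <= B * (2 `^ p * (2 * cn)).
    by apply: ler_wpM2l => //; apply: le_trans h4 _; apply: ler_wpM2l => //; lra.
  apply: le_trans h5 _.
  have : 0 <= (2 `^ p - 1) * (2 `^ p * B * cn).
    by rewrite mulr_ge0 ?subr_ge0 ?mulr_ge0.
  lra.
have [h Lh [_ hc]] := Lp_complete p0 LAv ucauchy.
exists h; split=> // w L2w Lw.
(* This bounds the distance from A w to h through the n-th approximation; it tends to K times the
   distance from w to f. *)
have c : 2 `^ p * (B * (2 `^ p * (momr (fun x => w x - f x) + (2 * 2 `^ p) ^- n)) +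
    2 * K * (2 * 2 `^ p) ^- n) @[n --> \oo] -->
    2 `^ p * (B * (2 `^ p * (momr (fun x => w x - f x) + 0)) + 2 * K * 0).
  have g := geometric_cvg0 p0; apply: cvgMr; apply: cvgD.
    by apply: cvgMr; apply: cvgMr; apply: cvgD => //; exact: cvg_cst.
  exact: cvgMr.
move: c; rewrite addr0 mulr0 addr0.
have -> : 2 `^ p * (B * (2 `^ p * momr (fun x => w x - f x))) =
    K * momr (fun x => w x - f x) by rewrite /K; ring.
move=> c; apply: (ler_cvg_to (cvg_cst _) c); apply: nearW => n.
apply: le_trans (momr_trans p0 (ALp L2w Lw) (LAv n) Lh) _.
apply: ler_wpM2l => //; apply: lerD.
  apply: le_trans (Asub L2w Lw (L2v n) (Lv n)) _; apply: ler_wpM2l => //.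
  apply: le_trans (momr_trans p0 Lw Lf (Lv n)) _; apply: ler_wpM2l => //.
  by apply: lerD => //; rewrite momr_subC.
by rewrite -lee_fin (EFin_momr p0 (Lp_sub p0 (LAv n) Lh)).
Qed.

Definition extension : operator X R :=
  Operator Lp (fun f => xget (fun=> 0) (extends_at f)).

Lemma extensionP f : Lp f -> extends_at f (extension f).
Proof. by move=> Lf; exact: (xgetPex (fun=> 0) (extends_at_ex Lf)). Qed.

Lemma extension_cvg f (v : nat -> X -> R[i]) : Lp f -> (forall n, L2 (v n)) ->
  (forall n, Lp (v n)) -> momr (fun x => v n x - f x) @[n --> \oo] --> 0 ->
  momr (fun x => A (v n) x - extension f x) @[n --> \oo] --> 0.
Proof.
move=> Lf L2v Lv vf; have [Lh H] := extensionP Lf.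
apply: (@squeeze0 _ _ (fun n => K * momr (fun x => v n x - f x))) => [n|].
  by rewrite momr_ge0 H.
by rewrite -[X in _ --> X](mulr0 K); apply: cvgMr.
Qed.

Let dense_cvg f (v : nat -> X -> R[i]) :
  (forall n, momr (fun x => v n x - f x) <= (2 * 2 `^ p) ^- n) ->
  momr (fun x => v n x - f x) @[n --> \oo] --> 0.
Proof.
move=> H; apply: (@squeeze0 _ _ (fun n => (2 * 2 `^ p) ^- n)) => [n|].
  by rewrite momr_ge0 H.
exact: geometric_cvg0.
Qed.

Lemma extension_eq f : L2 f -> Lp f -> \forall x \ae nu, extension f x = A f x.
Proof.
move=> L2f Lf; have [Lh H] := extensionP Lf.
apply: (momr_lim_unique p0 (u := fun=> A f) _ Lh (ALp L2f Lf)).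
- by move=> n; exact: ALp.
- have := extension_cvg Lf (fun=> L2f) (fun=> Lf); apply.
  apply: (dense_cvg (v := fun=> f)) => n.
  rewrite (_ : (fun x => f x - f x) = (fun=> 0)).
    by rewrite momr.unlock mom0// invr_ge0 exprn_ge0// mulr_ge0.
  by apply/funext => x; rewrite subrr.
- rewrite (_ : (fun x => A f x - A f x) = (fun=> 0)).
    by rewrite momr.unlock mom0//; exact: cvg_cst.
  by apply/funext => x; rewrite subrr.
Qed.

Lemma extension_ae f g : Lp f -> cmeasurable g -> (\forall x \ae nu, f x = g x) ->
  Lp g /\ \forall x \ae nu, extension f x = extension g x.
Proof.
move=> Lf mg fg; have Lg := Lp_ae p0 Lf mg fg; split => //.
have [v [Lv L2v _ vf]] := Lp_dense_seq p0 Lf.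
have vf0 := dense_cvg vf.
have LAv n : Lp (A (v n)) by exact: ALp.
have [Lh _] := extensionP Lf; have [Lh' _] := extensionP Lg.
apply: (momr_lim_unique p0 LAv Lh Lh'); first exact: extension_cvg.
apply: extension_cvg => //.
move: vf0; rewrite (_ : (fun n => momr _) = (fun n => momr (fun x => v n x - g x)))//.
apply/funext => n; apply: momr_ae => //; try exact: Lp_sub.
by apply: filterS fg => x ->.
Qed.

Lemma extension_lin (a : R[i]) f g : Lp f -> Lp g ->
  \forall x \ae nu, extension (fun x => a * f x + g x) x = a * extension f x + extension g x.
Proof.
move=> Lf Lg.
have [v [Lv L2v _ /dense_cvg vf]] := Lp_dense_seq p0 Lf.
have [w [Lw L2w _ /dense_cvg wg]] := Lp_dense_seq p0 Lg.
have Lag : Lp (fun x => a * f x + g x) by apply: Lp_add => //; exact: Lp_scale.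
have L2u n : L2 (fun x => a * v n x + w n x) by apply: Lp_add => //; exact: Lp_scale.
have Lu n : Lp (fun x => a * v n x + w n x) by apply: Lp_add => //; exact: Lp_scale.
have [Lh _] := extensionP Lag; have [Lf' _] := extensionP Lf; have [Lg' _] := extensionP Lg.
have LAu n : Lp (A (fun x => a * v n x + w n x)) by exact: ALp.
have lin_cvg (v' w' : nat -> X -> R[i]) f' g' : (forall n, Lp (v' n)) -> (forall n, Lp (w' n)) ->
    Lp f' -> Lp g' -> momr (fun x => v' n x - f' x) @[n --> \oo] --> 0 ->
    momr (fun x => w' n x - g' x) @[n --> \oo] --> 0 ->
    momr (fun x => (a * v' n x + w' n x) - (a * f' x + g' x)) @[n --> \oo] --> 0.
  move=> Lv' Lw' Lf1 Lg1 c1 c2.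
  apply: (@squeeze0 _ _ (fun n => 2 `^ p * (normc a `^ p * momr (fun x => v' n x - f' x) +
    momr (fun x => w' n x - g' x)))) => [n|].
    rewrite momr_ge0/=.
    rewrite (_ : (fun x => _ - _) = (fun x => a * (v' n x - f' x) + (w' n x - g' x))).
      have L1 := Lp_sub p0 (Lv' n) Lf1; have L3 := Lp_sub p0 (Lw' n) Lg1.
      by have := momrD p0 (Lp_scale a p0 L1) L3; rewrite (momrZ p0 a L1).
    by apply/funext => x; rewrite mulrBr opprD addrACA.
  rewrite -[X in _ --> X](mulr0 (2 `^ p)); apply: cvgMr.
  rewrite -[X in _ --> X](addr0 0); apply: cvgD => //.
  by rewrite -[X in _ --> X](mulr0 (normc a `^ p)); apply: cvgMr.
apply: (momr_lim_unique p0 LAu Lh); first by apply: Lp_add => //; exact: Lp_scale.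
  by apply: extension_cvg => //; exact: lin_cvg.
have LAv n : Lp (A (v n)) by exact: ALp.
have LAw n : Lp (A (w n)) by exact: ALp.
have := lin_cvg _ _ _ _ LAv LAw Lf' Lg' (extension_cvg Lf L2v Lv vf) (extension_cvg Lg L2w Lw wg).
rewrite (_ : (fun n => momr _) = (fun n => momr (fun x => A (fun x => a * v n x + w n x) x - (a * extension f x + extension g x))))//.
apply/funext => n; apply: momr_ae => //.
- by apply: Lp_sub => //; apply: Lp_add => //; exact: Lp_scale.
- by apply: Lp_sub => //; apply: Lp_add => //; exact: Lp_scale.
by have := Alin a (L2v n) (L2w n); apply: filterS => x ->.
Qed.

Lemma extension_bound f : Lp f -> momr (extension f) <= 2 `^ p * (B * momr f).
Proof.
move=> Lf; have [v [Lv L2v vle /dense_cvg vf]] := Lp_dense_seq p0 Lf.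
have [Lh _] := extensionP Lf.
apply: (momr_lim_le p0 (u := fun n => A (v n))) => //.
- by move=> n; exact: ALp.
- exact: extension_cvg.
- by move=> n; apply: le_trans (Abound (L2v n) (Lv n)) _; exact: ler_wpM2l.
Qed.

Lemma Lpnorm_le_momr (c : R) f g : 0 <= c -> Lp f -> Lp g -> momr f <= c * momr g ->
  (Lpnorm nu p%:E f <= (c `^ p^-1)%:E * Lpnorm nu p%:E g)%E.
Proof.
move=> c0 Lf Lg fg; rewrite !LpnormE -(EFin_momr p0 Lf) -(EFin_momr p0 Lg) !poweR_EFin.
rewrite -EFinM lee_fin -powRM ?momr_ge0//.
by apply: ge0_ler_powR; rewrite ?nnegrE ?momr_ge0 ?mulr_ge0 ?momr_ge0 ?invr_ge0 ?(ltW p0).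
Qed.

Lemma extension_Lp_bounded (T : operator X R) : Lp `&` L2 `<=` domain T ->
  (forall f, L2 f -> \forall x \ae nu, A f x = T f x) ->
  Lp_bounded_extension nu p%:E T extension.
Proof.
move=> dT AT; split => //.
- split => //.
  + exact: Lp0.
  + move=> f g Lf mg /aeqP fg; have [Lg H] := extension_ae Lf mg fg.
    by split => //; exact/aeqP.
  + by move=> f Lf; have [] := extensionP Lf.
  + move=> a f g Lf Lg; split; first by apply: Lp_add => //; exact: Lp_scale.
    by apply/aeqP; exact: extension_lin.
- exists ((2 `^ p * B) `^ p^-1) => f Lf; have [Lh _] := extensionP Lf.
  apply: Lpnorm_le_momr => //; first exact: mulr_ge0.
  by rewrite -mulrA; exact: extension_bound.
- move=> f Lf L2f; apply/aeqP.
  by apply: filterS2 (extension_eq L2f Lf) (AT f L2f) => x -> ->.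
Qed.

(** Concerns an arbitrary bounded extension S, whose own bound K' has no relation to B. That bound
    serves only for continuity of S; density then transfers the estimate of A. *)
Lemma extension_opnorm (T S : operator X R) :
  (forall f, L2 f -> \forall x \ae nu, A f x = T f x) ->
  Lp_bounded_extension nu p%:E T S ->
  (Lp_opnorm nu p%:E S <= ((2 `^ p * B) `^ p^-1)%:E)%E.
Proof.
move=> AT [[_ _ _ SLp Slin] dS [K' SK] _ ST].
apply: ge_ereal_sup => _ [f [Lf f1] <-].
have LS g : Lp g -> Lp (S g) by move=> Lg; apply: SLp; rewrite dS.
have [v [Lv L2v vle /dense_cvg vf]] := Lp_dense_seq p0 Lf.
have SfE : momr (S f) <= 2 `^ p * (B * momr f).
  apply: (momr_lim_le p0 (u := fun n => S (v n))) => //; last first.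
  - move=> n; apply: le_trans (ler_wpM2l B0 (vle n)).
    rewrite (_ : momr (S (v n)) = momr (A (v n))); first exact: Abound.
    apply: momr_ae => //; [exact: LS|exact: ALp|].
    have /aeqP H := ST _ (Lv n) (L2v n).
    by apply: filterS2 (AT _ (L2v n)) H => x -> ->.
  (* The sign of K' is unknown, hence the absolute value. *)
  - have cv : (`|K'| `^ p) * momr (fun x => v n x - f x) @[n --> \oo] --> (0 : R).
      by rewrite -[X in _ --> X](mulr0 (`|K'| `^ p)); apply: cvgMr.
    apply: squeeze0 cv => n; rewrite momr_ge0 /=.
    have Lvf := Lp_sub p0 (Lv n) Lf.
    have e : (fun x => v n x - f x) = (fun x => -1 * f x + v n x).
      by apply/funext => x; rewrite mulN1r addrC.
    have -> : momr (fun x => S (v n) x - S f x) = momr (S (fun x => v n x - f x)).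
      apply: momr_ae; [by apply: Lp_sub => //; exact: LS|exact: LS|].
      have dSf : domain S f by rewrite dS.
      have dSv : domain S (v n) by rewrite dS; exact: Lv.
      have [_ /aeqP] := Slin (-1) _ _ dSf dSv.
      by rewrite -e; apply: filterS => x ->; rewrite mulN1r addrC.
    have := SK _ Lvf; have LSv := LS _ Lvf.
    rewrite !LpnormE -(EFin_momr p0 LSv) -(EFin_momr p0 Lvf) !poweR_EFin -EFinM lee_fin => H.
    have {}H : momr (S (fun x => v n x - f x)) `^ p^-1 <=
        `|K'| * momr (fun x => v n x - f x) `^ p^-1.
      by apply: le_trans H _; apply: ler_wpM2r; [exact: powR_ge0|exact: ler_norm].
    have := ge0_ler_powR (ltW p0) _ _ H; rewrite !nnegrE powR_ge0 mulr_ge0 ?powR_ge0// => /(_ isT isT).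
    by rewrite powRM ?powR_ge0// -!powRrM mulVf ?gt_eqF// !powRr1 ?momr_ge0.
  - exact: LS.
  - by move=> n; exact: LS.
have := Lpnorm_le_momr (mulr_ge0 pp0 B0) (LS _ Lf) Lf; rewrite -mulrA => /(_ SfE) H.
apply: le_trans H _; rewrite -[leRHS]mule1.
by apply: lee_wpmul2l => //; rewrite lee_fin powR_ge0.
Qed.

End Extension.

(** * Riesz transforms *)

(* Exponents p > 2 are reduced to p / (p - 1) < 2 by symmetry of the form. *)
Definition riesz_const {R : realType} (p : R) : R :=
  if p <= 2 then 2 / (p - 1) + 3 else 2 / (p / (p - 1) - 1) + 3.

Lemma riesz_const_gt0 {R : realType} (p : R) : 1 < p -> 0 < riesz_const p.
Proof.
move=> p1; have pm : 0 < p - 1 by rewrite subr_gt0.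
rewrite /riesz_const; case: ifP => _; rewrite ltr_wpDl// divr_ge0//; first exact: ltW.
by rewrite subr_ge0 ler_pdivlMr// mul1r lerBlDr lerDl.
Qed.

Section PowersOfMultipliers.
Context {dX} {X : measurableType dX} {R : realType}.
Variable nu : {measure set X -> \bar R}.
Context {dO} {Omega : measurableType dO}.
Variable E : set Omega -> (X -> R[i]) -> (X -> R[i]).
Hypothesis hE : spectral_measure nu E.
Variable p : R.
Hypothesis p0 : 0 < p.
Implicit Types (f g h : X -> R[i]).
Local Notation L2 := (Lp nu 2%:E).
Local Notation Lp := (Lp nu p%:E).
Local Notation fc := (fc nu E).

(** Powers of the symbol are iterates of the operator, so the operator bound, unlike the form bound,
    can be multiplied. *)
Lemma fc_pow_bound m (A : R) n : 0 <= A -> bmeas m ->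
  (forall f, L2 f -> Lp f -> (mom nu p (fc m f) <= A%:E * mom nu p f)%E) ->
  forall f, L2 f -> Lp f -> Lp (fc (fun l => m l ^+ n) f) /\
    momr nu p (fc (fun l => m l ^+ n) f) <= A ^+ n * momr nu p f.
Proof.
move=> A0 bm H f L2f Lf; elim: n => [|n [IH1 IH2]].
  have fE : \forall x \ae nu, f x = fc (fun l => m l ^+ 0) f x.
    rewrite (_ : (fun l => m l ^+ 0) = cst 1); last by apply/funext => l; rewrite expr0.
    by apply: filterS (fc_cst1 hE L2f) => x ->.
  have L2e : L2 (fc (fun l => m l ^+ 0) f) by apply: (fc_L2 hE) => //; exact: bmeasX.
  have Le := Lp_ae p0 Lf (L2_measurable L2e) fE.
  by split=> //; rewrite expr0 mul1r (momr_ae Lf Le fE).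
have bn : bmeas (fun l => m l ^+ n) by exact: bmeasX.
have L2n := fc_L2 hE bn L2f.
have cE := fc_comp hE bn bm L2f.
rewrite (_ : (fun l => m l ^+ n.+1) = (fun l => m l * m l ^+ n)); last first.
  by apply/funext => l; rewrite exprS.
have L2S : L2 (fc (fun l => m l * m l ^+ n) f) by apply: (fc_L2 hE) => //; exact: bmeasM.
have L2c := fc_L2 hE bm L2n.
have Lc : Lp (fc m (fc (fun l => m l ^+ n) f)).
  apply/(LpP _ _ p0); split; first exact: L2_measurable L2c.
  apply: le_lt_trans (H _ L2n IH1) _.
  by rewrite -(EFin_momr p0 IH1) -EFinM ltry.
have LS := Lp_ae p0 Lc (L2_measurable L2S) cE.
split=> //; rewrite -(momr_ae Lc LS cE) exprS -mulrA.
apply: (@le_trans _ _ (A * momr nu p (fc (fun l => m l ^+ n) f))).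
  by rewrite -lee_fin EFinM (EFin_momr p0 Lc) (EFin_momr p0 IH1); exact: H.
exact: ler_wpM2l.
Qed.

End PowersOfMultipliers.

Section RieszTransforms.
Context {dX} {X : measurableType dX} {R : realType}.
Variable nu : {measure set X -> \bar R}.
Variable d : nat.
Variable L : 'I_d -> operator X R.
Variable EL : 'I_d -> set (measurableTypeR R) -> (X -> R[i]) -> (X -> R[i]).
Variable E : set (d.-tuple (measurableTypeR R)) -> (X -> R[i]) -> (X -> R[i]).
Hypothesis linL : forall r, linear_operator nu 2%:E (L r).
Hypothesis posL : forall r, nonneg_operator nu (L r).
Hypothesis hEL : forall r, spectral_measure_of nu (L r) (EL r).
Hypothesis hEJ : joint_spectral_measure nu L E.
Hypothesis contr : forall r (q : \bar R) (t : R), (1 <= q)%E -> 0 < t ->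
  forall f, Lp nu q f -> Lp nu 2%:E f ->
  (Lpnorm nu q (semigroup nu (EL r) t f) <= Lpnorm nu q f)%E.
Implicit Types (f g h : X -> R[i]).
Local Notation L2 := (Lp nu 2%:E).
Local Notation fc := (fc nu E).
Local Notation lam := (fun (r : 'I_d) (l : d.-tuple (measurableTypeR R)) => tnth l r : R).

Let hE : spectral_measure nu E. Proof. by case: hEJ. Qed.

Let mlam r : measurable_fun setT (lam r).
Proof. exact: measurable_tnth. Qed.

Let cD : carrier nu E [set l | forall r, 0 <= lam r l].
Proof.
split; last by case: hEJ => _ H _ f Lf; apply/aeqP; exact: H.
rewrite (_ : mkset _ = \bigcap_(r in [set: 'I_d]) (lam r @^-1` `[0, +oo[%classic)).
  apply: fin_bigcap_measurable => // r _.
  by rewrite -[X in measurable X]setTI; exact: mlam.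
apply/seteqP; split => l /= H r; have := H r; first by rewrite /= in_itv /= andbT.
by rewrite /= in_itv /= andbT; apply.
Qed.

Let bexp r t : 0 < t -> bmeas (fun l => expind t (lam r l)).
Proof. by move=> t0; apply: (bmeas_expind mlam); exact: ltW. Qed.

Let semigroupE r t f : 0 < t -> L2 f ->
  \forall x \ae nu, semigroup nu (EL r) t f x = fc (fun l => expind t (lam r l)) f x.
Proof.
move=> t0 Lf; have [hr LEr] := hEL r.
have [_ _ LE] := hEJ.
have s1 := semigroup_fc (linL r) (@posL r) (hEL r) t0 Lf.
have s2 := fc_expind hr hE (@measurable_id _ _ setT) (@mlam r) (linL r) (@posL r) LEr (LE r) t0 Lf.
by apply: filterS2 s1 s2 => x -> ->.
Qed.

Let bT r t : 0 < t -> bicontraction nu (fc (fun l => expind t (lam r l))).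
Proof.
move=> t0; apply: (fc_bicontraction hE (bexp r t0) (S := semigroup nu (EL r) t)).
- by move=> f; exact: spectral_integral_L2.
- by move=> f Lf; exact: semigroupE.
- by move=> q f q1 Lqf Lf; exact: contr.
Qed.

Let momT r t q f : 0 < t -> 1 <= q -> L2 f ->
  (mom nu q (fc (fun l => expind t (lam r l)) f) <= mom nu q f)%E.
Proof.
move=> t0 q1 Lf; apply: (fc_mom_le hE (bexp r t0) (S := semigroup nu (EL r) t)) => //.
- by move=> g; exact: spectral_integral_L2.
- by move=> g Lg; exact: semigroupE.
- by move=> q' g q1' Lqg Lg; exact: contr.
Qed.

Local Notation T r := (ratio lam (fun=> 1) r).

Let w1 (i : 'I_d) : 0 < (fun=> 1 : R) i. Proof. exact: ltr01. Qed.

Lemma riesz_frac_bound p s r f : 1 < p -> 0 < s -> s < 1 -> L2 f -> Lp nu p%:E f ->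
  (mom nu p (fc (fun l => T r l `^ s)%R f) <=
   (dual_const p (riesz_const p))%:E * mom nu p f)%E.
Proof.
move=> p1 s0 s1 Lf Lpf; have pm : 0 < p - 1 by rewrite subr_gt0.
have K0 := riesz_const_gt0 p1.
apply: (multiplier_dual hE p1 (erefl (p / (p - 1))) K0) => //.
rewrite /riesz_const; have [p2|p2] := leP p 2.
  exact: (multiplier_ratio_powR hE mlam cD bT momT r p1 p2 erefl s0 s1).
(* For p > 2 the exponent p / (p - 1) lies in ]1, 2[, and its conjugate is p. *)
apply: multiplier_swap => //.
apply: (multiplier_ratio_powR hE mlam cD bT momT r _ _ _ s0 s1).
- by rewrite ltr_pdivlMr// mul1r gtrBl.
- by rewrite ler_pdivrMr//; lra.
- have -> : p / (p - 1) - 1 = (p - 1)^-1 by move: pm => /lt0r_neq0 ?; field.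
  by rewrite invrK divfK// gt_eqF.
Qed.

Let bpow r s : 0 <= s -> bmeas (fun l => T r l `^ s).
Proof.
move=> s0; have [mr _] := bmeas_ratio mlam r w1; split.
  exact: (measurableT_comp (measurable_powR s) mr).
exists 1 => l; rewrite ger0_norm ?powR_ge0//.
have T1 := ratio_le1 lam r l w1; have T0 := ratio_ge0 lam r l w1.
by have := ge0_ler_powR s0 _ _ T1; rewrite powR1; apply; rewrite nnegrE ?ler01.
Qed.

Lemma riesz_pow_bound p sigma r n f : 1 < p -> 0 < sigma -> sigma < n%:R -> L2 f -> Lp nu p%:E f ->
  Lp nu p%:E (fc (fun l => T r l `^ sigma) f) /\
  momr nu p (fc (fun l => T r l `^ sigma) f) <=
    dual_const p (riesz_const p) ^+ n * momr nu p f.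
Proof.
move=> p1 s0 sn Lf Lpf; have p0 : 0 < p by exact: lt_trans p1.
have n0 : 0 < n%:R :> R by exact: lt_trans sn.
have sn0 : 0 < sigma / n%:R by exact: divr_gt0.
have sn1 : sigma / n%:R < 1 by rewrite ltr_pdivrMr// mul1r.
rewrite (_ : (fun l => T r l `^ sigma) = (fun l => (T r l `^ (sigma / n%:R)) ^+ n)).
  apply: (fc_pow_bound hE p0) => //.
  - by apply: dual_const_ge0; exact: riesz_const_gt0.
  - by apply: bpow; exact: ltW.
  - by move=> g Lg Lpg; exact: riesz_frac_bound.
by apply/funext => l; rewrite -powR_mulrn ?powR_ge0// -powRrM divfK// gt_eqF.
Qed.

(** The symbol [riesz_multiplier] agrees with the power of the ratio on the closed positive orthant
    D only, including the origin, where both are 0. Since D carries the joint measure, f can be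
    replaced by its projection to D, which makes the symbol bounded. *)
Lemma riesz_spectral_integral sigma r f : 0 < sigma -> L2 f ->
  domain (spectral_integral nu E (riesz_multiplier r sigma)) f /\
  \forall x \ae nu, fc (fun l => T r l `^ sigma) f x =
    spectral_integral nu E (riesz_multiplier r sigma) f x.
Proof.
move=> s0 Lf.
pose phi (l : d.-tuple (measurableTypeR R)) : R :=
  (tnth l r : R) `^ sigma * (\sum_(s < d) (tnth l s : R)) `^ (- sigma).
have mphi : measurable_fun setT phi.
  apply: measurable_funM.
    exact: (measurableT_comp (measurable_powR sigma) (@mlam r)).
  apply: (measurableT_comp (measurable_powR _)).
  by apply: measurable_sum => i; exact: mlam.
pose D := [set l | forall r, 0 <= lam r l].
have mD : measurable D by case: cD.
have bD : bmeas (\1_D : d.-tuple (measurableTypeR R) -> R) by exact: bmeas_indic.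
have bp := bpow r (ltW s0).
have eD l : D l -> phi l = T r l `^ sigma.
  move=> Dl; rewrite /phi /ratio.
  have -> : \sum_i 1 * Num.max (tnth l i : R) 0 = \sum_i (tnth l i : R).
    by apply: eq_bigr => i _; rewrite mul1r max_l//; exact: Dl.
  rewrite mul1r max_l; last exact: Dl.
  have S0 : 0 <= \sum_i (tnth l i : R) by apply: sumr_ge0 => i _; exact: Dl.
  have t0 : 0 <= (tnth l r : R) := Dl r.
  rewrite powRM ?t0 ?invr_ge0 ?S0//.
  by rewrite -powR_inv1// -powRrM mulN1r.
have eD' l : phi l * \1_D l = \1_D l * T r l `^ sigma.
  rewrite indicE; have [|_] := boolP (l \in D); last by rewrite mulr0 mul0r.
  by rewrite inE => Dl; rewrite mulr1 mul1r eD.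
have bphi : bmeas (fun l => phi l * \1_D l).
  by rewrite (funext eD'); exact: bmeasM.
have fE : \forall x \ae nu, f x = fc \1_D f x.
  have e1 : \forall x \ae nu, fc \1_D f x = fc (cst 1) f x.
    apply: (fc_eq_carrier hE cD bD (bmeas_cst 1) _ Lf) => l Dl.
    by rewrite indicE mem_set.
  by apply: filterS2 (fc_cst1 hE Lf) e1 => x -> ->.
have [dom eI] := spectral_integral_fc hE mphi bD bphi Lf Lf fE.
split=> //.
have e2 : \forall x \ae nu, fc (fun l => phi l * \1_D l) f x = fc (fun l => T r l `^ sigma) f x.
  apply: (fc_eq_carrier hE cD bphi bp _ Lf) => l Dl.
  by rewrite indicE mem_set// mulr1 eD.
by apply: filterS2 eI e2 => x H <-; rewrite -H.
Qed.

Lemma riesz_extension p sigma r n : 1 < p -> 0 < sigma -> sigma < n%:R ->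
  (exists S, Lp_bounded_extension nu p%:E
     (spectral_integral nu E (riesz_multiplier r sigma)) S) /\
  (forall S, Lp_bounded_extension nu p%:E
     (spectral_integral nu E (riesz_multiplier r sigma)) S ->
   (Lp_opnorm nu p%:E S <=
    ((2 `^ p * dual_const p (riesz_const p) ^+ n) `^ p^-1)%:E)%E).
Proof.
move=> p1 s0 sn; have p0 : 0 < p by exact: lt_trans p1.
have B0 : 0 <= dual_const p (riesz_const p) ^+ n.
  by rewrite exprn_ge0// dual_const_ge0// riesz_const_gt0.
have ALp f : L2 f -> Lp nu p%:E f -> Lp nu p%:E (fc (fun l => T r l `^ sigma) f).
  by move=> Lf Lpf; have [] := riesz_pow_bound r p1 s0 sn Lf Lpf.
have Abd f : L2 f -> Lp nu p%:E f -> momr nu p (fc (fun l => T r l `^ sigma) f) <=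
    dual_const p (riesz_const p) ^+ n * momr nu p f.
  by move=> Lf Lpf; have [] := riesz_pow_bound r p1 s0 sn Lf Lpf.
have Alin a f g : L2 f -> L2 g -> \forall x \ae nu,
    fc (fun l => T r l `^ sigma) (fun x => a * f x + g x) x =
    a * fc (fun l => T r l `^ sigma) f x + fc (fun l => T r l `^ sigma) g x.
  by move=> Lf Lg; exact: (fc_lin hE a (bpow r (ltW s0)) Lf Lg).
have AT f : L2 f -> \forall x \ae nu, fc (fun l => T r l `^ sigma) f x =
    spectral_integral nu E (riesz_multiplier r sigma) f x.
  by move=> Lf; have [] := riesz_spectral_integral r s0 Lf.
split.
  exists (extension nu p (fc (fun l => T r l `^ sigma)) (dual_const p (riesz_const p) ^+ n)).
  apply: (extension_Lp_bounded p0 B0 ALp Alin Abd) => //.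
  by move=> f [_ Lf]; have [] := riesz_spectral_integral r s0 Lf.
move=> S HS; exact: (extension_opnorm p0 B0 ALp Abd AT HS).
Qed.

End RieszTransforms.

Theorem theorem3p1 (R : realType) (p sigma : R) (hp : 1 < p) (hsigma : 0 < sigma) :
  exists C : R,
  forall (d : nat) (hd : (1 <= d)%N)
    (dX : measure_display) (X : measurableType dX)
    (nu : {sigma_finite_measure set X -> \bar R})
    (L : 'I_d -> operator X R)
    (EL : 'I_d -> set (measurableTypeR R) -> (X -> R[i]) -> (X -> R[i]))
    (E : set (d.-tuple (measurableTypeR R)) -> (X -> R[i]) -> (X -> R[i])),
    (forall r, self_adjoint nu (L r)) ->
    (forall r, nonneg_operator nu (L r)) ->
    (forall r, spectral_measure_of nu (L r) (EL r)) ->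
    commute_strongly nu EL ->
    joint_spectral_measure nu L E ->
    (forall r (q : \bar R) (t : R), (1 <= q)%E -> 0 < t ->
       forall f, Lp nu q f -> Lp nu 2%:E f ->
       (Lpnorm nu q (semigroup nu (EL r) t f) <= Lpnorm nu q f)%E) ->
    (forall r f, Lp nu 2%:E f -> EL r [set 0] f = (fun=> 0) %[ae nu]) ->
    (forall r, exists S : operator X R,
       Lp_bounded_extension nu p%:E
         (spectral_integral nu E (riesz_multiplier r sigma)) S) /\
    (forall S : 'I_d -> operator X R,
       (forall r, Lp_bounded_extension nu p%:E
          (spectral_integral nu E (riesz_multiplier r sigma)) (S r)) ->
       (\big[maxe/0%E]_(r < d) Lp_opnorm nu p%:E (S r) <= C%:E)%E).
Proof.
(* The integer n is fixed before d, X and L, so the constant depends on p and sigma alone. *)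
have [n _ /(_ n (leqnn n)) /= sn] := nbhs_infty_gtr sigma.
exists ((2 `^ p * dual_const p (riesz_const p) ^+ n) `^ p^-1).
move=> d _ dX X nu L EL E saL posL hEL _ hEJ contr _.
have linL r : linear_operator nu 2%:E (L r) by have [] := saL r.
have H r := riesz_extension linL posL hEL hEJ contr r hp hsigma sn.
split=> [r|S HS]; first by have [] := H r.
(* The maximum starts from 0, so the non-negativity of the constant has to be checked too. *)
elim/big_ind : _ => [|x y xC yC|r _].
- by rewrite lee_fin powR_ge0.
- by rewrite ge_max xC yC.
- by have [_] := H r; apply.
Qed.
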